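(* Let $n,m\ge1$ be integers. Regard $\mathbb{P}_n(1)\times\mathbb{P}_m(1)$ with the torus action $\Phi_n\times\Phi_m$ as the regular torification of the product family $\mathcal{P}_{n+1}^\times\times\mathcal{P}_{m+1}^\times$, and $\mathbb{P}_{(n+1)(m+1)-1}(1)$ with the action $\Phi_{(n+1)(m+1)-1}$ as the regular torification of $\mathcal{P}_{(n+1)(m+1)}^\times$. Then the Segre embedding $$\mathbb{P}_n(1)\times\mathbb{P}_m(1)\to\mathbb{P}_{(n+1)(m+1)-1}(1),\qquad([z_i],[w_j])\mapsto[z_iw_j],$$ where $i=0,\dots,n$, $j=0,\dots,m$ and the lexicographic ordering is adopted, is a lift of the inclusion map $\mathcal{P}_{n+1}^\times\times\mathcal{P}_{m+1}^\times\to\mathcal{P}_{(n+1)(m+1)}^\times$.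
   Context: Dually flat spaces. A linear connection is flat if its torsion and curvature both vanish. If $(M,h)$ is a Riemannian manifold with a linear connection $\nabla$, the dual connection $\nabla^*$ is the unique linear connection with $Xh(Y,Z)=h(\nabla_XY,Z)+h(Y,\nabla^*_XZ)$ for all vector fields $X,Y,Z$. The triple $(M,h,\nabla)$ is a dually flat space if $\nabla$ and $\nabla^*$ are both flat. Kähler structure on $TM$ (Dombrowski). Let $(M,h,\nabla)$ be dually flat, $\pi:TM\to M$ the projection, and $K:TTM\to TM$ the connector of $\nabla$ (the map, linear on each $T_u(TM)$, with $K(Y_*X)=\nabla_XY$ for all vector fields). For $u\in T_pM$ the map $A\mapsto(\pi_*A,KA)$ identifies $T_u(TM)$ with $T_pM\oplus T_pM$; under it set $g_u((v,w),(v',w'))=h_p(v,v')+h_p(w,w')$, $J_u(v,w)=(-w,v)$, $\omega_u((v,w),(v',w'))=h_p(v,w')-h_p(w,v')$. This makes $TM$ a Kähler manifold, and $TM$ always carries this structure. Parallel lattices. Let $(M,h,\nabla)$ be connected, $\dim M=n$. A parallel lattice is a subset $L\subset TM$ of the form $L=\{\sum_i k_iX_i(p)\mid p\in M,\ k_i\in\mathbb{Z}\}$ where $X=(X_1,\dots,X_n)$ are $\nabla$-parallel vector fields forming a basis of $T_pM$ at every $p$; $X$ is called a generator of $L$. $\Gamma(L)$ is the group of maps $TM\to TM$, $u\mapsto u+\sum_ik_iX_i$ ($k\in\mathbb{Z}^n$); it does not depend on the generator, acts freely and properly by holomorphic isometries, and $M_L=TM/\Gamma(L)$ carries the quotient Kähler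 structure, with quotient map $q_L:TM\to M_L$. Put $\mathbb{T}^n=\mathbb{R}^n/\mathbb{Z}^n$; for a generator $X$ let $\Phi_X([t],q_L(u))=q_L(u+\sum_it_iX_i)$, an action of $\mathbb{T}^n$ on $M_L$. Torifications and lifts. Let $N$ be a connected Kähler manifold of real dimension $2n$ with an effective holomorphic isometric action $\Phi:\mathbb{T}^n\times N\to N$; write $\Phi_a=\Phi(a,\cdot)$ and let $N^\circ$ be the set of points where $\Phi$ is free. $N$ (or $\Phi$) is a torification of the connected $n$-dimensional dually flat space $(M,h,\nabla)$ if there is a toric parametrization, i.e. a triple $(L,X,F)$ where $L$ is a parallel lattice generated by $X$ and $F:M_L\to N^\circ$ is a holomorphic isometric diffeomorphism with $F\circ(\Phi_X)_a=\Phi_a\circ F$ for all $a\in\mathbb{T}^n$. A compatible covering map is a map $\tau:TM\to N^\circ$ of the form $\tau=F\circ q_L$ for some toric parametrization $(L,X,F)$. A torification is regular if $N$ is connected, simply connected, complete with real analytic Kähler metric. A smooth map $m:N\to N'$ is a lift of a smooth map $f:M\to M'$ if there are compatible covering maps $\tau:TM\to N^\circ$ and $\tau':TM'\to(N')^\circ$ such that $m\circ\tau=\tau'\circ f_*$. Families of distributions. For a finite set of $n+1$ ordered elements $\{x_0,\dots,x_n\}$, $\mathcal{P}_{n+1}^\times$ is the set of all $p>0$ on it with $\sum p=1$; natural parameters $\theta\in\mathbb{R}^n$: $p(x_{i})=e^{\theta_{i+1}-\psi}$ ($i<n$), $p(x_n)=e^{-\psi}$, $\psi=\ln(1+\sum_{i=1}^ne^{\theta_i})$.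 The product of exponential families $\mathcal{E}_1,\mathcal{E}_2$ over finite sets $\Omega_1,\Omega_2$ is the set of all $p:\Omega_1\times\Omega_2\to\mathbb{R}$ of the form $p(x,y)=p_1(x)p_2(y)$ with $p_i\in\mathcal{E}_i$; it is an exponential family over $\Omega_1\times\Omega_2$ with natural parameters $(\theta,\theta')$ and cumulant generating function $\psi_1(\theta)+\psi_2(\theta')$. All these families are dually flat with the Fisher metric (components $\mathbb{E}_{p_\theta}(\partial_i\ln p_\theta\cdot\partial_j\ln p_\theta)$, equal to the Hessian of the cumulant generating function in the natural parameters) and the exponential connection (the flat connection for which the natural parameters are affine coordinates). In the claim, $\mathcal{P}_{(n+1)(m+1)}^\times$ is taken over $\{x_0,\dots,x_n\}\times\{y_0,\dots,y_m\}$ with lexicographic order. $\mathbb{P}_n(1)$ is complex projective space of complex dimension $n$ with the Fubini–Study metric of holomorphic sectional curvature $1$; $\Phi_n([t],[z_0,\dots,z_n])=[e^{2i\pi t_1}z_0,\dots,e^{2i\pi t_n}z_{n-1},z_n]$; $(\Phi_n\times\Phi_m)((a,b),(x,y))=(\Phi_n(a,x),\Phi_m(b,y))$. These are regular torifications of the families as indicated in the claim. *)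

(* Defs.v *)
From HB Require Import structures.
From mathcomp Require Import all_boot all_order all_algebra.
From mathcomp Require Import complex.
From mathcomp Require Import all_classical all_reals all_analysis.

Set Implicit Arguments.
Unset Strict Implicit.
Unset Printing Implicit Defensive.

Import numFieldNormedType.Exports.
Import Order.TTheory GRing.Theory Num.Theory.

Local Open Scope classical_set_scope.
Local Open Scope ring_scope.

Definition some_such (T : Type) (x0 : T) (P : set T) : T :=
  match pselect (exists x, P x) with
  | left ex => projT1 (cid ex)
  | right _ => x0
  end.

(* The set of classes of an equivalence relation given by [e u], the class
   of [u]. *)
Definition quot (T : Type) (e : T -> set T) := {A : set T | exists u, A = e u}.

Definition cls (T : Type) (e : T -> set T) (u : T) : quot e :=
  exist _ (e u) (ex_intro _ u erefl).

Definition rep (T : Type) (e : T -> set T) (A : quot e) : T :=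
  projT1 (cid (proj2_sig A)).

Fixpoint Ck (R : realType) (V W : normedModType R) (k : nat) (U : set V)
    (f : V -> W) : Prop :=
  match k with
  | 0 => forall x, U x -> {for x, continuous f}
  | k'.+1 => (forall x, U x -> differentiable f x) /\
             forall v, Ck k' U (fun x => 'd f x v)
  end.

(* Meaningful for open [U] only. *)
Definition smooth (R : realType) (V W : normedModType R) (U : set V)
    (f : V -> W) : Prop := forall k, Ck k U f.

(* An atlas with a preferred chart [prefer p] around every point [p].  The
   tangent space at [p] is the space 'rV_d of components in that preferred
   chart.  The axioms are in [is_manifold]. *)
Record mfd (R : realType) (d : nat) := Mfd {
  carrier :> Type;
  chart : Type;
  dom : chart -> set carrier;
  coord : chart -> carrier -> 'rV[R]_d;
  point : chart -> 'rV[R]_d -> carrier;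
  prefer : carrier -> chart }.

Arguments Mfd {R d carrier chart} dom coord point prefer.
Arguments dom {R d m} _ _.
Arguments coord {R d m} _ _.
Arguments point {R d m} _ _.
Arguments prefer {R d m} _.

Section Manifolds.
Context {R : realType}.

Section One.
Context {d : nat} (M : mfd R d).

Definition cod (i : chart M) : set 'rV[R]_d := coord i @` dom i.

Definition mopen (S : set M) : Prop :=
  forall i : chart M, open (coord i @` (dom i `&` S)).

Definition is_manifold : Prop :=
  [/\ (forall p : M, dom (prefer p) p),
      (forall (i : chart M) (p : M), dom i p -> point i (coord i p) = p),
      (forall i j : chart M,
         let U := coord i @` (dom i `&` dom j) in
         open U /\ smooth U (coord j \o point i)),
      (forall p q : M, p <> q ->
         exists S T : set M,
           [/\ mopen S, mopen T, S p, T q & S `&` T = set0])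
    & (exists c : nat -> chart M, forall p : M, exists k, dom (c k) p)].

Definition mconnected : Prop :=
  forall S : set M, mopen S -> mopen (~` S) -> S = set0 \/ S = setT.

(* Change of components of a tangent vector between the chart [i] and the
   preferred one: [vec] takes components in [i] at [point i x], [comp] returns
   them. *)
Definition vec (i : chart M) (x : 'rV[R]_d) (a : 'rV[R]_d) : 'rV[R]_d :=
  'd (coord (prefer (point i x)) \o point i) x a.

Definition comp (i : chart M) (p : M) (v : 'rV[R]_d) : 'rV[R]_d :=
  'd (coord i \o point (prefer p)) (coord (prefer p) p) v.

Definition vfield : Type := M -> 'rV[R]_d.

Definition vf_comp (i : chart M) (X : vfield) (x : 'rV[R]_d) : 'rV[R]_d :=
  comp i (point i x) (X (point i x)).

Definition smooth_vf (X : vfield) : Prop :=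
  forall i : chart M, smooth (cod i) (vf_comp i X).

Definition smooth_fun (f : M -> R) : Prop :=
  forall i : chart M, smooth (cod i) (f \o point i).

Definition vf_app (X : vfield) (f : M -> R) (p : M) : R :=
  'd (f \o point (prefer p)) (coord (prefer p) p) (X p).

Definition bracket (X Y : vfield) : vfield := fun p =>
  let i := prefer p in let x := coord i p in
  'd (vf_comp i Y) x (X p) - 'd (vf_comp i X) x (Y p).

End One.

Definition mdiff {d d' : nat} (M : mfd R d) (M' : mfd R d') (f : M -> M')
    (p : M) (v : 'rV[R]_d) : 'rV[R]_d' :=
  'd (coord (prefer (f p)) \o f \o point (prefer p)) (coord (prefer p) p) v.

(* Smoothness on an open subset [S].  The openness of the domains of the
   coordinate expressions is the continuity of [f]. *)
Definition msmooth_on {d d' : nat} (M : mfd R d) (M' : mfd R d') (S : set M)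
    (f : M -> M') : Prop :=
  forall (i : chart M) (j : chart M'),
    let U := coord i @` (dom i `&` S `&` f @^-1` dom j) in
    open U /\ smooth U (coord j \o f \o point i).

Definition msmooth {d d' : nat} (M : mfd R d) (M' : mfd R d')
    (f : M -> M') : Prop := msmooth_on setT f.

Definition diffeo_onto {d d' : nat} (M : mfd R d) (M' : mfd R d')
    (f : M -> M') (S : set M') : Prop :=
  [/\ msmooth f, range f = S
    & exists g : M' -> M, cancel f g /\ msmooth_on S g].

Definition euclid (n : nat) : mfd R n :=
  @Mfd R n 'rV[R]_n unit (fun _ => setT) (fun _ x => x) (fun _ x => x)
    (fun _ => tt).

Definition prod_mfd {d d' : nat} (M : mfd R d) (M' : mfd R d') :
    mfd R (d + d') :=
  @Mfd R (d + d') (M * M') (chart M * chart M')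
    (fun i => [set p | dom i.1 p.1 /\ dom i.2 p.2])
    (fun i p => row_mx (coord i.1 p.1) (coord i.2 p.2))
    (fun i x => (point i.1 (lsubmx x), point i.2 (rsubmx x)))
    (fun p => (prefer p.1, prefer p.2)).

Definition tangent {d : nat} (M : mfd R d) : mfd R (d + d) :=
  @Mfd R (d + d) (M * 'rV[R]_d) (chart M)
    (fun i => [set u | dom i u.1])
    (fun i u => row_mx (coord i u.1) (comp i u.1 u.2))
    (fun i x => (point i (lsubmx x), vec i (lsubmx x) (rsubmx x)))
    (fun u => prefer u.1).

Definition push {d d' : nat} (M : mfd R d) (M' : mfd R d') (f : M -> M')
    (u : tangent M) : tangent M' := (f u.1, mdiff f u.1 u.2).

End Manifolds.

Record riem (R : realType) (d : nat) := Riem {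
  riem_mfd :> mfd R d;
  met : riem_mfd -> 'rV[R]_d -> 'rV[R]_d -> R }.

Record herm (R : realType) (d : nat) := Herm {
  herm_riem :> riem R d;
  cpx : herm_riem -> 'rV[R]_d -> 'rV[R]_d }.

Record affine (R : realType) (n : nat) := Affine {
  affine_riem :> riem R n;
  nabla : vfield affine_riem -> vfield affine_riem -> vfield affine_riem }.

Arguments Riem {R d riem_mfd} met.
Arguments Herm {R d herm_riem} cpx.
Arguments Affine {R n affine_riem} nabla.
Arguments met {R d r} _ _ _.
Arguments cpx {R d h} _ _.
Arguments nabla {R n a} _ _.

Section Geometry.
Context {R : realType}.

Definition is_riemannian {d : nat} (M : riem R d) : Prop :=
  [/\ is_manifold M,
      (forall (p : M) v w, met p v w = met p w v),
      (forall (p : M) v (c : R) w w',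
         met p v (c *: w + w') = c * met p v w + met p v w'),
      (forall (p : M) v, v != 0 -> 0 < met p v v)
    & (forall (i : chart M) a b,
         smooth (cod i)
           (fun x => met (point i x) (vec i x a) (vec i x b)))].

Definition isometric {d d' : nat} (M : riem R d) (M' : riem R d')
    (f : M -> M') : Prop :=
  forall p v w, met (f p) (mdiff f p v) (mdiff f p w) = met p v w.

Definition holomorphic {d d' : nat} (M : herm R d) (M' : herm R d')
    (f : M -> M') : Prop :=
  forall p v, mdiff f p (cpx p v) = cpx (f p) (mdiff f p v).

(* On a tangent bundle this is h(v,w') - h(w,v') at ((v,w),(v',w')). *)
Definition omega {d : nat} (M : herm R d) (p : M) (v w : 'rV[R]_d) : R :=
  met p (cpx p v) w.

Definition closed_omega {d : nat} (M : herm R d) : Prop :=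
  forall (i : chart M) (x : 'rV[R]_d), cod i x -> forall a b c,
    let om a b y := omega (point i y) (vec i y a) (vec i y b) in
    'd (om b c) x a + 'd (om c a) x b + 'd (om a b) x c = 0.

Definition nijenhuis_free {d : nat} (M : herm R d) : Prop :=
  forall X Y : vfield M, smooth_vf X -> smooth_vf Y -> forall p,
    let J (Z : vfield M) : vfield M := fun q => cpx q (Z q) in
    bracket X Y p + J (bracket (J X) Y) p + J (bracket X (J Y)) p
      - bracket (J X) (J Y) p = 0.

Definition is_kahler {d : nat} (M : herm R d) : Prop :=
  [/\ is_riemannian M,
      (forall (p : M), linear (cpx p)) /\
      (forall (p : M) v, cpx p (cpx p v) = - v),
      (forall (p : M) v w, met p (cpx p v) (cpx p w) = met p v w),
      (forall (i : chart M) a,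
         smooth (cod i) (fun x => comp i (point i x) (cpx (point i x) (vec i x a))))
    & nijenhuis_free M /\ closed_omega M].

Section Connections.
Context {n : nat} {M : mfd R n}.
Implicit Types (D : vfield M -> vfield M -> vfield M) (X Y Z : vfield M).

Definition is_connection D : Prop :=
  [/\ (forall X Y, smooth_vf X -> smooth_vf Y -> smooth_vf (D X Y)),
      (forall X X' Y p, smooth_vf X -> smooth_vf X' -> smooth_vf Y ->
         D (fun q => X q + X' q) Y p = D X Y p + D X' Y p),
      (forall (f : M -> R) X Y p, smooth_fun f -> smooth_vf X -> smooth_vf Y ->
         D (fun q => f q *: X q) Y p = f p *: D X Y p),
      (forall X Y Y' p, smooth_vf X -> smooth_vf Y -> smooth_vf Y' ->
         D X (fun q => Y q + Y' q) p = D X Y p + D X Y' p)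
    & (forall (f : M -> R) X Y p, smooth_fun f -> smooth_vf X -> smooth_vf Y ->
         D X (fun q => f q *: Y q) p = vf_app X f p *: Y p + f p *: D X Y p)].

Definition is_flat D : Prop :=
  (forall X Y, smooth_vf X -> smooth_vf Y -> forall p,
     D X Y p - D Y X p - bracket X Y p = 0) /\
  (forall X Y Z, smooth_vf X -> smooth_vf Y -> smooth_vf Z -> forall p,
     D X (D Y Z) p - D Y (D X Z) p - D (bracket X Y) Z p = 0).

Definition is_parallel D X : Prop :=
  forall Y, smooth_vf Y -> forall p, D Y X p = 0.

Definition is_connector D (K : tangent M -> 'rV[R]_(n + n) -> 'rV[R]_n) : Prop :=
  (forall u, linear (K u)) /\
  (forall X Y, smooth_vf X -> smooth_vf Y -> forall p : M,
     K (p, Y p) (mdiff (fun q : M => (q, Y q) : tangent M) p (X p)) = D X Y p).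

Definition connector D : tangent M -> 'rV[R]_(n + n) -> 'rV[R]_n :=
  some_such (fun _ _ => 0) (is_connector D).

End Connections.

Definition dual_connections {n : nat} (M : riem R n)
    (D D' : vfield M -> vfield M -> vfield M) : Prop :=
  forall X Y Z, smooth_vf X -> smooth_vf Y -> smooth_vf Z -> forall p,
    vf_app X (fun q => met q (Y q) (Z q)) p
      = met p (D X Y p) (Z p) + met p (Y p) (D' X Z p).

Definition is_dually_flat {n : nat} (M : affine R n) : Prop :=
  [/\ is_riemannian M, is_connection (@nabla R n M), is_flat (@nabla R n M)
    & exists D' : vfield M -> vfield M -> vfield M,
        [/\ is_connection D', dual_connections (@nabla R n M) D' & is_flat D']].

End Geometry.

Section Dombrowski.
Context {R : realType} {n : nat} (M : affine R n).

Let TM : mfd R (n + n) := tangent M.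
Let dpi (u : TM) (A : 'rV[R]_(n + n)) : 'rV[R]_n :=
  mdiff (fun w : TM => w.1 : M) u A.
Let K : TM -> 'rV[R]_(n + n) -> 'rV[R]_n := connector (@nabla R n M).

Definition tangent_herm : herm R (n + n) :=
  @Herm R (n + n)
    (@Riem R (n + n) TM (fun u A B =>
       met u.1 (dpi u A) (dpi u B) + met u.1 (K u A) (K u B)))
    (fun u A => some_such 0 [set B | dpi u B = - K u A /\ K u B = dpi u A]).

Definition translate (X : 'I_n -> vfield M) (t : 'rV[R]_n) (u : TM) : TM :=
  (u.1, u.2 + \sum_(i < n) t 0 i *: X i u.1).

Definition generates (X : 'I_n -> vfield M) (L : set TM) : Prop :=
  [/\ (forall i, smooth_vf (X i)),
      (forall i, is_parallel (@nabla R n M) (X i)),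
      (forall p, (\matrix_(i < n) X i p) \in unitmx)
    & L = [set u | exists k : 'I_n -> int,
                     u.2 = \sum_(i < n) (k i)%:~R *: X i u.1]].

Definition Gamma (L : set TM) : set (TM -> TM) :=
  [set gam | exists (X : 'I_n -> vfield M) (k : 'rV[int]_n),
     generates X L /\ gam = translate X (map_mx intr k)].

Definition orbit (L : set TM) (u : TM) : set TM :=
  [set u' | exists2 gam, Gamma L gam & u' = gam u].

(* The charts of TM/Gamma(L): the quotient map is inverted on an open set [U]
   on which it is injective, and a chart of TM is applied.  The preferred chart
   at a class comes from a neighbourhood of its representative [rep A], and
   from the chart of TM preferred at [rep A], so that the quotient map
   identifies the tangent spaces at [rep A] and at [A]. *)
Section Quotient.
Variable L : set TM.
Let q : TM -> quot (orbit L) := cls (orbit L).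

Definition qdom (iU : chart TM * set TM) : set (quot (orbit L)) :=
  [set A | [/\ mopen iU.2, iU.2 `<=` dom iU.1,
               (forall u u', iU.2 u -> iU.2 u' -> q u = q u' -> u = u')
             & exists2 u, iU.2 u & A = q u]].

Definition qsection (U : set TM) (A : quot (orbit L)) : TM :=
  some_such (rep A) [set u | U u /\ A = q u].

Definition qmfd : mfd R (n + n) :=
  @Mfd R (n + n) (quot (orbit L)) (chart TM * set TM)
    qdom
    (fun iU A => coord iU.1 (qsection iU.2 A))
    (fun iU x => q (point iU.1 x))
    (fun A =>
       let i := prefer (rep A : TM) in
       (i, some_such set0 [set U | U (rep A) /\ qdom (i, U) A])).

Definition qherm : herm R (n + n) :=
  @Herm R (n + n)
    (@Riem R (n + n) qmfd (fun A => @met R _ tangent_herm (rep A)))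
    (fun A => @cpx R _ tangent_herm (rep A)).

End Quotient.

Definition qmap (L : set TM) : TM -> qherm L := cls (orbit L).

Definition PhiX (L : set TM) (X : 'I_n -> vfield M) (t : 'rV[R]_n)
    (A : qherm L) : qherm L := qmap L (translate X t (rep A)).

End Dombrowski.

(* An action of R^n/Z^n is written as a Z^n-periodic action of R^n. *)
Section Torifications.
Context {R : realType}.

Definition integral {n : nat} (t : 'rV[R]_n) : Prop :=
  forall i, t 0 i \is a Num.int.

Definition is_torus_action {n d : nat} (N : herm R d)
    (Phi : 'rV[R]_n -> N -> N) : Prop :=
  [/\ (forall t p, integral t -> Phi t p = p),
      (forall s t p, Phi (s + t) p = Phi s (Phi t p))
    & msmooth (fun tp : prod_mfd (euclid n) N => Phi tp.1 tp.2)].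

Definition effective {n d : nat} (N : herm R d) (Phi : 'rV[R]_n -> N -> N) :
    Prop := forall t, (forall p, Phi t p = p) -> integral t.

Definition free_locus {n d : nat} (N : herm R d) (Phi : 'rV[R]_n -> N -> N) :
    set N := [set p | forall t, Phi t p = p -> integral t].

Section Fix.
Context {n d : nat} (M : affine R n) (N : herm R d) (Phi : 'rV[R]_n -> N -> N).

Definition toric_parametrization (L : set (tangent M))
    (X : 'I_n -> vfield M) (F : qherm L -> N) : Prop :=
  [/\ generates X L, diffeo_onto F (free_locus Phi),
      holomorphic F, isometric F
    & forall a A, F (PhiX X a A) = Phi a (F A)].

Definition is_torification : Prop :=
  [/\ is_dually_flat M /\ mconnected M,
      is_kahler N /\ mconnected N,
      d = (n + n)%N,
      [/\ is_torus_action Phi, effective Phi,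
          (forall a, holomorphic (Phi a)) & (forall a, isometric (Phi a))]
    & exists L X F, @toric_parametrization L X F].

Definition compatible_covering (tau : tangent M -> N) : Prop :=
  exists L X F, @toric_parametrization L X F /\ tau = F \o @qmap R n M L.

End Fix.

Definition is_lift {n d n' d' : nat} (M : affine R n) (N : herm R d)
    (Phi : 'rV[R]_n -> N -> N) (M' : affine R n') (N' : herm R d')
    (Phi' : 'rV[R]_n' -> N' -> N') (m : N -> N') (f : M -> M') : Prop :=
  [/\ is_torification M Phi, is_torification M' Phi', msmooth m, msmooth f
    & exists (tau : tangent M -> N) (tau' : tangent M' -> N'),
        [/\ compatible_covering Phi tau, compatible_covering Phi' tau'
          & forall u, m (tau u) = tau' (push f u)]].

End Torifications.

Record ordered_set (n : nat) := OrderedSet {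
  elements :> finType;
  elt : 'I_n.+1 -> elements;
  rank : elements -> 'I_n.+1;
  eltK : cancel elt rank;
  rankK : cancel rank elt }.

(* A set of functions on a finite set, with its natural parametrization
   [theta |-> p_theta]. *)
Record family (R : realType) (n : nat) := Family {
  outcomes : finType;
  member : set (outcomes -> R);
  par : 'rV[R]_n -> outcomes -> R;
  par_member : forall theta, member (par theta) }.

Section FamilyGeometry.
Context {R : realType} {n : nat} (E : family R n).

Definition family_mfd : mfd R n :=
  @Mfd R n {p | @member R n E p} unit (fun _ => setT)
    (fun _ p => some_such 0 [set theta | @par R n E theta = sval p])
    (fun _ theta => exist _ (@par R n E theta) (@par_member R n E theta))
    (fun _ => tt).

Definition score (x : outcomes E) (i : 'I_n) (theta : 'rV[R]_n) : R :=
  'd (fun eta => ln (@par R n E eta x)) theta (delta_mx 0 i).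

Definition fisher (theta : 'rV[R]_n) (i j : 'I_n) : R :=
  \sum_(x : outcomes E) @par R n E theta x * (score x i theta * score x j theta).

Definition family_affine : affine R n :=
  @Affine R n
    (@Riem R n family_mfd (fun p v w =>
       \sum_(i < n) \sum_(j < n) v 0 i * w 0 j * fisher (@coord R n family_mfd tt p) i j))
    (fun X Y p =>
       'd (Y \o @point R n family_mfd tt) (@coord R n family_mfd tt p) (X p)).

End FamilyGeometry.

Section Simplex.
Context {R : realType} {n : nat} (T : ordered_set n).

Definition open_simplex : set (T -> R) :=
  [set p | (forall x, 0 < p x) /\ \sum_x p x = 1].

Definition psi (theta : 'rV[R]_n) : R :=
  ln (1 + \sum_(i < n) expR (theta 0 i)).

(* [unlift ord_max k] is [Some i] if k = i < n, and [None] if k = n. *)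
Definition simplex_par (theta : 'rV[R]_n) (x : T) : R :=
  match unlift ord_max (rank x) with
  | Some i => expR (theta 0 i - psi theta)
  | None => expR (- psi theta)
  end.

Lemma simplex_par_member theta : open_simplex (simplex_par theta).
Proof.
split=> [x|]; first by rewrite /simplex_par; case: unlift => *; exact: expR_gt0.
rewrite (reindex (elt T)) /=; last first.
  exists (@rank n T) => [k _|x _]; first exact: eltK. exact: rankK.
rewrite (bigD1 ord_max) //= {1}/simplex_par eltK unlift_none.
have -> : \sum_(i < n.+1 | i != ord_max) simplex_par theta (elt T i)
        = \sum_(i < n) expR (theta 0 i - psi theta).
  rewrite (reindex_omap (lift ord_max) (unlift ord_max)) /=; last first.
    by move=> i; case: unliftP => [j ->|->] //=; rewrite eqxx.
  apply: eq_big => [i|i _].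
    by rewrite liftK eqxx eq_sym neq_lift.
  by rewrite /simplex_par eltK liftK.
have pos : 0 < 1 + \sum_(i < n) expR (theta 0 i).
  by rewrite ltr_pwDl // sumr_ge0 // => i _; exact: expR_ge0.
under eq_bigr do rewrite expRD.
rewrite -mulr_suml -{1}(mul1r (expR _)) -mulrDl expRN lnK ?posrE //.
by rewrite divff // gt_eqF.
Qed.

Definition simplex : family R n :=
  @Family R n (elements T) open_simplex simplex_par simplex_par_member.

End Simplex.

Section ProductFamily.
Context {R : realType} {n m : nat} (E : family R n) (E' : family R m).

Definition product_member : set (outcomes E * outcomes E' -> R) :=
  [set p | exists p1 p2, [/\ @member R n E p1, @member R m E' p2
                           & forall x y, p (x, y) = p1 x * p2 y]].

Definition product_par (theta : 'rV[R]_(n + m)) (xy : outcomes E * outcomes E') : R :=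
  @par R n E (lsubmx theta) xy.1 * @par R m E' (rsubmx theta) xy.2.

Lemma product_par_member theta : product_member (product_par theta).
Proof.
exists (@par R n E (lsubmx theta)), (@par R m E' (rsubmx theta)).
by split=> //; exact: par_member.
Qed.

Definition product_family : family R (n + m) :=
  @Family R (n + m) (outcomes E * outcomes E')%type
    product_member product_par product_par_member.

End ProductFamily.

(* (lex_dim n m).+1 is convertible to (n+1)(m+1). *)
Definition lex_dim (n m : nat) : nat := (n.+1 * m.+1).-1.

Section Lex.
Context {n m : nat}.

Definition lex_index (ij : 'I_n.+1 * 'I_m.+1) : 'I_(lex_dim n m).+1 :=
  inord (ij.1 * m.+1 + ij.2).

Definition lex_pair (k : 'I_(lex_dim n m).+1) : 'I_n.+1 * 'I_m.+1 :=
  (inord (k %/ m.+1), inord (k %% m.+1)).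

Lemma lex_indexE i j : lex_index (i, j) = (i * m.+1 + j)%N :> nat.
Proof.
rewrite inordK //= prednK // -ltn_divLR // divnMDl // divn_small // addn0.
exact: ltn_ord.
Qed.

Lemma lex_indexK : cancel lex_index lex_pair.
Proof.
case=> i j; rewrite /lex_pair lex_indexE divnMDl // modnMDl.
by rewrite divn_small // addn0 modn_small // !inord_val.
Qed.

Lemma lex_pairK : cancel lex_pair lex_index.
Proof.
move=> k; apply/val_inj; rewrite /= /lex_pair lex_indexE !inordK ?ltn_mod //.
  by rewrite -divn_eq.
by rewrite ltn_divLR //; exact: ltn_ord.
Qed.

Section LexProduct.
Variables (S : ordered_set n) (T : ordered_set m).

Definition lex_elt (k : 'I_(lex_dim n m).+1) : S * T :=
  (elt S (lex_pair k).1, elt T (lex_pair k).2).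

Definition lex_rank (xy : S * T) : 'I_(lex_dim n m).+1 :=
  lex_index (rank xy.1, rank xy.2).

Lemma lex_eltK : cancel lex_elt lex_rank.
Proof. by move=> k; rewrite /lex_rank /= !eltK; exact: lex_pairK. Qed.

Lemma lex_rankK : cancel lex_rank lex_elt.
Proof. by case=> x y; rewrite /lex_elt /lex_rank lex_indexK /= !rankK. Qed.

Definition lex_product : ordered_set (lex_dim n m) :=
  @OrderedSet (lex_dim n m) (S * T)%type lex_elt lex_rank lex_eltK lex_rankK.

Lemma product_simplex_sub (R : realType) (p : S * T -> R) :
  @member R (n + m) (product_family (simplex S) (simplex T)) p ->
  @member R (lex_dim n m) (simplex lex_product) p.
Proof.
case=> p1 [p2 [[p1_gt0 p1_sum] [p2_gt0 p2_sum] pE]]; split=> [[x y]|].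
  by rewrite pE mulr_gt0.
rewrite (eq_bigr (fun xy => p (xy.1, xy.2))) => [|[x y] _] //.
rewrite -(pair_bigA _ (fun x y => p (x, y))) /=.
under eq_bigr do (under eq_bigr do rewrite pE; rewrite -mulr_sumr p2_sum mulr1).
exact: p1_sum.
Qed.

Definition inclusion (R : realType)
    (p : family_affine (@product_family R n m (simplex S) (simplex T))) :
    family_affine (@simplex R (lex_dim n m) lex_product) :=
  exist _ (sval p) (product_simplex_sub (svalP p)).

End LexProduct.
End Lex.

Section ProjectiveSpace.
Context {R : realType}.
Local Notation C := (R[i]).

Definition nzvec (n : nat) := {z : 'rV[C]_n.+1 | z != 0}.

Definition line {n : nat} (z : nzvec n) : set (nzvec n) :=
  [set z' | exists2 c : C, c != 0 & sval z' = c *: sval z].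

Definition proj_space (n : nat) := quot (@line n).

Definition hcoord {n : nat} (p : proj_space n) : 'rV[C]_n.+1 := sval (rep p).

Definition to_complex {n : nat} (x : 'rV[R]_(n + n)) : 'rV[C]_n :=
  \row_(k < n) (lsubmx x 0 k +i* rsubmx x 0 k)%C.

Definition of_complex {n : nat} (w : 'rV[C]_n) : 'rV[R]_(n + n) :=
  row_mx (\row_k complex.Re (w 0 k)) (\row_k complex.Im (w 0 k)).

(* [c] in position [i], and the entries of [w] in the other ones. *)
Definition insert {n : nat} (i : 'I_n.+1) (c : C) (w : 'rV[C]_n) :
    'rV[C]_n.+1 :=
  \row_k (if unlift i k is Some j then w 0 j else c).

Lemma insert_neq0 n (i : 'I_n.+1) (w : 'rV[C]_n) : insert i 1 w != 0.
Proof.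
apply/eqP => /rowP/(_ i); rewrite !mxE unlift_none => /eqP.
by rewrite oner_eq0.
Qed.

(* The charts [z] |-> (z_j / z_i)_(j <> i). *)
Definition proj_mfd (n : nat) : mfd R (n + n) :=
  @Mfd R (n + n) (proj_space n) 'I_n.+1
    (fun i => [set p | hcoord p 0 i != 0])
    (fun i p => of_complex (\row_j (hcoord p 0 (lift i j) / hcoord p 0 i)))
    (fun i x => cls (@line n) (exist _ (insert i 1 (to_complex x))
                                       (insert_neq0 i (to_complex x))))
    (fun p => odflt ord0 [pick i | hcoord p 0 i != 0]).

Definition hdot {n : nat} (z w : 'rV[C]_n) : C := \sum_k z 0 k * (w 0 k)^*%C.

(* The Fubini-Study metric at [z], on the tangent vectors represented by
   [a, b] in C^(n+1).  Without the factor 4 the holomorphic sectional curvature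
   is 4 (on P_1, the metric |dw|^2/(1+|w|^2)^2); with it, it is 1. *)
Definition fubini_study {n : nat} (z a b : 'rV[C]_n.+1) : R :=
  4 * complex.Re (hdot a b / hdot z z - hdot a z * hdot z b / hdot z z ^+ 2).

Definition mul_i {n : nat} (v : 'rV[R]_(n + n)) : 'rV[R]_(n + n) :=
  row_mx (- rsubmx v) (lsubmx v).

Definition CP (n : nat) : herm R (n + n) :=
  @Herm R (n + n)
    (@Riem R (n + n) (proj_mfd n) (fun p v w =>
       let i := prefer p in
       fubini_study (insert i 1 (to_complex (coord i p)))
         (insert i 0 (to_complex v)) (insert i 0 (to_complex w))))
    (fun p => mul_i).

Definition cis (x : R) : C := (cos x +i* sin x)%C.

Lemma cis_neq0 x : cis x != 0.
Proof.
apply/eqP => -[c0 s0]; have := cos2Dsin2 x.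
by rewrite c0 s0 expr0n /= addr0 => /eqP; rewrite eq_sym oner_eq0.
Qed.

Definition phase {n : nat} (t : 'rV[R]_n) (k : 'I_n.+1) : C :=
  if unlift ord_max k is Some j then cis (2 * pi * t 0 j) else 1.

Definition rotate {n : nat} (t : 'rV[R]_n) (z : 'rV[C]_n.+1) : 'rV[C]_n.+1 :=
  \row_k (phase t k * z 0 k).

Lemma rotate_neq0 n (t : 'rV[R]_n) (z : nzvec n) : rotate t (sval z) != 0.
Proof.
case: z => z /= /rV0Pn[k zk]; apply/rV0Pn; exists k.
rewrite mxE mulf_neq0 // /phase; case: unlift => [j|]; first exact: cis_neq0.
exact: oner_neq0.
Qed.

Definition proj_action (n : nat) (t : 'rV[R]_n) (p : CP n) : CP n :=
  cls (@line n) (exist _ (rotate t (hcoord p)) (rotate_neq0 t (rep p))).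

Definition prod_herm {d d' : nat} (N : herm R d) (N' : herm R d') :
    herm R (d + d') :=
  @Herm R (d + d')
    (@Riem R (d + d') (prod_mfd N N') (fun p v w =>
       met p.1 (lsubmx v) (lsubmx w) + met p.2 (rsubmx v) (rsubmx w)))
    (fun p v => row_mx (cpx p.1 (lsubmx v)) (cpx p.2 (rsubmx v))).

Definition prod_action {n n' d d' : nat} (N : herm R d) (N' : herm R d')
    (Phi : 'rV[R]_n -> N -> N) (Phi' : 'rV[R]_n' -> N' -> N')
    (t : 'rV[R]_(n + n')) (p : prod_herm N N') : prod_herm N N' :=
  (Phi (lsubmx t) p.1, Phi' (rsubmx t) p.2).

Definition segre_vec {n m : nat} (z : 'rV[C]_n.+1) (w : 'rV[C]_m.+1) :
    'rV[C]_(lex_dim n m).+1 :=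
  \row_k (z 0 (lex_pair k).1 * w 0 (lex_pair k).2).

Lemma segre_vec_neq0 n m (z : nzvec n) (w : nzvec m) :
  segre_vec (sval z) (sval w) != 0.
Proof.
case: z w => z /= /rV0Pn[i zi] [w /= /rV0Pn[j wj]].
by apply/rV0Pn; exists (lex_index (i, j)); rewrite mxE lex_indexK mulf_neq0.
Qed.

Definition segre (n m : nat) (p : prod_herm (CP n) (CP m)) :
    CP (lex_dim n m) :=
  cls (@line (lex_dim n m))
    (exist _ (segre_vec (hcoord p.1) (hcoord p.2))
             (segre_vec_neq0 (rep p.1) (rep p.2))).

End ProjectiveSpace.

Arguments CP R n : clear implicits.

(* Main.v *)
From HB Require Import structures.
From mathcomp Require Import all_boot all_order all_algebra.
From mathcomp Require Import complex.
From mathcomp Require Import all_classical all_reals all_analysis.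
From mathcomp Require Import ring lra.
Require Import Defs.

Set Implicit Arguments.
Unset Strict Implicit.
Unset Printing Implicit Defensive.

Import numFieldNormedType.Exports.
Import Order.TTheory GRing.Theory Num.Theory.

Local Open Scope classical_set_scope.
Local Open Scope ring_scope.

(** The statement becomes a linear identity between exponents once both sides
    are written in natural parameters.

    On the tangent bundle of an exponential family, the natural parameters
    [theta] and the components [y] of tangent vectors are coordinates in which
    the connector is [(v, w) |-> w]. The structure of Dombrowski is thus [J (v,
    w) = (- w, v)], with metric [cov theta] on each of the two summands, where
    [cov theta] is the covariance of the sufficient statistics, which is the
    Fisher metric ([family_metE], [tangent_metE], [tangent_cpxE]).

    For the positive distributions on [n + 1] points, let [tau (theta, y)] be
    the point of projective space with homogeneous coordinates [exp ((theta_k +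
    i y_k) / 2)] and last coordinate 1. It is holomorphic. The Fubini-Study form
    at a vector [Z] with entries of modulus [exp (theta_k / 2)], on tangent
    vectors [Z_k u_k], is four times a complex covariance of the [u_k] under the
    weights [exp theta_k]; as the [u_k] are halves of complexified statistics,
    [tau] is isometric ([fubini_study_toric]). Its image is the set of points
    without zero coordinate, which is the free locus of the torus ([proj_free]),
    its fibres are the orbits of [4 pi Z^n] in the variable [y], and translation
    of [y] by [4 pi t] is the action of [t]. These properties are collected in
    [toric_cover]. A map that has them induces a toric parametrization for the
    lattice spanned by the fields [4 pi d/dtheta_i] ([toric_parametrizationP]),
    because it is a quotient map for that lattice and has smooth local sections.
    Toric covers multiply ([prod_toric_cover]), which gives the torification of
    the product family.

    In natural parameters the inclusion is the linear map [theta_ij = theta_i +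
    theta'_j], with the convention that the parameter of a last outcome is 0
    ([inclusion_of_natural]), so that its differential is the same map applied
    to [y]. The exponential turns [theta_i + theta'_j + i (y_i + y'_j)] into the
    product [z_i w_j] of the homogeneous coordinates, which is the Segre
    embedding ([toric_vec_lex]).

    What remains is to see that the spaces are of the required kind. An
    exponential family is dually flat because the dual connection is the
    conjugate of the exponential one by the Fisher matrix: conjugation preserves
    curvature zero, and the torsion vanishes because the Fisher matrix is a
    Hessian, so that its derivatives are symmetric in three indices
    ([dual_nabla_flat]). Projective space is Kähler because its complex
    structure is constant in the affine charts ([kahler_of_pre]), and because
    the derivative of the Kähler form in an affine chart is an explicit
    expression with vanishing cyclic sum ([kahler_term_cyclic]); that expression
    is accessible since the Fubini-Study form may be computed on any homogeneous
    representative ([fubini_study_scale]). *)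

(** * Differentials together with their values *)

Section Differentials.
Context {R : realType}.
Implicit Types U V W : normedModType R.

(** The value ['d f x] is meaningful for differentiable [f] only; carrying both
    together lets the rules below compose by application. *)
Definition has_diff V W (f : V -> W) (x : V) (df : V -> W) : Prop :=
  differentiable f x /\ forall v, 'd f x v = df v.

Lemma differentiable_has_diff V W (f : V -> W) x :
  differentiable f x -> has_diff f x ('d f x).
Proof. by []. Qed.

Lemma has_diff_ext V W (f : V -> W) x df df' :
  has_diff f x df -> (forall v, df v = df' v) -> has_diff f x df'.
Proof. by move=> [fx fE] E; split=> // v; rewrite fE E. Qed.

Lemma is_diff_has_diff V W (f : V -> W) x df :
  is_diff x f df -> has_diff f x df.
Proof. by move=> [fx E]; split=> // v; rewrite E. Qed.

Lemma has_diff_is_diff V W (f : V -> W) x df :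
  has_diff f x df -> is_diff x f df.
Proof. by move=> [fx E]; apply: DiffDef => //; apply/funext. Qed.

(** The remainder of [e] at [x] is 0 on a neighbourhood, so 0 is a differential
    by the definition with little-o. *)
Lemma has_diff0_near V W (e : V -> W) x :
  (\forall y \near x, e y = 0) -> has_diff e x (fun=> 0).
Proof.
move=> e0.
have ex0 : e x = 0 by exact: nbhs_singleton e0.
have E : e \o shift x = cst (e x) + (\0 : {linear V -> W}) +o_ 0 id.
  apply/eqaddoP => _/posnumP[eps].
  have : \forall h \near (0 : V), e (h + x) = 0.
    have C : (h + x) @[h --> (0 : V)] --> x.
      by rewrite -[X in _ --> X](add0r x); apply: cvgD; [exact: cvg_id|exact: cvg_cst].
    exact: C e0.
  apply: filterS => h eh; rewrite !fctE /= eh ex0 !(addr0, subr0) normr0 mulr_ge0 //.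
have C : continuous (\0 : {linear V -> W}) by move=> y; exact: cvg_cst.
have D := diff_unique C E.
split=> [|v]; last by rewrite D.
by apply/diff_locallyP; rewrite D.
Qed.

(** The difference [g - f] falls under [has_diff0_near]. *)
Lemma has_diff_near V W (f g : V -> W) x df :
  (\forall y \near x, f y = g y) -> has_diff f x df -> has_diff g x df.
Proof.
move=> fg [fx fE].
have [ex eE] : has_diff (g - f) x (fun=> 0).
  by apply: has_diff0_near; apply: filterS fg => y fgy; rewrite !fctE fgy subrr.
have -> : g = f + (g - f) by apply/funext => y; rewrite !fctE addrC subrK.
split; first exact: differentiableD.
by move=> v; rewrite diffD //= eE addr0 fE.
Qed.

Lemma has_diff_cst V W (c : W) x : has_diff (fun _ : V => c) x (fun=> 0).
Proof. by have [] := is_diff_cst c x => d e; split=> // v; rewrite e. Qed.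

Lemma has_diffD V W (f g : V -> W) x df dg : has_diff f x df -> has_diff g x dg ->
  has_diff (fun y => f y + g y) x (fun v => df v + dg v).
Proof.
move=> [fx fE] [gx gE]; split; first exact: differentiableD.
by move=> v; rewrite diffD //= fE gE.
Qed.

Lemma has_diffN V W (f : V -> W) x df : has_diff f x df ->
  has_diff (fun y => - f y) x (fun v => - df v).
Proof.
move=> [fx fE]; split; first exact: differentiableN.
by move=> v; rewrite -fE; exact: (congr1 (@^~ v) (diffN fx)).
Qed.

Lemma has_diffB V W (f g : V -> W) x df dg : has_diff f x df -> has_diff g x dg ->
  has_diff (fun y => f y - g y) x (fun v => df v - dg v).
Proof. by move=> ? ?; apply: has_diffD => //; exact: has_diffN. Qed.

Lemma has_diff_sum V W (I : Type) (r : seq I) (P : pred I) (f : I -> V -> W) x df :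
  (forall i, P i -> has_diff (f i) x (df i)) ->
  has_diff (fun y => \sum_(i <- r | P i) f i y) x (fun v => \sum_(i <- r | P i) df i v).
Proof.
move=> H; elim: r => [|i r IH].
  by under eq_fun do rewrite big_nil; under [X in has_diff _ _ X]eq_fun do rewrite big_nil;
    exact: has_diff_cst.
under eq_fun do rewrite big_cons; under [X in has_diff _ _ X]eq_fun do rewrite big_cons.
by case Pi: (P i) => //; apply: has_diffD => //; exact: H.
Qed.

Lemma has_diffM V (f g : V -> R) x df dg : has_diff f x df -> has_diff g x dg ->
  has_diff (fun y => f y * g y) x (fun v => f x * dg v + g x * df v).
Proof.
move=> /has_diff_is_diff F /has_diff_is_diff G.
exact: is_diff_has_diff (is_diffM F G).
Qed.

Lemma has_diffV V (f : V -> R) x df : has_diff f x df -> f x != 0 ->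
  has_diff (fun y => (f y)^-1) x (fun v => - (f x)^-1 ^+ 2 * df v).
Proof.
move=> [fx fE] f0; split; first exact: differentiableV.
by move=> v; rewrite diffV //= -fE exprVn.
Qed.

Lemma has_diffZl V W (f : V -> R) x df (w : W) : has_diff f x df ->
  has_diff (fun y => f y *: w) x (fun v => df v *: w).
Proof.
move=> [fx fE]; split; first exact: differentiableZl.
by move=> v; rewrite diffZl //= fE.
Qed.

Lemma has_diff_comp U V W (f : U -> V) (g : V -> W) x df dg :
  has_diff f x df -> has_diff g (f x) dg ->
  has_diff (fun y => g (f y)) x (fun v => dg (df v)).
Proof.
move=> [fx fE] [gx gE]; split; first exact: differentiable_comp.
by move=> v; rewrite diff_comp //= gE fE.
Qed.

Lemma has_diff_real V (f : V -> R) (g : R -> R) x df (g' : R) :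
  has_diff f x df -> is_derive (f x) 1 g g' ->
  has_diff (fun y => g (f y)) x (fun v => g' * df v).
Proof.
move=> F G; apply: has_diff_comp F _.
have gd : differentiable g (f x) by apply/derivable1_diffP; exact: ex_derive.
split=> // v; rewrite deriv1E; last by exact: ex_derive.
by rewrite derive1E (@derive_val _ _ _ _ _ _ _ G) /= mulrC.
Qed.

End Differentials.

Section RowDomain.
Context {R : realType} {n : nat}.
Local Notation V := 'rV[R]_n.

Lemma has_diff_coord (x : V) j : has_diff (fun y : V => y 0 j) x (fun v => v 0 j).
Proof.
have L : linear (fun y : V => y 0 j : R) by move=> k a b; rewrite !mxE.
pose l := HB.pack (fun y : V => y 0 j) (GRing.isLinear.Build _ _ _ _ _ L) : {linear V -> R}.
have C : continuous l by move=> y; apply: differentiable_continuous; exact: differentiable_coord.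
split; first exact: differentiable_coord.
by move=> v; rewrite (_ : (fun y : V => y 0 j) = l) // diff_lin.
Qed.

Lemma row_expand (v : V) : v = \sum_j v 0 j *: delta_mx 0 j.
Proof.
by rewrite {1}[v]matrix_sum_delta big_ord1.
Qed.

(** In finite dimension a linear map is a combination of coordinates, hence
    continuous. *)
Lemma has_diff_linear (W : normedModType R) (l : V -> W) x : linear l -> has_diff l x l.
Proof.
move=> L.
pose k := HB.pack l (GRing.isLinear.Build _ _ _ _ _ L) : {linear V -> W}.
have E y : l y = \sum_j y 0 j *: l (delta_mx 0 j).
  rewrite {1}[y]row_expand -[l _]/(k _) linear_sum; apply: eq_bigr => j _.
  by rewrite linearZ.
rewrite (funext E); apply: has_diff_sum => j _; apply: has_diffZl; exact: has_diff_coord.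
Qed.

Lemma has_diff_row (U : normedModType R) (f : U -> V) x (df : U -> V) :
  (forall j, has_diff (fun y => f y 0 j) x (fun v => df v 0 j)) -> has_diff f x df.
Proof.
move=> H.
have -> : f = fun y => \sum_j f y 0 j *: delta_mx 0 j by apply/funext => y; exact: row_expand.
rewrite (_ : df = fun y => \sum_j df y 0 j *: delta_mx 0 j); last first.
  by apply/funext => y; exact: row_expand.
by apply: has_diff_sum => j _; apply: has_diffZl.
Qed.

Lemma diff_expand (W : normedModType R) (f : V -> W) x v :
  'd f x v = \sum_j v 0 j *: 'd f x (delta_mx 0 j).
Proof. by rewrite {1}[v]row_expand linear_sum; apply: eq_bigr => j _; rewrite linearZ. Qed.

End RowDomain.

(** * Smooth functions *)

Section Smooth.
Context {R : realType} {n : nat}.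
Local Notation V := 'rV[R]_n.
Implicit Types (W : normedModType R) (U : set V) (k : nat).

Lemma open_near U (P : V -> Prop) x :
  open U -> (forall y, U y -> P y) -> U x -> \forall y \near x, P y.
Proof. by move=> oU H Ux; have := open_nbhs_nbhs (conj oU Ux); apply: filterS. Qed.

Lemma Ck_eq W U k (f g : V -> W) : open U -> (forall x, U x -> f x = g x) ->
  Ck k U f -> Ck k U g.
Proof.
move=> oU; elim: k f g => [|k IH] f g fg /=.
  move=> H x Ux; have fgx := open_near oU fg Ux.
  rewrite /prop_for /continuous_at -fg //.
  apply: cvg_trans (H _ Ux); exact: (@near_eq_cvg _ _ (nbhs x) _ f g fgx).
move=> [fd fC].
have E x : U x -> has_diff g x ('d f x).
  move=> Ux; have := differentiable_has_diff (fd _ Ux); apply: has_diff_near.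
  exact: open_near Ux.
split=> [x /E[] //|v]; apply: IH (fC v) => x /E[_ ->] //.
Qed.

Lemma CkW W U k (f : V -> W) : Ck k.+1 U f -> Ck k U f.
Proof.
elim: k f => [|k IH] f /= [fd fC].
  by move=> x /fd; exact: differentiable_continuous.
by split=> // v; exact: IH.
Qed.

(** The step of inductions on the order of differentiability, for a function
    whose differential is known by a formula valid on [U]. *)
Lemma Ck_has_diff W U k (f : V -> W) (df : V -> V -> W) : open U ->
  (forall x, U x -> has_diff f x (df x)) ->
  (forall v, Ck k U (fun x => df x v)) -> Ck k.+1 U f.
Proof.
move=> oU fd fC; split=> [x /fd[] //|v].
by apply: Ck_eq (fC v) => // x /fd[].
Qed.

Lemma smooth_has_diff W U (f : V -> W) x :
  smooth U f -> U x -> has_diff f x ('d f x).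
Proof. by move=> /(_ 1%N)[fd _] /fd. Qed.

Lemma smooth_diff W U (f : V -> W) v :
  smooth U f -> smooth U (fun x => 'd f x v).
Proof. by move=> fC k; have [_ +] := fC k.+1; exact. Qed.

Lemma smooth_eq W U (f g : V -> W) : open U -> (forall x, U x -> f x = g x) ->
  smooth U f -> smooth U g.
Proof. by move=> oU fg fC k; apply: Ck_eq fg (fC k). Qed.

(** Every clause of [Ck] is a condition at the points of [U]; restriction to
    subsets and locality follow. *)
Lemma Ck_pointwise W U k (f : V -> W) :
  (forall x, U x -> Ck k [set x] f) <-> Ck k U f.
Proof.
split.
  elim: k f => [|k IH] f /=; first by move=> H x Ux; exact: (H x Ux x erefl).
  move=> H; split=> [x Ux|v]; first by have [+ _] := H _ Ux; exact.
  by apply: IH => x /H[].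
elim: k f => [|k IH] f /= H x Ux; first by move=> y ->; exact: H.
by case: H => fd fC; split=> [y -> |v]; [exact: fd|exact: IH].
Qed.

Lemma smooth_pointwise W U (f : V -> W) :
  (forall x, U x -> smooth [set x] f) <-> smooth U f.
Proof.
split=> [H k|H x Ux k]; first by apply/Ck_pointwise => x /H.
by move/Ck_pointwise: (H k); exact.
Qed.

Lemma smooth_sub W U U' (f : V -> W) : U `<=` U' -> smooth U' f -> smooth U f.
Proof. by move=> UU' /smooth_pointwise H; apply/smooth_pointwise => x /UU' /H. Qed.

Lemma smooth_local W U (f : V -> W) :
  (forall x, U x -> exists U' (g : V -> W), [/\ open U', U' x, smooth U' g &
     forall y, U' y -> f y = g y]) -> smooth U f.
Proof.
move=> H; apply/smooth_pointwise => x /H[U' [g [oU' U'x gC fg]]].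
have : smooth U' f by apply: smooth_eq gC => // y /fg.
by apply: smooth_sub => y ->.
Qed.

Lemma Ck_cst W U k (c : W) : Ck k U (fun=> c).
Proof.
elim: k c => [|k IH] c; first by move=> x _; exact: cst_continuous.
split=> [x _|v]; first by have [] := has_diff_cst c x.
rewrite (_ : (fun x => _) = fun=> 0) //.
by apply/funext => x; have [_] := has_diff_cst c x.
Qed.

Lemma smooth_cst W U (c : W) : smooth U (fun=> c).
Proof. by move=> k; exact: Ck_cst. Qed.

Lemma smooth_linear W U (l : V -> W) : linear l -> smooth U l.
Proof.
move=> L [|k]; first by move=> x _; apply: differentiable_continuous; have [] := has_diff_linear x L.
split=> [x _|v]; first by have [] := has_diff_linear x L.
rewrite (_ : (fun x => _) = fun=> l v); first exact: Ck_cst.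
by apply/funext => x; have [_] := has_diff_linear x L.
Qed.

Lemma CkD W U k (f g : V -> W) : open U -> Ck k U f -> Ck k U g ->
  Ck k U (fun x => f x + g x).
Proof.
move=> oU; elim: k f g => [|k IH] f g.
  by move=> fC gC x Ux; exact: (cvgD (fC x Ux) (gC x Ux)).
move=> [fd fC] [gd gC]; apply: (@Ck_has_diff _ U k _ (fun x v => 'd f x v + 'd g x v)) => //.
  by move=> x Ux; apply: has_diffD; apply: differentiable_has_diff; [exact: fd|exact: gd].
by move=> v; exact: (IH _ _ (fC v) (gC v)).
Qed.

Lemma smoothD W U (f g : V -> W) : open U -> smooth U f -> smooth U g ->
  smooth U (fun x => f x + g x).
Proof. by move=> ? fC gC k; exact: (CkD _ (fC k) (gC k)). Qed.

Lemma smooth_sum W U (I : Type) (r : seq I) (P : pred I) (f : I -> V -> W) :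
  open U -> (forall i, P i -> smooth U (f i)) ->
  smooth U (fun x => \sum_(i <- r | P i) f i x).
Proof.
move=> oU H; elim: r => [|i r IH].
  by under eq_fun do rewrite big_nil; exact: smooth_cst.
under eq_fun do rewrite big_cons.
by case Pi: (P i) => //; apply: smoothD => //; exact: H.
Qed.

Lemma CkM U k (f g : V -> R) : open U -> Ck k U f -> Ck k U g ->
  Ck k U (fun x => f x * g x).
Proof.
move=> oU; elim: k f g => [|k IH] f g.
  by move=> fC gC x Ux; exact: (cvgM (fC x Ux) (gC x Ux)).
move=> fC1 gC1; have fC0 := CkW fC1; have gC0 := CkW gC1; move: fC1 gC1 => [fd fC] [gd gC].
apply: (@Ck_has_diff _ U k _ (fun x v => f x * 'd g x v + g x * 'd f x v)) => //.
  by move=> x Ux; apply: has_diffM; apply: differentiable_has_diff; [exact: fd|exact: gd].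
by move=> v; apply: CkD => //; [exact: (IH _ _ fC0 (gC v))|exact: (IH _ _ gC0 (fC v))].
Qed.

Lemma smoothM U (f g : V -> R) : open U -> smooth U f -> smooth U g ->
  smooth U (fun x => f x * g x).
Proof. by move=> ? fC gC k; exact: (CkM _ (fC k) (gC k)). Qed.

Lemma smoothN U (f : V -> R) : open U -> smooth U f -> smooth U (fun x => - f x).
Proof.
move=> oU fC; rewrite (_ : (fun x => _) = fun x => -1 * f x).
  by apply: smoothM => //; exact: smooth_cst.
by apply/funext => x; rewrite mulN1r.
Qed.

Lemma smoothB U (f g : V -> R) : open U -> smooth U f -> smooth U g ->
  smooth U (fun x => f x - g x).
Proof. by move=> oU fC gC; apply: smoothD => //; exact: smoothN. Qed.

Lemma smoothX U (f : V -> R) m : open U -> smooth U f -> smooth U (fun x => f x ^+ m).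
Proof.
move=> oU fC; elim: m => [|m IH]; first exact: smooth_cst.
by under eq_fun do rewrite exprS; exact: smoothM.
Qed.

Lemma smooth_prod U (I : Type) (r : seq I) (P : pred I) (f : I -> V -> R) :
  open U -> (forall i, P i -> smooth U (f i)) ->
  smooth U (fun x => \prod_(i <- r | P i) f i x).
Proof.
move=> oU H; elim: r => [|i r IH].
  by under eq_fun do rewrite big_nil; exact: smooth_cst.
under eq_fun do rewrite big_cons.
by case Pi: (P i) => //; apply: smoothM => //; exact: H.
Qed.

(** Induction on [k]: as the differential is [g' (f x) * 'd f x], it suffices
    that [g' o f] inherits the regularity of [g o f]. This is immediate for
    [exp], where [g' = g], and for [ln] and [atan], where [g'] is rational. *)
Lemma smooth_real_comp U (f : V -> R) (g g' : R -> R) : open U -> smooth U f ->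
  (forall x, U x -> is_derive (f x) 1 g (g' (f x))) ->
  (forall k, Ck k U (fun x => g (f x)) -> Ck k U (fun x => g' (f x))) ->
  smooth U (fun x => g (f x)).
Proof.
move=> oU fC gd g'C.
have D x : U x -> has_diff (fun y => g (f y)) x (fun v => g' (f x) * 'd f x v).
  move=> Ux; apply: has_diff_real (gd _ Ux); exact: smooth_has_diff Ux.
elim=> [|k IH]; first by move=> x /D[+ _]; exact: differentiable_continuous.
apply: Ck_has_diff D _ => // v; apply: CkM => //; first exact: g'C.
exact: smooth_diff.
Qed.

Lemma smoothV U (f : V -> R) : open U -> smooth U f -> (forall x, U x -> f x != 0) ->
  smooth U (fun x => (f x)^-1).
Proof.
move=> oU fC f0; elim=> [|k IH].
  by move=> x Ux; apply: differentiable_continuous; apply: differentiableV;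
    [have [] := smooth_has_diff fC Ux|exact: f0].
apply: (@Ck_has_diff _ U k _ (fun x v => - (f x)^-1 ^+ 2 * 'd f x v)) => //.
  by move=> x Ux; apply: has_diffV; [exact: smooth_has_diff Ux|exact: f0].
move=> v; apply: CkM => //; last exact: smooth_diff.
rewrite (_ : (fun x => _) = fun x => -1 * ((f x)^-1 * (f x)^-1)).
  by do 2?apply: CkM => //; exact: Ck_cst.
by apply/funext => x; rewrite mulN1r expr2.
Qed.

Lemma smooth_expR U (f : V -> R) : open U -> smooth U f -> smooth U (fun x => expR (f x)).
Proof. by move=> oU fC; apply: (smooth_real_comp (g' := expR)). Qed.

Lemma smooth_ln U (f : V -> R) : open U -> smooth U f -> (forall x, U x -> 0 < f x) ->
  smooth U (fun x => ln (f x)).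
Proof.
move=> oU fC f0; apply: (smooth_real_comp (g' := fun x => x^-1)) => //.
  by move=> x Ux; apply: is_derive1_ln; exact: f0.
by move=> k _; apply: smoothV => // x /f0 /gt_eqF ->.
Qed.

Lemma smooth_atan U (f : V -> R) : open U -> smooth U f -> smooth U (fun x => atan (f x)).
Proof.
move=> oU fC; apply: (smooth_real_comp (g' := fun x => (1 + x ^+ 2)^-1)) => //.
move=> k _; apply: smoothV => // [|x _].
  by apply: smoothD => //; [exact: smooth_cst|exact: smoothX].
by rewrite gt_eqF // ltr_pwDl // sqr_ge0.
Qed.

(** Each function is the derivative of the other up to sign, so the induction
    treats them together. *)
Lemma smooth_cos_sin U (f : V -> R) : open U -> smooth U f ->
  smooth U (fun x => cos (f x)) /\ smooth U (fun x => sin (f x)).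
Proof.
move=> oU fC.
have D x : U x -> has_diff (fun y => cos (f y)) x (fun v => - sin (f x) * 'd f x v) /\
    has_diff (fun y => sin (f y)) x (fun v => cos (f x) * 'd f x v).
  by move=> Ux; split; apply: has_diff_real; exact: smooth_has_diff Ux.
have : forall k, Ck k U (fun x => cos (f x)) /\ Ck k U (fun x => sin (f x)).
  elim=> [|k [cC sC]].
    by split=> x /D[[cd _] [sd _]]; exact: differentiable_continuous.
  split; [apply: (Ck_has_diff oU (fun x Ux => (D x Ux).1))|
          apply: (Ck_has_diff oU (fun x Ux => (D x Ux).2))] => v;
    (apply: CkM => //; last exact: smooth_diff).
  rewrite (_ : (fun x => _) = fun x => -1 * sin (f x)); first by apply: CkM => //; exact: Ck_cst.
  by apply/funext => x; rewrite mulN1r.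
by move=> H; split=> k; have [] := H k.
Qed.

End Smooth.

Section SmoothMaps.
Context {R : realType}.

Lemma coord_is_linear {n} j : linear (fun y : 'rV[R]_n => y 0 j : R).
Proof. by move=> k a b; rewrite !mxE. Qed.

Lemma smooth_coord n m (U : set 'rV[R]_n) (f : 'rV[R]_n -> 'rV[R]_m) j :
  open U -> smooth U f -> smooth U (fun x => f x 0 j).
Proof.
move=> oU fC; suff H : forall k f, Ck k U f -> Ck k U (fun x => (f x : 'rV[R]_m) 0 j).
  by move=> k; exact: H.
elim=> [|k IH] {fC}f.
  move=> fC x Ux; have [+ _] := has_diff_coord (f x) j.
  by move=> /differentiable_continuous; apply: continuous_comp; exact: fC.
move=> [fd fC]; apply: (@Ck_has_diff _ _ _ U k _ (fun x v => 'd f x v 0 j)) => //.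
  move=> x Ux.
  exact: (has_diff_comp (differentiable_has_diff (fd x Ux)) (has_diff_coord (f x) j)).
by move=> v; exact: (IH _ (fC v)).
Qed.

Lemma smooth_row n m (U : set 'rV[R]_n) (f : 'rV[R]_n -> 'rV[R]_m) :
  open U -> (forall j, smooth U (fun x => f x 0 j)) -> smooth U f.
Proof.
move=> oU H; rewrite (_ : f = fun x => \sum_j f x 0 j *: delta_mx 0 j); last first.
  by apply/funext => x; exact: row_expand.
apply: smooth_sum => // j _ k.
have H' : forall k (g : 'rV[R]_n -> R), Ck k U g ->
    Ck k U (fun x => g x *: (delta_mx 0 j : 'rV[R]_m)).
  elim=> [|{}k IH] g.
    by move=> gC x Ux; exact: (cvgZr_tmp (gC x Ux)).
  move=> [gd gC].
  apply: (@Ck_has_diff _ _ _ U k _ (fun x v => 'd g x v *: (delta_mx 0 j : 'rV[R]_m))) => //.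
    by move=> x Ux; apply: has_diffZl; exact: differentiable_has_diff (gd x Ux).
  by move=> v; exact: (IH _ (gC v)).
by apply: H'; exact: H.
Qed.

Lemma smooth_postcomp n m p (U : set 'rV[R]_n) (f : 'rV[R]_n -> 'rV[R]_m)
    (l : 'rV[R]_m -> 'rV[R]_p) : open U -> linear l -> smooth U f ->
  smooth U (fun x => l (f x)).
Proof.
move=> oU L fC; apply: smooth_row => // j.
pose lin := HB.pack l (GRing.isLinear.Build _ _ _ _ _ L) : {linear 'rV[R]_m -> 'rV[R]_p}.
rewrite (_ : (fun x => _) = fun x => \sum_i f x 0 i * l (delta_mx 0 i) 0 j); last first.
  apply/funext => x; rewrite {1}[f x]row_expand -[l _]/(lin _) linear_sum summxE.
  by apply: eq_bigr => i _; rewrite linearZ mxE.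
apply: smooth_sum => // i _; apply: smoothM => //; last exact: smooth_cst.
exact: smooth_coord.
Qed.

(** By the chain rule the derivative along [v] is the sum over [j] of the [j]-th
    component of ['d f x v] times the [j]-th partial derivative of [g] at [f x];
    the induction hypothesis applies to these partial derivatives. *)
Lemma Ck_comp n m (U : set 'rV[R]_n) (U' : set 'rV[R]_m) k
    (f : 'rV[R]_n -> 'rV[R]_m) (g : 'rV[R]_m -> R) :
  open U -> open U' -> (forall x, U x -> U' (f x)) -> smooth U f -> Ck k U' g ->
  Ck k U (fun x => g (f x)).
Proof.
move=> oU oU' fU fC; elim: k g => [|k IH] g.
  move=> gC x Ux; apply: continuous_comp; last exact: gC (fU _ Ux).
  exact: fC 0%N x Ux.
move=> [gd gC].
apply: (@Ck_has_diff _ _ _ U k _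
  (fun x v => \sum_j 'd f x v 0 j * 'd g (f x) (delta_mx 0 j))) => //.
  move=> x Ux; apply: (@has_diff_ext _ _ _ _ _ (fun v => 'd g (f x) ('d f x v))).
    apply: has_diff_comp; first exact: smooth_has_diff Ux.
    exact: differentiable_has_diff (gd _ (fU _ Ux)).
  by move=> v; rewrite diff_expand.
move=> v.
have : forall j, Ck k U (fun x => 'd f x v 0 j * 'd g (f x) (delta_mx 0 j)).
  move=> j; apply: CkM => //; last exact: (IH _ (gC (delta_mx 0 j))).
  by apply: smooth_coord => //; exact: smooth_diff.
move=> H; elim: (index_enum _) => [|i r IHr].
  by under eq_fun do rewrite big_nil; exact: Ck_cst.
by under eq_fun do rewrite big_cons; apply: CkD.
Qed.

Lemma smooth_comp n m (U : set 'rV[R]_n) (U' : set 'rV[R]_m)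
    (f : 'rV[R]_n -> 'rV[R]_m) (g : 'rV[R]_m -> R) :
  open U -> open U' -> (forall x, U x -> U' (f x)) -> smooth U f -> smooth U' g ->
  smooth U (fun x => g (f x)).
Proof. by move=> oU oU' fU fC gC k; apply: (Ck_comp oU oU' fU fC). Qed.

Lemma smooth_comp_row n m p (U : set 'rV[R]_n) (U' : set 'rV[R]_m)
    (f : 'rV[R]_n -> 'rV[R]_m) (g : 'rV[R]_m -> 'rV[R]_p) :
  open U -> open U' -> (forall x, U x -> U' (f x)) -> smooth U f -> smooth U' g ->
  smooth U (fun x => g (f x)).
Proof.
move=> oU oU' fU fC gC; apply: smooth_row => // j.
by apply: (smooth_comp oU oU' fU fC (g := fun y => g y 0 j)); exact: smooth_coord.
Qed.

Lemma smooth_diff_along n m (U : set 'rV[R]_n) (f : 'rV[R]_n -> 'rV[R]_m)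
    (w : 'rV[R]_n -> 'rV[R]_n) :
  open U -> smooth U f -> smooth U w -> smooth U (fun x => 'd f x (w x)).
Proof.
move=> oU fC wC; apply: smooth_row => // j.
rewrite (_ : (fun x => _) = fun x => \sum_i w x 0 i * 'd f x (delta_mx 0 i) 0 j); last first.
  by apply/funext => x; rewrite diff_expand summxE; apply: eq_bigr => i _; rewrite mxE.
apply: smooth_sum => // i _; apply: smoothM => //; first exact: smooth_coord.
by apply: smooth_coord => //; exact: smooth_diff.
Qed.

Lemma smooth_continuous n (W : normedModType R) (U : set 'rV[R]_n) (f : 'rV[R]_n -> W) x :
  smooth U f -> U x -> {for x, continuous f}.
Proof. by move=> fC Ux; exact: (fC 0%N x Ux). Qed.

Lemma linear_continuous_rV n (W : normedModType R) (l : 'rV[R]_n -> W) :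
  linear l -> continuous l.
Proof. by move=> L x; apply: differentiable_continuous; have [] := has_diff_linear x L. Qed.

Lemma diff_linear n (W : normedModType R) (l : 'rV[R]_n -> W) x v :
  linear l -> 'd l x v = l v.
Proof. by move=> L; have [_] := has_diff_linear x L. Qed.

Lemma open_preimage n m (U : set 'rV[R]_n) (A : set 'rV[R]_m) (f : 'rV[R]_n -> 'rV[R]_m) :
  open U -> smooth U f -> open A -> open [set x | U x /\ A (f x)].
Proof.
move=> oU fC oA; rewrite openE => x [Ux Afx].
have : nbhs (f x) A by exact: open_nbhs_nbhs.
move/(smooth_continuous fC Ux) => /= N.
exact: (filterI (open_nbhs_nbhs (conj oU Ux)) N).
Qed.

Lemma open_linear_preimage n m (A : set 'rV[R]_m) (l : 'rV[R]_n -> 'rV[R]_m) :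
  linear l -> open A -> open [set x | A (l x)].
Proof. by move=> L; apply: open_comp => x _; exact: linear_continuous_rV. Qed.

Lemma open_neq0 n (U : set 'rV[R]_n) (f : 'rV[R]_n -> R) :
  open U -> smooth U f -> open [set x | U x /\ f x != 0].
Proof.
move=> oU fC; rewrite openE => x [Ux fx0].
have O : open [set y : R | y != 0] by exact: open_neq.
have : nbhs (f x) [set y : R | y != 0] by exact: open_nbhs_nbhs.
move/(smooth_continuous fC Ux) => /= N.
exact: (filterI (open_nbhs_nbhs (conj oU Ux)) N).
Qed.

Lemma open_superlevel n (U : set 'rV[R]_n) (f : 'rV[R]_n -> R) c :
  open U -> smooth U f -> open [set x | U x /\ c < f x].
Proof.
move=> oU fC; rewrite openE => x [Ux fx0].
have O : open [set y : R | c < y] by exact: open_gt.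
have : nbhs (f x) [set y : R | c < y] by exact: open_nbhs_nbhs.
move/(smooth_continuous fC Ux) => /= N.
exact: (filterI (open_nbhs_nbhs (conj oU Ux)) N).
Qed.

(** A segment from a point of [S] to a point outside would separate the real
    line. *)
Lemma rV_connected n (S : set 'rV[R]_n) : open S -> open (~` S) -> S = set0 \/ S = setT.
Proof.
move=> oS oC; have [->|/set0P[x Sx]] := eqVneq S set0; first by left.
right; apply/seteqP; split=> // y _; apply: contrapT => Sy.
pose f (t : R) : 'rV[R]_n := x + t *: (y - x).
have fc : continuous f.
  move=> t; apply: cvgD; first exact: cvg_cst.
  by apply: cvgZr_tmp; exact: cvg_id.
have O1 : open (f @^-1` S) by apply: open_comp => // ? _; exact: fc.
have O2 : open (f @^-1` (~` S)) by apply: open_comp => // ? _; exact: fc.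
have C : connected [set: R] by apply/connected_intervalP.
have : f @^-1` S = setT.
  apply: C.
  - by exists 0; rewrite /= /f scale0r addr0.
  - by exists (f @^-1` S) => //; rewrite setTI.
  - exists (f @^-1` S); last by rewrite setTI.
    by rewrite -[f @^-1` S]setCK; apply: open_closedC.
move=> /(congr1 (@^~ 1)) /= E; apply: Sy.
have : S (f 1) by rewrite E.
by rewrite /f scale1r addrC subrK.
Qed.

End SmoothMaps.

(** * Symmetry of second derivatives *)

Section SymmetricSecondDerivative.
Context {R : realType} {n : nat}.
Local Notation V := 'rV[R]_n.
Implicit Types (f : V -> R) (U : set V).

Lemma is_derive_line f (p v : V) t :
  differentiable f (p + t *: v) ->
  is_derive t 1 (fun s : R => f (p + s *: v)) ('d f (p + t *: v) v).
Proof.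
move=> fd.
have L : has_diff (fun s : R => p + s *: v) t (fun s => s *: v).
  have I : has_diff (fun s : R => s) t id := is_diff_has_diff (is_diff_id t).
  have := has_diffD (has_diff_cst p t) (has_diffZl v I).
  by move=> /has_diff_ext; apply=> s; rewrite add0r.
have [D E] := has_diff_comp L (differentiable_has_diff fd).
apply: DeriveDef; first by apply/derivable1_diffP.
by rewrite deriveE // E scale1r.
Qed.

(** The mean value theorem, used first in the direction [v] for the difference
    of [f] along [w], and then in the direction [w]. *)
Lemma second_difference f U (x v w : V) (h : R) : open U -> smooth U f -> 0 < h ->
  (forall s t : R, 0 <= s <= h -> 0 <= t <= h -> U (x + s *: v + t *: w)) ->
  exists s t : R, [/\ 0 <= s <= h, 0 <= t <= h &
    f (x + h *: v + h *: w) - f (x + h *: v) - f (x + h *: w) + f x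
      = 'd (fun y => 'd f y v) (x + s *: v + t *: w) w * h * h].
Proof.
move=> oU fC h0 HU.
have d1 y : U y -> differentiable f y by move=> Uy; have [] := smooth_has_diff fC Uy.
have d2 y : U y -> differentiable (fun y => 'd f y v) y.
  by move=> Uy; have [] := smooth_has_diff (smooth_diff v fC) Uy.
have hh : 0 <= h <= h by rewrite lexx ltW.
have h00 : 0 <= (0 : R) <= h by rewrite lexx ltW.
pose F (s : R) := f ((x + h *: w) + s *: v) - f (x + s *: v).
pose F' (s : R) := 'd f ((x + h *: w) + s *: v) v - 'd f (x + s *: v) v.
have FD s : 0 <= s <= h -> is_derive s 1 F (F' s).
  move=> sh; apply: is_deriveB; apply: is_derive_line; apply: d1.
    by rewrite addrAC; exact: HU.
  by rewrite -[_ + _]addr0 -(scale0r w); exact: HU.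
have [||s sI Fs] := @MVT R F F' 0 h h0.
- by move=> s; rewrite in_itv /= => /andP[s0 sh]; apply: FD; rewrite !ltW.
- apply: derivable_within_continuous => s; rewrite in_itv /= => sh.
  by have [] := FD s sh.
have sh : 0 <= s <= h by move: sI; rewrite in_itv /= => /andP[? ?]; rewrite !ltW.
pose G (t : R) := 'd f ((x + s *: v) + t *: w) v.
pose G' (t : R) := 'd (fun y => 'd f y v) ((x + s *: v) + t *: w) w.
have GD t : 0 <= t <= h -> is_derive t 1 G (G' t).
  by move=> th; apply: (@is_derive_line (fun y => 'd f y v)); apply: d2; exact: HU.
have [||t tI Gt] := @MVT R G G' 0 h h0.
- by move=> t; rewrite in_itv /= => /andP[t0 th]; apply: GD; rewrite !ltW.
- apply: derivable_within_continuous => t; rewrite in_itv /= => th.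
  by have [] := GD t th.
exists s, t; split=> //.
  by move: tI; rewrite in_itv /= => /andP[? ?]; rewrite !ltW.
move: Fs Gt; rewrite /F /F' /G /G' !scale0r !addr0 subr0.
rewrite [x + h *: w + h *: v]addrAC [x + h *: w + s *: v]addrAC => Fs Gt.
by rewrite -Gt -Fs; ring.
Qed.

(** The second difference is symmetric in [v] and [w], so the two mixed second
    derivatives agree at two points close to [x]; both are continuous. *)
Theorem diff2_sym f U (x v w : V) : open U -> smooth U f -> U x ->
  'd (fun y => 'd f y v) x w = 'd (fun y => 'd f y w) x v.
Proof.
move=> oU fC Ux.
set A := fun y => 'd (fun y => 'd f y v) y w; set B := fun y => 'd (fun y => 'd f y w) y v.
suff: A x = B x by [].
have AC : {for x, continuous A} by apply: (@smooth_continuous _ _ _ U) => //; do 2!apply: smooth_diff.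
have BC : {for x, continuous B} by apply: (@smooth_continuous _ _ _ U) => //; do 2!apply: smooth_diff.
apply/eqP; rewrite -subr_eq0 -normr_le0; apply/ler_addgt0Pr => e e0; rewrite add0r.
have e2 : 0 < e / 2 by rewrite divr_gt0.
have : \forall y \near x, [/\ U y, `|A x - A y| < e / 2 & `|B x - B y| < e / 2].
  have NU := open_nbhs_nbhs (conj oU Ux).
  have /cvgrPdist_lt/(_ _ e2) NA := AC.
  have /cvgrPdist_lt/(_ _ e2) NB := BC.
  by near=> y; split; near: y.
move=> /nbhs_ballP[r /= r0 rP].
(* Side [h] for which the parallelogram spanned by [h v] and [h w] lies in the
   ball of radius [r]. *)
pose N := `|v| + `|w| + 1.
have N0 : 0 < N by rewrite ltr_wpDl // addr_ge0.
pose h := r / 2 / N.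
have h0 : 0 < h by rewrite !divr_gt0.
have I (s t : R) : 0 <= s <= h -> 0 <= t <= h -> ball x r (x + s *: v + t *: w).
  move=> /andP[s0 sh] /andP[t0 th]; rewrite -ball_normE /ball_ /=.
  rewrite -addrA opprD addrA subrr sub0r normrN.
  apply: le_lt_trans (ler_normD _ _) _; rewrite !normrZ !ger0_norm //.
  apply: (@le_lt_trans _ _ (h * N)).
    rewrite /N !mulrDr mulr1; apply: ler_wpDr; first exact: ltW.
    by apply: lerD; apply: ler_wpM2r.
  by rewrite /h divfK ?gt_eqF // ltr_pdivrMr // ltr_pMr // ltr1n.
have [|s [t [sh th E1]]] := @second_difference f U x v w h oU fC h0.
  by move=> s t sh th; have [] := rP _ (I s t sh th).
have [|s' [t' [sh' th' E2]]] := @second_difference f U x w v h oU fC h0.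
  by move=> s' t' sh' th'; rewrite addrAC; have [] := rP _ (I t' s' th' sh').
have [_ HA _] := rP _ (I s t sh th).
have [_ _ HB] := rP _ (I t' s' th' sh').
have E : A (x + s *: v + t *: w) = B (x + t' *: v + s' *: w).
  have hn0 : h != 0 by rewrite gt_eqF.
  apply: (mulIf hn0); apply: (mulIf hn0); rewrite /A -E1.
  rewrite [x + t' *: v + s' *: w]addrAC /B -E2 [x + h *: w + h *: v]addrAC.
  by ring.
rewrite (_ : A x - B x = (A x - A (x + s *: v + t *: w)) - (B x - B (x + t' *: v + s' *: w))); last first.
  by rewrite E opprB addrA subrK.
apply: le_trans (ler_normB _ _) _; rewrite [e]splitr; apply: lerD; exact: ltW.
Unshelve. all: by end_near. Qed.

End SymmetricSecondDerivative.

(** * Manifolds whose charts are onto the coordinate space *)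

Section FullCharts.
Context {R : realType}.

(** All domain conditions on coordinates disappear for such an atlas: openness
    and smoothness are tested on the whole coordinate space. Affine charts of
    projective spaces are of this kind, as are vector spaces and products; the
    quotients of tangent bundles are not. *)
Definition full_charts {d} (M : mfd R d) : Prop := forall i : chart M,
  (forall p, dom i p -> point i (coord i p) = p) /\
  (forall x, dom i (point i x) /\ coord i (point i x) = x).

Section One.
Context {d : nat} (M : mfd R d) (fM : full_charts M).

Lemma dom_point (i : chart M) x : dom i (point i x).
Proof. by have [_ /(_ x)[]] := fM i. Qed.

Lemma coordK (i : chart M) x : coord i (point i x) = x.
Proof. by have [_ /(_ x)[]] := fM i. Qed.

Lemma pointK (i : chart M) p : dom i p -> point i (coord i p) = p.
Proof. by have [+ _] := fM i; exact. Qed.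

Lemma image_dom (i : chart M) (S : set M) :
  coord i @` (dom i `&` S) = [set x | S (point i x)].
Proof.
apply/seteqP; split=> [_ [p [ip Sp] <-]|x Sx] /=; first by rewrite pointK.
by exists (point i x); [split=> //; exact: dom_point|exact: coordK].
Qed.

Lemma cod_full (i : chart M) : cod i = setT.
Proof. by rewrite /cod -[dom i]setIT image_dom. Qed.

Lemma mopen_full (S : set M) :
  mopen S <-> forall i : chart M, open [set x | S (point i x)].
Proof. by split=> H i; move: (H i); rewrite image_dom. Qed.

(** The domain of each chart is connected, and all domains contain [p0]. *)
Lemma full_connected p0 : (forall i : chart M, dom i p0) ->
  (forall p : M, exists i : chart M, dom i p) -> mconnected M.
Proof.
move=> ip0 cov S /mopen_full oS /mopen_full oC.
have H i : (forall p, dom i p -> ~ S p) \/ (forall p, dom i p -> S p).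
  have [E|E] := rV_connected (oS i) (oC i).
    left=> p ip Sp; suff : [set x | S (point i x)] (coord i p) by rewrite E.
    by rewrite /= pointK.
  right=> p ip; suff : [set x | S (point i x)] (coord i p) by rewrite /= pointK.
  by rewrite E.
have [Sp0|Sp0] := pselect (S p0).
  right; apply/seteqP; split=> // p _; have [i ip] := cov p.
  by have [/(_ _ (ip0 i))|] := H i => //; apply.
left; apply/seteqP; split=> // p Sp; have [i ip] := cov p.
by have [/(_ _ ip)|/(_ _ (ip0 i))] := H i.
Qed.

Definition smooth_transitions : Prop := forall i j : chart M,
  open [set x | dom j (point i x)] /\
  smooth [set x | dom j (point i x)] (coord j \o point i).

(** Smoothness makes the sets where [f] is below and above the midpoint of [f p]
    and [f q] open. *)
Lemma separated_by_function (f : M -> R) p q : f p < f q ->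
  (forall i : chart M, smooth setT (f \o point i)) ->
  exists S T : set M, [/\ mopen S, mopen T, S p, T q & S `&` T = set0].
Proof.
move=> fpq fC; pose c := (f p + f q) / 2.
exists [set r | f r < c], [set r | c < f r]; split.
- apply/mopen_full => i /=; have := open_superlevel (c := - c) (@openT _) (smoothN (@openT _) (fC i)).
  by congr open; apply/seteqP; split=> x /=; rewrite ltrN2 => // -[].
- apply/mopen_full => i /=; have := open_superlevel (c := c) (@openT _) (fC i).
  by congr open; apply/seteqP; split=> x //= -[].
- by rewrite /= /c; exact: (midf_lt fpq).1.
- by rewrite /= /c; exact: (midf_lt fpq).2.
- by apply/seteqP; split=> // r [/= /lt_trans H /H]; rewrite ltxx.
Qed.

Lemma full_manifold : (forall p : M, dom (prefer p) p) -> smooth_transitions ->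
  (forall p q : M, p <> q -> exists S T : set M,
     [/\ mopen S, mopen T, S p, T q & S `&` T = set0]) ->
  (exists c : nat -> chart M, forall p : M, exists k, dom (c k) p) ->
  is_manifold M.
Proof.
move=> pref tr H c; split=> //; first by move=> i p; exact: pointK.
by move=> i j /=; rewrite image_dom; exact: tr.
Qed.

End One.

Section Transitions.
Context {d : nat} (M : mfd R d) (fM : full_charts M) (mM : is_manifold M).

Lemma prefer_dom (p : M) : dom (prefer p) p.
Proof. by case: mM. Qed.

Lemma manifold_transitions : smooth_transitions M.
Proof. by move=> i j; case: mM => _ _ /(_ i j) /=; rewrite image_dom. Qed.

Lemma transition_diff (i j : chart M) x : dom j (point i x) ->
  differentiable (coord j \o point i) x.
Proof.
by move=> jx; have [_ /smooth_has_diff H] := manifold_transitions i j; have [] := H _ jx.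
Qed.

(** The change of charts through [j] agrees with the direct one near [x] only,
    which is enough for the differentials. *)
Lemma transition_chain (i j k : chart M) x v : dom j (point i x) -> dom k (point i x) ->
  'd (coord k \o point j) (coord j (point i x)) ('d (coord j \o point i) x v)
    = 'd (coord k \o point i) x v.
Proof.
move=> jx kx; have [oj _] := manifold_transitions i j.
have kd : differentiable (coord k \o point j) (coord j (point i x)).
  by apply: transition_diff; rewrite pointK.
have H := has_diff_comp (differentiable_has_diff (transition_diff jx))
             (differentiable_has_diff kd).
have E : \forall y \near x, (coord k \o point j) ((coord j \o point i) y)
    = (coord k \o point i) y.
  by apply: open_near oj _ jx => y jy; rewrite /= pointK.
by have [_ E2] := has_diff_near E H; exact: (esym (E2 v)).
Qed.

Lemma transition_id (i : chart M) x v : 'd (coord i \o point i) x v = v.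
Proof.
rewrite (_ : coord i \o point i = id); last by apply/funext => y; exact: coordK.
by rewrite (diff_linear (l := id)).
Qed.

Lemma vec_prefer (p : M) v : vec (prefer p) (coord (prefer p) p) v = v.
Proof. by rewrite /vec pointK ?transition_id //; exact: prefer_dom. Qed.

Lemma comp_vec (i : chart M) x a : comp i (point i x) (vec i x a) = a.
Proof.
by rewrite /comp /vec transition_chain ?transition_id //; [exact: prefer_dom|exact: dom_point].
Qed.

Lemma vec_comp (i : chart M) p v : dom i p -> vec i (coord i p) (comp i p v) = v.
Proof.
move=> ip; rewrite /vec /comp pointK //.
set k := prefer p; have kp : dom k p := prefer_dom p.
have ip' : dom i (point k (coord k p)) by rewrite (pointK fM kp).
have kp' : dom k (point k (coord k p)) by rewrite (pointK fM kp).
have := transition_chain v ip' kp'; rewrite (pointK fM kp) => E.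
exact: etrans E (transition_id k (coord k p) v).
Qed.

End Transitions.

End FullCharts.

(** * Complex structures with constant components in charts *)

Lemma lsubmx_is_linear (R : realType) n m : linear (@lsubmx R 1 n m).
Proof. by move=> k a b; rewrite linearP. Qed.

Lemma rsubmx_is_linear (R : realType) n m : linear (@rsubmx R 1 n m).
Proof. by move=> k a b; rewrite linearP. Qed.

Lemma vec_linear (R : realType) d (M : mfd R d) (i : chart M) x : linear (vec i x).
Proof. by move=> k a b; rewrite /vec; exact: linearP. Qed.

Lemma comp_linear (R : realType) d (M : mfd R d) (i : chart M) p : linear (comp i p).
Proof. by move=> k a b; rewrite /comp; exact: linearP. Qed.

Section Kahler.
Context {R : realType} {d : nat} (N : herm R d).

Definition const_cpx (J0 : chart N -> 'rV[R]_d -> 'rV[R]_d) : Prop :=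
  forall i x a, cpx (point i x) (vec i x a) = vec i x (J0 i a).

(** Constant components of [cpx] in each chart, as in holomorphic coordinates,
    replace the smoothness and the integrability of the complex structure; this
    form of the conditions passes to products at once. *)
Definition pre_kahler : Prop :=
  [/\ full_charts N /\ is_riemannian N,
      (forall p : N, linear (cpx p)) /\
      (forall (p : N) v, cpx p (cpx p v) = - v),
      (forall (p : N) v w, met p (cpx p v) (cpx p w) = met p v w),
      (exists J0, const_cpx J0) & closed_omega N].

(** In a chart, [cpx] is a constant linear map [J0], which commutes with the
    differentials of components. The terms of the Nijenhuis tensor then cancel
    in pairs, by [J0 (J0 v) = - v]. *)
Lemma kahler_of_pre : pre_kahler -> is_kahler N.
Proof.
move=> [[fN rN] [Jl JJ] Jh [J0 cJ] cl]; have mN : is_manifold N by case: rN.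
have J0E i x a : J0 i a = comp i (point i x) (cpx (point i x) (vec i x a)).
  by rewrite cJ comp_vec.
have J0l i : linear (J0 i).
  by move=> k a b; rewrite !(J0E i 0) vec_linear Jl comp_linear.
have J0J i a : J0 i (J0 i a) = - a.
  by rewrite [LHS](J0E i 0) -cJ JJ -scaleN1r -[- 1 *: _]addr0 comp_linear comp_vec // /comp linear0 addr0 scaleN1r.
split=> //.
  move=> i a; rewrite (_ : (fun x => _) = fun=> J0 i a); first exact: smooth_cst.
  by apply/funext => x; rewrite -J0E.
split=> // X Y sX sY p /=.
set i := prefer p; have ip : dom i p := prefer_dom mN p.
have cE v : cpx p v = J0 i v.
  have := cJ i (coord i p) v; rewrite pointK // => E.
  by move: E; rewrite !(vec_prefer fN mN).
have JE (Z : vfield N) : vf_comp i (fun q => cpx q (Z q)) = fun x => J0 i (vf_comp i Z x).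
  apply/funext => x; rewrite /vf_comp.
  have := vec_comp fN mN (Z (point i x)) (dom_point fN i x); rewrite coordK // => {1}<-.
  by rewrite -J0E.
have D (Z : vfield N) v : smooth_vf Z ->
    'd (vf_comp i (fun q => cpx q (Z q))) (coord i p) v = J0 i ('d (vf_comp i Z) (coord i p) v).
  move=> sZ; rewrite JE.
  have ZD : has_diff (vf_comp i Z) (coord i p) ('d (vf_comp i Z) (coord i p)).
    apply: (smooth_has_diff (sZ i)); rewrite cod_full //.
  by have [_ E] := has_diff_comp ZD (has_diff_linear (vf_comp i Z (coord i p)) (J0l i)); exact: E.
pose a v := 'd (vf_comp i Y) (coord i p) v; pose b v := 'd (vf_comp i X) (coord i p) v.
have B1 : bracket X Y p = a (X p) - b (Y p) by [].
have B2 : bracket (fun q => cpx q (X q)) Y p = a (J0 i (X p)) - J0 i (b (Y p)).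
  by rewrite -cE; congr (_ - _); exact: (D X).
have B3 : bracket X (fun q => cpx q (Y q)) p = J0 i (a (X p)) - b (J0 i (Y p)).
  by rewrite -(cE (Y p)); congr (_ - _); exact: (D Y).
have B4 : bracket (fun q => cpx q (X q)) (fun q => cpx q (Y q)) p
    = J0 i (a (J0 i (X p))) - J0 i (b (J0 i (Y p))).
  by rewrite -(cE (X p)) -(cE (Y p)); congr (_ - _); [exact: (D Y)|exact: (D X)].
rewrite B1 B2 B3 B4 !cE {B1 B2 B3 B4 D}.
pose l := HB.pack (J0 i) (GRing.isLinear.Build _ _ _ _ _ (J0l i)) : {linear 'rV[R]_d -> 'rV[R]_d}.
have B u v : J0 i (u - v) = J0 i u - J0 i v by exact: (linearB l).
rewrite !B !J0J opprB opprK.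
rewrite !addrA; apply/rowP => k; rewrite !mxE.
by ring.
Qed.

End Kahler.

(** * Products of Kähler manifolds *)

Section RowMx.
Context {R : realType}.

Lemma row_mx0_is_linear n m : linear (fun a : 'rV[R]_n => row_mx a (0 : 'rV[R]_m)).
Proof. by move=> k a b; rewrite scale_row_mx add_row_mx scaler0 addr0. Qed.

Lemma row_0mx_is_linear n m : linear (fun a : 'rV[R]_m => row_mx (0 : 'rV[R]_n) a).
Proof. by move=> k a b; rewrite scale_row_mx add_row_mx scaler0 addr0. Qed.

Lemma row_mx_split n m (a : 'rV[R]_n) (b : 'rV[R]_m) : row_mx a b = row_mx a 0 + row_mx 0 b.
Proof. by rewrite add_row_mx addr0 add0r. Qed.

Lemma smooth_row_mx p n m (U : set 'rV[R]_p) (f : 'rV[R]_p -> 'rV[R]_n)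
    (g : 'rV[R]_p -> 'rV[R]_m) : open U -> smooth U f -> smooth U g ->
  smooth U (fun x => row_mx (f x) (g x)).
Proof.
move=> oU fC gC; under eq_fun do rewrite row_mx_split.
apply: smoothD => //.
  exact: (smooth_postcomp oU (@row_mx0_is_linear n m) fC).
exact: (smooth_postcomp oU (@row_0mx_is_linear n m) gC).
Qed.

Lemma has_diff_row_mx (V : normedModType R) n m (f : V -> 'rV[R]_n) (g : V -> 'rV[R]_m)
    x df dg : has_diff f x df -> has_diff g x dg ->
  has_diff (fun y => row_mx (f y) (g y)) x (fun v => row_mx (df v) (dg v)).
Proof.
move=> fD gD.
have := has_diffD (has_diff_comp fD (has_diff_linear (f x) (@row_mx0_is_linear n m)))
  (has_diff_comp gD (has_diff_linear (g x) (@row_0mx_is_linear n m))).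
under eq_fun do rewrite -row_mx_split.
by move=> /has_diff_ext; apply => v; rewrite -row_mx_split.
Qed.

Lemma has_diff_lsubmx n m (W : normedModType R) (f : 'rV[R]_n -> W) (x : 'rV[R]_(n + m)) df :
  has_diff f (lsubmx x) df ->
  has_diff (fun y : 'rV[R]_(n + m) => f (lsubmx y)) x (fun v => df (lsubmx v)).
Proof. by move=> H; apply: has_diff_comp H; apply: has_diff_linear; exact: lsubmx_is_linear. Qed.

Lemma has_diff_rsubmx n m (W : normedModType R) (f : 'rV[R]_m -> W) (x : 'rV[R]_(n + m)) df :
  has_diff f (rsubmx x) df ->
  has_diff (fun y : 'rV[R]_(n + m) => f (rsubmx y)) x (fun v => df (rsubmx v)).
Proof. by move=> H; apply: has_diff_comp H; apply: has_diff_linear; exact: rsubmx_is_linear. Qed.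

Lemma open_prod_charts n m (A : set 'rV[R]_n) (B : set 'rV[R]_m) : open A -> open B ->
  open [set x : 'rV[R]_(n + m) | A (lsubmx x) /\ B (rsubmx x)].
Proof.
move=> oA oB; apply: (@openI _ [set x | A (lsubmx x)] [set x | B (rsubmx x)]).
  by apply: open_linear_preimage => //; exact: lsubmx_is_linear.
by apply: open_linear_preimage => //; exact: rsubmx_is_linear.
Qed.

Lemma smooth_prod_charts n m k l (A : set 'rV[R]_n) (B : set 'rV[R]_m)
    (f : 'rV[R]_n -> 'rV[R]_k) (g : 'rV[R]_m -> 'rV[R]_l) :
  open A -> open B -> smooth A f -> smooth B g ->
  smooth [set x : 'rV[R]_(n + m) | A (lsubmx x) /\ B (rsubmx x)]
    (fun x => row_mx (f (lsubmx x)) (g (rsubmx x))).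
Proof.
move=> oA oB fC gC; have oAB := open_prod_charts oA oB.
apply: smooth_row_mx => //.
  apply: (smooth_comp_row oAB oA _ _ fC); first by move=> x [].
  by apply: smooth_linear; exact: lsubmx_is_linear.
apply: (smooth_comp_row oAB oB _ _ gC); first by move=> x [].
by apply: smooth_linear; exact: rsubmx_is_linear.
Qed.

End RowMx.

Section ProductManifold.
Context {R : realType} {d d' : nat} (M : mfd R d) (M' : mfd R d').
Hypotheses (fM : full_charts M) (fM' : full_charts M').

Lemma prod_full : full_charts (prod_mfd M M').
Proof.
move=> [i i']; split=> [[p p'] /= [ip ip']|x] /=.
  by rewrite row_mxKl row_mxKr !pointK.
by split; [split; exact: dom_point|rewrite !coordK // hsubmxK].
Qed.

Hypotheses (mM : is_manifold M) (mM' : is_manifold M').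

Lemma prod_manifold : is_manifold (prod_mfd M M').
Proof.
apply: (full_manifold prod_full).
- by move=> [p p']; split; exact: prefer_dom.
- move=> [i i'] [j j'] /=.
  have [oi ci] := manifold_transitions fM mM i j.
  have [oi' ci'] := manifold_transitions fM' mM' i' j'.
  split; first exact: (open_prod_charts oi oi').
  have := smooth_prod_charts oi oi' ci ci'; exact.
- move=> [p p'] [q q'] /= pq.
  have [pq1|pq1] := pselect (p = q).
    have pq2 : p' <> q' by move=> E; apply: pq; rewrite pq1 E.
    have [S [T [oS oT Sp Tq ST]]] : exists S T, [/\ mopen S, mopen T, S p', T q' & S `&` T = set0].
      by case: mM' => _ _ _ /(_ _ _ pq2).
    exists [set u | S u.2], [set u | T u.2]; split=> //.
    + apply/(mopen_full prod_full) => -[i i'] /=.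
      exact: (open_linear_preimage (A := [set y | S (point i' y)]) (@rsubmx_is_linear _ _ _) ((mopen_full fM' _).1 oS i')).
    + apply/(mopen_full prod_full) => -[i i'] /=.
      exact: (open_linear_preimage (A := [set y | T (point i' y)]) (@rsubmx_is_linear _ _ _) ((mopen_full fM' _).1 oT i')).
    + apply/seteqP; split=> // u [/= Su Tu]; suff : (S `&` T) u.2 by rewrite ST.
      by [].
  have [S [T [oS oT Sp Tq ST]]] : exists S T, [/\ mopen S, mopen T, S p, T q & S `&` T = set0].
    by case: mM => _ _ _ /(_ _ _ pq1).
  exists [set u | S u.1], [set u | T u.1]; split=> //.
  + apply/(mopen_full prod_full) => -[i i'] /=.
      exact: (open_linear_preimage (A := [set y | S (point i y)]) (@lsubmx_is_linear _ _ _) ((mopen_full fM _).1 oS i)).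
  + apply/(mopen_full prod_full) => -[i i'] /=.
      exact: (open_linear_preimage (A := [set y | T (point i y)]) (@lsubmx_is_linear _ _ _) ((mopen_full fM _).1 oT i)).
  + apply/seteqP; split=> // u [/= Su Tu]; suff : (S `&` T) u.1 by rewrite ST.
    by [].
- have [c cP] : exists c : nat -> chart M, forall p : M, exists k, dom (c k) p by case: mM.
  have [c' cP'] : exists c : nat -> chart M', forall p : M', exists k, dom (c k) p by case: mM'.
  exists (fun k => let: (a, b) := odflt (0%N, 0%N) (unpickle k) in (c a, c' b)) => -[p p'].
  have [k kp] := cP p; have [k' kp'] := cP' p'.
  by exists (pickle (k, k')); rewrite pickleK.
Qed.

Lemma prod_vec (i : chart M) (i' : chart M') x a :
  @vec _ _ (prod_mfd M M') (i, i') x a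
    = row_mx (vec i (lsubmx x) (lsubmx a)) (vec i' (rsubmx x) (rsubmx a)).
Proof.
rewrite {1}/vec.
have D := differentiable_has_diff (transition_diff fM mM (prefer_dom mM (point i (lsubmx x)))).
have D' := differentiable_has_diff (transition_diff fM' mM' (prefer_dom mM' (point i' (rsubmx x)))).
have [_ E] := has_diff_row_mx (has_diff_lsubmx D) (has_diff_rsubmx D'); exact: (E a).
Qed.

End ProductManifold.

Section ProductHermitian.
Context {R : realType} {d d' : nat} (N : herm R d) (N' : herm R d').
Hypotheses (kN : pre_kahler N) (kN' : pre_kahler N').

Let fN : full_charts N. Proof. by case: kN => -[]. Qed.
Let fN' : full_charts N'. Proof. by case: kN' => -[]. Qed.
Let rN : is_riemannian N. Proof. by case: kN => -[]. Qed.
Let rN' : is_riemannian N'. Proof. by case: kN' => -[]. Qed.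
Let mN : is_manifold N. Proof. by case: rN. Qed.
Let mN' : is_manifold N'. Proof. by case: rN'. Qed.

Lemma prod_riemannian : is_riemannian (prod_herm N N').
Proof.
have met0 (p : N) v : met p v (0 : 'rV[R]_d) = 0 :> R.
  case: rN => _ _ L _ _; have := L p v 1 0 0; rewrite scaler0 addr0 mul1r => E.
  by apply: (addIr (met p v 0)); rewrite -E add0r.
have met0' (p : N') v : met p v (0 : 'rV[R]_d') = 0 :> R.
  case: rN' => _ _ L _ _; have := L p v 1 0 0; rewrite scaler0 addr0 mul1r => E.
  by apply: (addIr (met p v 0)); rewrite -E add0r.
have ge0 (p : N) v : 0 <= met p v v.
  have [->|v0] := eqVneq v 0; first by rewrite met0.
  by case: rN => _ _ _ /(_ p v v0) /ltW.
have ge0' (p : N') v : 0 <= met p v v.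
  have [->|v0] := eqVneq v 0; first by rewrite met0'.
  by case: rN' => _ _ _ /(_ p v v0) /ltW.
split.
- exact: prod_manifold.
- move=> [p p'] v w /=; case: rN => _ -> _ _ _; case: rN' => _ -> _ _ _ //.
- move=> [p p'] v c w w' /=; rewrite !lsubmx_is_linear !rsubmx_is_linear.
  case: rN => _ _ -> _ _; case: rN' => _ _ -> _ _; ring.
- move=> [p p'] v v0 /=.
  have [l0|l0] := eqVneq (lsubmx v) 0; last first.
    by apply: ltr_wpDr; [exact: ge0'|case: rN => _ _ _ + _; exact].
  have r0 : rsubmx v != 0.
    by apply: contraNneq v0 => r0; rewrite -[v]hsubmxK l0 r0 row_mx0.
  by apply: ltr_wpDl; [exact: ge0|case: rN' => _ _ _ + _; exact].
- move=> [i i'] a b; rewrite (cod_full (prod_full fN fN')).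
  rewrite (_ : (fun x => _) = fun x : 'rV[R]_(d + d') =>
    met (point i (lsubmx x)) (vec i (lsubmx x) (lsubmx a)) (vec i (lsubmx x) (lsubmx b)) +
    met (point i' (rsubmx x)) (vec i' (rsubmx x) (rsubmx a)) (vec i' (rsubmx x) (rsubmx b))); last first.
    by apply/funext => x; rewrite !prod_vec //= !row_mxKl !row_mxKr.
  case: rN => _ _ _ _ /(_ i (lsubmx a) (lsubmx b)); rewrite cod_full // => S.
  case: rN' => _ _ _ _ /(_ i' (rsubmx a) (rsubmx b)); rewrite cod_full // => S'.
  apply: smoothD; first exact: openT.
    apply: (smooth_comp (@openT _) (@openT _) _ _ S) => //.
    by apply: smooth_linear; exact: lsubmx_is_linear.
  apply: (smooth_comp (@openT _) (@openT _) _ _ S') => //.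
  by apply: smooth_linear; exact: rsubmx_is_linear.
Qed.

(** In a chart, the Kähler form at [b, c] is the metric at [J0 b, c] with [J0]
    constant. *)
Lemma omega_smooth {e} (P : herm R e) (kP : pre_kahler P) (i : chart P) b c :
  smooth setT (fun y => omega (point i y) (vec i y b) (vec i y c)).
Proof.
case: kP => -[fP rP] _ _ [J0 cJ] _.
case: rP => _ _ _ _ /(_ i (J0 i b) c); rewrite cod_full //.
by under eq_fun do rewrite -cJ.
Qed.

(** The Kähler form of the product is the sum of the two pulled back ones, so
    its cyclic sum of derivatives splits. *)
Lemma prod_pre_kahler : pre_kahler (prod_herm N N').
Proof.
case: (kN) => _ [Jl JJ] Jh [J0 cJ] cl; case: (kN') => _ [Jl' JJ'] Jh' [J0' cJ'] cl'.
split; first by split; [exact: prod_full|exact: prod_riemannian].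
- split=> [[p p'] k a b /=|[p p'] v /=].
    rewrite !lsubmx_is_linear !rsubmx_is_linear Jl Jl'.
    by rewrite scale_row_mx add_row_mx.
  by rewrite !row_mxKl !row_mxKr JJ JJ' -opp_row_mx hsubmxK.
- by move=> [p p'] v w /=; rewrite !row_mxKl !row_mxKr Jh Jh'.
- exists (fun i a => row_mx (J0 i.1 (lsubmx a)) (J0' i.2 (rsubmx a))) => -[i i'] x a.
  by rewrite !prod_vec //= !row_mxKl !row_mxKr cJ cJ'.
- move=> [i i'] x _ a b c om.
  pose l (u w : 'rV[R]_(d + d')) y := omega (point i y) (vec i y (lsubmx u)) (vec i y (lsubmx w)).
  pose r (u w : 'rV[R]_(d + d')) y := omega (point i' y) (vec i' y (rsubmx u)) (vec i' y (rsubmx w)).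
  pose dl u w (v : 'rV[R]_(d + d')) := 'd (l u w) (lsubmx x) (lsubmx v).
  pose dr u w (v : 'rV[R]_(d + d')) := 'd (r u w) (rsubmx x) (rsubmx v).
  have D u w v : 'd (om u w) x v = dl u w v + dr u w v.
    have -> : om u w = fun y => l u w (lsubmx y) + r u w (rsubmx y).
      by apply/funext => y; rewrite /om /l /r /omega !prod_vec //= !row_mxKl !row_mxKr.
    have S := @smooth_has_diff _ _ _ setT _ (lsubmx x) (omega_smooth kN i (lsubmx u) (lsubmx w)) I.
    have S' := @smooth_has_diff _ _ _ setT _ (rsubmx x) (omega_smooth kN' i' (rsubmx u) (rsubmx w)) I.
    by have [_ E] := has_diffD (has_diff_lsubmx S) (has_diff_rsubmx S'); exact: E.
  have H : dl b c a + dl c a b + dl a b c = 0 by apply: cl; rewrite cod_full.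
  have H' : dr b c a + dr c a b + dr a b c = 0 by apply: cl'; rewrite cod_full.
  have -> : 'd (om b c) x a + 'd (om c a) x b + 'd (om a b) x c
    = (dl b c a + dl c a b + dl a b c) + (dr b c a + dr c a b + dr a b c).
    rewrite [X in X + _ + _](D b c a) [X in _ + X + _](D c a b) [X in _ + _ + X](D a b c).
    by move: (dl _ _ _) (dl _ _ _) (dl _ _ _) (dr _ _ _) (dr _ _ _) (dr _ _ _) => ??????; ring.
  by rewrite H H' addr0.
Qed.

End ProductHermitian.

(** * Differentiation along vector fields, inverse matrices *)

Section Calculus.
Context {R : realType}.

Lemma has_diffZ (V : normedModType R) n (f : V -> R) (g : V -> 'rV[R]_n) x df dg :
  has_diff f x df -> has_diff g x dg ->
  has_diff (fun y => f y *: g y) x (fun v => f x *: dg v + df v *: g x).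
Proof.
move=> fD gD; apply: has_diff_row => j.
have gj := has_diff_comp gD (has_diff_coord (g x) j).
have := has_diffM fD gj.
rewrite (_ : (fun y => (f y *: g y) 0 j) = fun y => f y * g y 0 j); last first.
  by apply/funext => y; rewrite mxE.
by move=> /has_diff_ext; apply => v; rewrite !mxE [g x 0 j * _]mulrC.
Qed.

(** Product rule for the pairing of ['d f] with a vector field: in the first
    term the field is frozen at [x]. *)
Lemma has_diff_along n m (f : 'rV[R]_n -> 'rV[R]_m) (w : 'rV[R]_n -> 'rV[R]_n) x dw :
  smooth setT f -> has_diff w x dw ->
  has_diff (fun y => 'd f y (w y)) x
    (fun v => 'd (fun y => 'd f y (w x)) x v + 'd f x (dw v)).
Proof.
move=> fC wD.
have D i : has_diff (fun y => 'd f y (delta_mx 0 i)) x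
    ('d (fun y => 'd f y (delta_mx 0 i)) x).
  exact: (smooth_has_diff (smooth_diff (delta_mx 0 i) fC)).
have W i := has_diff_comp wD (has_diff_coord (w x) i).
have := has_diff_sum (index_enum 'I_n) (P := predT) (fun i _ => has_diffZ (W i) (D i)).
rewrite (_ : (fun y => \sum_i _) = fun y => 'd f y (w y)); last first.
  by apply/funext => y; rewrite [RHS]diff_expand.
move=> /has_diff_ext; apply => v.
rewrite big_split /=; congr (_ + _); last first.
  by apply/esym; exact: diff_expand.
have := has_diff_sum (index_enum 'I_n) (P := predT) (fun i _ =>
  has_diffZ (has_diff_cst (w x 0 i) x) (D i)).
rewrite (_ : (fun y => \sum_i _) = fun y => 'd f y (w x)); last first.
  by apply/funext => y; rewrite [RHS]diff_expand.
move=> [_ /(_ v) E]; apply/esym; apply: etrans E _.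
by apply: eq_bigr => i _; rewrite scale0r addr0.
Qed.

Lemma diff_coord n m (f : 'rV[R]_n -> 'rV[R]_m) x v j : differentiable f x ->
  'd f x v 0 j = 'd (fun y => f y 0 j) x v.
Proof.
move=> fd; have [_ E] := has_diff_comp (differentiable_has_diff fd) (has_diff_coord (f x) j).
exact: (esym (E v)).
Qed.

Lemma diff2_sym_row n m (f : 'rV[R]_n -> 'rV[R]_m) x v w : smooth setT f ->
  'd (fun y => 'd f y v) x w = 'd (fun y => 'd f y w) x v.
Proof.
move=> fC; apply/rowP => j.
have D u y : 'd f y u 0 j = 'd (fun y => f y 0 j) y u.
  by apply: diff_coord; have [] := smooth_has_diff fC (x := y) I.
have E u u' : 'd (fun y => 'd f y u) x u' 0 j
    = 'd (fun y => 'd (fun y => f y 0 j) y u) x u'.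
  rewrite diff_coord; last by have [] := smooth_has_diff (smooth_diff u fC) (x := x) I.
  by congr ('d _ x u'); apply/funext => y; exact: D.
apply: etrans (E v w) _; apply: etrans _ (esym (E w v)).
by apply: (@diff2_sym _ _ _ setT) => //; [exact: openT|apply: smooth_coord => //; exact: openT].
Qed.

Lemma smooth_det n k (U : set 'rV[R]_n) (A : 'rV[R]_n -> 'M[R]_k) : open U ->
  (forall i j, smooth U (fun x => A x i j)) -> smooth U (fun x => \det (A x)).
Proof.
move=> oU AC; rewrite /determinant; apply: smooth_sum => // s _.
by apply: smoothM => //; [exact: smooth_cst|exact: smooth_prod].
Qed.

(** Cramer's rule. *)
Lemma smooth_invmx n k (U : set 'rV[R]_n) (A : 'rV[R]_n -> 'M[R]_k) : open U ->
  (forall i j, smooth U (fun x => A x i j)) -> (forall x, U x -> A x \in unitmx) ->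
  forall i j, smooth U (fun x => invmx (A x) i j).
Proof.
move=> oU AC Au i j.
apply: (@smooth_eq _ _ _ U (fun x => (\det (A x))^-1 * cofactor (A x) j i)) => //.
  by move=> x Ux; rewrite /invmx Au // !mxE.
apply: smoothM => //.
  apply: smoothV => //; first exact: smooth_det.
  by move=> x /Au; rewrite unitmxE unitfE.
rewrite /cofactor; apply: smoothM => //; first exact: smooth_cst.
apply: smooth_det => // a b; rewrite (_ : (fun x => _) = fun x => A x (lift j a) (lift i b)) //.
by apply/funext => x; rewrite !mxE.
Qed.

End Calculus.

(** * Families of distributions as manifolds with one chart *)

Section SingleChart.
Context {R : realType} {n : nat} (E : family R n).
Local Notation M := (family_mfd E).

Hypothesis par_inj : injective (@par R n E).
Hypothesis par_surj : forall p, @member R n E p -> exists theta, @par R n E theta = p.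

Lemma family_full : full_charts M.
Proof.
move=> i; have H (p : M) : par (coord i p) = sval p.
  rewrite /= /some_such; case: pselect => [ex|]; last by case; exact: par_surj (svalP p).
  by case: cid.
split=> [p _|x].
  by have := H p; case: p => q mq /= E0; exact: eq_exist.
by split=> //; apply: par_inj; rewrite H.
Qed.

Let fM := family_full.

Lemma family_vec (i : chart M) x a : vec i x a = a.
Proof. exact: transition_id. Qed.

Lemma family_comp (i : chart M) p v : comp i p v = v.
Proof. exact: transition_id. Qed.

Lemma family_coordK x : coord (tt : chart M) (point (tt : chart M) x) = x.
Proof. exact: (coordK fM). Qed.

Lemma family_pointK (p : M) : point (tt : chart M) (coord (tt : chart M) p) = p.
Proof. exact: (pointK fM). Qed.

Lemma family_vf_comp (i : chart M) (X : vfield M) : vf_comp i X = X \o point i.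
Proof. by apply/funext => x; rewrite /vf_comp family_comp. Qed.

Lemma family_smooth_vf (X : vfield M) :
  smooth_vf X <-> smooth setT (X \o point (tt : chart M)).
Proof.
by split=> [/(_ tt)|H []]; rewrite cod_full // family_vf_comp.
Qed.

Lemma family_smooth_fun (f : M -> R) :
  smooth_fun f <-> smooth setT (f \o point (tt : chart M)).
Proof. by split=> [/(_ tt)|H []]; rewrite cod_full. Qed.

Lemma family_bracket (X Y : vfield M) p :
  bracket X Y p = 'd (Y \o point (tt : chart M)) (coord (tt : chart M) p) (X p)
    - 'd (X \o point (tt : chart M)) (coord (tt : chart M) p) (Y p).
Proof. by rewrite /bracket !family_vf_comp. Qed.

(** Two distributions are separated by a natural parameter on which they
    differ. *)
Lemma family_manifold : is_manifold M.
Proof.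
apply: full_manifold => //.
- move=> [] []; split; first by rewrite (_ : [set _ | _] = setT) //; exact: openT.
  apply: (@smooth_eq _ _ _ _ id); first by rewrite (_ : [set _ | _] = setT) //; exact: openT.
    by move=> x _; rewrite -[LHS]family_coordK.
  exact: smooth_linear.
- move=> p q pq; have /rowP pq' : coord (tt : chart M) p <> coord (tt : chart M) q.
    by move=> E0; apply: pq; rewrite -[p]family_pointK E0 family_pointK.
  have [i pqi] : exists i, coord (tt : chart M) p 0 i != coord (tt : chart M) q 0 i.
    apply: contrapT => H; apply: pq' => i; apply/eqP; apply: contrapT => /negP ne.
    by apply: H; exists i.
  have sm s : forall c : chart M, smooth setT ((fun p : M => s * coord (tt : chart M) p 0 i) \o point c).
    move=> []; apply: (@smooth_eq _ _ _ _ (fun x => s * x 0 i)); first exact: openT.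
      by move=> x _; rewrite -[in LHS](family_coordK x).
    apply: smoothM; [exact: openT|exact: smooth_cst|].
    by apply: smooth_linear; exact: coord_is_linear.
  have [lt|gt|/eqP] := ltgtP (coord (tt : chart M) p 0 i) (coord (tt : chart M) q 0 i);
    last by rewrite (negPf pqi).
    by apply: (separated_by_function fM _ (sm 1)); rewrite !mul1r.
  by apply: (separated_by_function fM _ (sm (-1))); rewrite !mulN1r ltrN2.
- by exists (fun=> tt).
Qed.

Lemma family_connected : mconnected M.
Proof.
apply: (full_connected fM (p0 := point (tt : chart M) 0)); first by case.
by move=> p; exists tt.
Qed.

(** This is [nabla] of the affine structure of the family, written on the
    underlying manifold. *)
Definition coord_nabla (X Y : vfield M) : vfield M := fun p =>
  'd (Y \o point (tt : chart M)) (coord (tt : chart M) p) (X p).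

Lemma coord_nablaE X Y : coord_nabla X Y \o point (tt : chart M) = fun x =>
  'd (Y \o point (tt : chart M)) x ((X \o point (tt : chart M)) x).
Proof. by apply/funext => x /=; rewrite /coord_nabla family_coordK. Qed.

Let sd (Y : vfield M) x : smooth_vf Y ->
  has_diff (Y \o point (tt : chart M)) x ('d (Y \o point (tt : chart M)) x).
Proof. by move=> /family_smooth_vf /smooth_has_diff; exact. Qed.

Lemma coord_nabla_connection : is_connection coord_nabla.
Proof.
split.
- move=> X Y /family_smooth_vf sX /family_smooth_vf sY; apply/family_smooth_vf.
  by rewrite coord_nablaE; apply: smooth_diff_along => //; exact: openT.
- by move=> X X' Y p _ _ _; exact: linearD.
- by move=> f X Y p _ _ _; exact: linearZ.
- move=> X Y Y' p _ sY sY'; have [_ H] := has_diffD (sd (coord (tt : chart M) p) sY)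
    (sd (coord (tt : chart M) p) sY'); exact: H.
- move=> f X Y p /family_smooth_fun sf sX sY.
  have sf' := smooth_has_diff sf (x := coord (tt : chart M) p) I.
  have [_ H] := has_diffZ sf' (sd (coord (tt : chart M) p) sY).
  apply: etrans (H _) _; rewrite addrC.
  by congr (_ *: _ + _ *: _); [exact: (congr1 Y (family_pointK p))|exact: (congr1 f (family_pointK p))].
Qed.

(** The second derivatives of the components of [Z] are symmetric, and the
    remaining first-order terms are the derivative of [Z] along the bracket. *)
Lemma coord_nabla_curvature (X Y Z : vfield M) p :
  smooth_vf X -> smooth_vf Y -> smooth_vf Z ->
  coord_nabla X (coord_nabla Y Z) p - coord_nabla Y (coord_nabla X Z) p
    - coord_nabla (bracket X Y) Z p = 0.
Proof.
move=> sX sY /[dup] /family_smooth_vf cZ sZ.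
set x := coord (tt : chart M) p.
have E0 (W W' : vfield M) : smooth_vf W' -> coord_nabla W (coord_nabla W' Z) p =
    'd (fun y => 'd (Z \o point (tt : chart M)) y (W' p)) x (W p)
    + 'd (Z \o point (tt : chart M)) x ('d (W' \o point (tt : chart M)) x (W p)).
  move=> sW'; rewrite {1}/coord_nabla coord_nablaE -/x.
  have [_ H] := has_diff_along cZ (sd x sW').
  by apply: etrans (H _) _; rewrite [(W' \o _) _](congr1 W' (family_pointK p)).
rewrite !E0 // {E0}.
have -> : coord_nabla (bracket X Y) Z p =
    'd (Z \o point (tt : chart M)) x ('d (Y \o point (tt : chart M)) x (X p))
    - 'd (Z \o point (tt : chart M)) x ('d (X \o point (tt : chart M)) x (Y p)).
  by rewrite /coord_nabla family_bracket -/x; exact: linearB.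
have cancel (a a' b c : 'rV[R]_n) : a = a' -> a + b - (a' + c) - (b - c) = 0.
  by move=> ->; apply/rowP => k; rewrite !mxE; ring.
exact: cancel (diff2_sym_row x (Y p) (X p) cZ).
Qed.

Lemma coord_nabla_flat : is_flat coord_nabla.
Proof.
split=> [X Y sX sY p|X Y Z sX sY sZ p]; last exact: coord_nabla_curvature.
by rewrite family_bracket subrr.
Qed.

End SingleChart.

(** * Exponential families are dually flat *)

Section Dot.
Context {R : realType} {n : nat}.
Implicit Types u v w : 'rV[R]_n.

Definition dot u v : R := \sum_i u 0 i * v 0 i.

Lemma dotC u v : dot u v = dot v u.
Proof. by apply: eq_bigr => i _; rewrite mulrC. Qed.

Lemma dot_is_linear v : linear (fun u => dot u v : R).
Proof.
move=> k a b; rewrite /dot scaler_sumr -big_split /=; apply: eq_bigr => i _.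
by rewrite !mxE mulrDl -mulrA.
Qed.

Lemma dotDl u v w : dot (u + v) w = dot u w + dot v w.
Proof. by have := dot_is_linear w 1 u v; rewrite !scale1r. Qed.

Lemma dotZl c u w : dot (c *: u) w = c * dot u w.
Proof. by rewrite /dot mulr_sumr; apply: eq_bigr => i _; rewrite mxE mulrA. Qed.

Lemma dotBl u v w : dot (u - v) w = dot u w - dot v w.
Proof. by rewrite dotDl -scaleN1r dotZl mulN1r. Qed.

Lemma dot_delta i v : dot (delta_mx 0 i) v = v 0 i.
Proof.
rewrite /dot (bigD1 i) //= big1 => [|j ji]; first by rewrite mxE !eqxx mul1r addr0.
by rewrite mxE (negPf ji) andbF mul0r.
Qed.

Lemma has_diff_dot (V : normedModType R) (f g : V -> 'rV[R]_n) (x : V) df dg :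
  has_diff f x df -> has_diff g x dg ->
  has_diff (fun y => dot (f y) (g y)) x (fun z => dot (df z) (g x) + dot (f x) (dg z)).
Proof.
move=> fD gD.
have H i := has_diffM (has_diff_comp fD (has_diff_coord (f x) i))
  (has_diff_comp gD (has_diff_coord (g x) i)).
apply: has_diff_ext (has_diff_sum (index_enum 'I_n) (P := predT) (fun i _ => H i)) _ => v.
rewrite /dot -big_split /=; apply: eq_bigr => i _.
by rewrite addrC [g x 0 i * _]mulrC.
Qed.

End Dot.

(** The family with cumulant generating function [ln (sum_y exp (theta . a y))]
    over the outcomes; [exp_free] is the affine independence of the statistics
    [a]. *)
Record exp_family (R : realType) (n : nat) (E : family R n)
    (a : outcomes E -> 'rV[R]_n) : Prop := ExpFamily {
  exp_par : forall theta x, @par R n E theta x =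
    expR (dot theta (a x)) / \sum_y expR (dot theta (a y));
  exp_nonempty : inhabited (outcomes E);
  exp_free : forall v c, (forall x, dot v (a x) = c) -> v = 0;
  exp_surj : forall p, @member R n E p -> exists theta, @par R n E theta = p }.

Section ExpFamily.
Context {R : realType} {n : nat} (E : family R n) (a : outcomes E -> 'rV[R]_n).
Hypothesis eE : exp_family a.
Local Notation M := (family_affine E).
Local Notation p := (@par R n E).

Lemma partition_gt0 (theta : 'rV[R]_n) : 0 < \sum_y expR (dot theta (a y)).
Proof.
have [x0] := exp_nonempty eE; rewrite (bigD1 x0) //=.
by apply: ltr_pwDl; [exact: expR_gt0|apply: sumr_ge0 => i _; exact: expR_ge0].
Qed.

Lemma par_gt0 theta x : 0 < p theta x.
Proof. by rewrite (exp_par eE) divr_gt0 ?expR_gt0 // partition_gt0. Qed.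

Lemma par_sum theta : \sum_x p theta x = 1.
Proof.
under eq_bigr do rewrite (exp_par eE); rewrite -mulr_suml divff //.
by rewrite gt_eqF // partition_gt0.
Qed.

(** Equality of two distributions makes [(t - t') . a x] independent of [x]. *)
Lemma exp_par_inj : injective p.
Proof.
move=> t t' E0; apply/eqP; rewrite -subr_eq0; apply/eqP.
apply: (exp_free eE (c := ln (\sum_y expR (dot t (a y))) - ln (\sum_y expR (dot t' (a y))))) => x.
have := congr1 (fun f => ln (f x)) E0; rewrite /= !(exp_par eE) !ln_div ?posrE ?expR_gt0 ?partition_gt0 //.
rewrite !expRK dotBl => /eqP; rewrite subr_eq addrAC eq_sym subr_eq => /eqP H.
lra.
Qed.

(** The differential of the cumulant generating function, at [theta] along
    [v]. *)
Definition mean (theta v : 'rV[R]_n) : R := \sum_x p theta x * dot v (a x).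

(** The Hessian of the cumulant generating function; see [has_diff_mean]. *)
Definition cov (theta v w : 'rV[R]_n) : R :=
  \sum_x p theta x * ((dot v (a x) - mean theta v) * (dot w (a x) - mean theta w)).

Lemma mean_is_linear theta : linear (fun v => mean theta v : R).
Proof.
move=> k v w; rewrite /mean scaler_sumr -big_split /=; apply: eq_bigr => x _.
by rewrite dotDl dotZl mulrDr mulrCA.
Qed.

(** The logarithmic derivative of the density is the centred statistic. *)
Lemma has_diff_par x theta :
  has_diff (fun eta => p eta x) theta
    (fun v => p theta x * (dot v (a x) - mean theta v)).
Proof.
have D y : has_diff (fun eta : 'rV[R]_n => expR (dot eta (a y))) theta
    (fun v => expR (dot theta (a y)) * dot v (a y)).
  apply: has_diff_real; apply: has_diff_linear; exact: dot_is_linear.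
have Z0 := partition_gt0 theta; have Zn0 := lt0r_neq0 Z0.
have DZ := has_diffV (has_diff_sum (index_enum (outcomes E)) (P := predT) (fun y _ => D y)) Zn0.
have := has_diffM (D x) DZ.
rewrite (_ : (fun y => _ * _) = fun eta => p eta x); last first.
  by apply/funext => eta; rewrite (exp_par eE).
move=> /has_diff_ext; apply => v; rewrite /mean.
under [in RHS]eq_bigr do rewrite (exp_par eE) mulrAC.
rewrite (exp_par eE) -mulr_suml; move: (\sum_(i <- _ | _) _ * _) => S.
move: Zn0; move: (\sum_y _) => Z Zn0; field; exact: Zn0.
Qed.

(** The derivative of the expectation of [v . a] is its expectation against the
    centred [w . a]; since the latter has expectation 0, centring [v . a] as
    well changes nothing. *)
Lemma has_diff_mean v theta :
  has_diff (fun eta => mean eta v) theta (fun w => cov theta v w).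
Proof.
have D x := has_diffM (has_diff_par x theta) (has_diff_cst (dot v (a x)) theta).
have := has_diff_sum (index_enum (outcomes E)) (P := predT) (fun x _ => D x).
move=> /has_diff_ext; apply => w /=; rewrite /cov.
pose c x := dot w (a x) - mean theta w.
have c0 : \sum_x p theta x * c x = 0.
  under eq_bigr do rewrite /c mulrBr.
  by rewrite sumrB -mulr_suml par_sum mul1r subrr.
have : \sum_x (mean theta v * (p theta x * c x)) = 0 by rewrite -mulr_sumr c0 mulr0.
move=> H; rewrite -[LHS]subr0 -[X in _ - X]H -sumrB; apply: eq_bigr => x _.
by rewrite /c mulr0 add0r; ring.
Qed.

Lemma cov_sym theta v w : cov theta v w = cov theta w v.
Proof. by apply: eq_bigr => x _; rewrite [X in _ * X]mulrC. Qed.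

Lemma cov_is_linear theta v : linear (fun w => cov theta v w : R).
Proof.
move=> k w w'; rewrite /cov.
have -> : mean theta (k *: w + w') = k * mean theta w + mean theta w'.
  exact: mean_is_linear.
rewrite [X in _ = X + _]mulr_sumr -big_split; apply: eq_bigr => x _.
by rewrite dotDl dotZl /=; ring.
Qed.

(** A statistic of variance 0 is constant, which affine independence
    excludes. *)
Lemma cov_gt0 theta v : v != 0 -> 0 < cov theta v v.
Proof.
move=> v0; have T x : 0 <= p theta x * ((dot v (a x) - mean theta v) * (dot v (a x) - mean theta v)).
  by apply: mulr_ge0; [exact/ltW/par_gt0|rewrite -expr2; exact: sqr_ge0].
rewrite lt_neqAle sumr_ge0 ?andbT; last by move=> x _; exact: T.
apply: contraNneq v0 => /esym/eqP; rewrite psumr_eq0; last by move=> x _; exact: T.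
move=> /allP H; apply/eqP; apply: (exp_free eE (c := mean theta v)) => x.
have := H x (mem_index_enum x); rewrite /= mulf_eq0 gt_eqF ?par_gt0 //= mulf_eq0 orbb subr_eq0.
by move/eqP.
Qed.

Lemma scoreE (x : outcomes E) i theta :
  score x i theta = a x 0 i - mean theta (delta_mx 0 i).
Proof.
have [_ H] := has_diff_real (has_diff_par x theta) (is_derive1_ln (par_gt0 theta x)).
rewrite /score; apply: etrans (H _) _.
by rewrite mulKf ?gt_eqF ?par_gt0 // dot_delta.
Qed.

Lemma fisherE theta i j : fisher E theta i j = cov theta (delta_mx 0 i) (delta_mx 0 j).
Proof. by apply: eq_bigr => x _; rewrite !scoreE !dot_delta. Qed.

Lemma cov_expandr theta v w : cov theta v w = \sum_j w 0 j * cov theta v (delta_mx 0 j).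
Proof.
pose l := HB.pack (fun w => cov theta v w)
  (GRing.isLinear.Build _ _ _ _ _ (cov_is_linear theta v)) : {linear 'rV[R]_n -> R}.
rewrite {1}[w]row_expand -[LHS]/(l _) linear_sum; apply: eq_bigr => j _.
by rewrite linearZ.
Qed.

Lemma family_metE (q : M) v w : met q v w = cov (coord (tt : chart M) q) v w.
Proof.
rewrite /= cov_sym cov_expandr; apply: eq_bigr => i _.
rewrite cov_sym cov_expandr mulr_sumr; apply: eq_bigr => j _.
by rewrite fisherE mulrA.
Qed.

Lemma smooth_par x : smooth setT (fun eta => p eta x).
Proof.
have S y : smooth setT (fun eta : 'rV[R]_n => expR (dot eta (a y))).
  by apply: smooth_expR; [exact: openT|apply: smooth_linear; exact: dot_is_linear].
apply: (@smooth_eq _ _ _ _ (fun eta => expR (dot eta (a x)) / \sum_y expR (dot eta (a y)))).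
- exact: openT.
- by move=> eta _; rewrite (exp_par eE).
- apply: smoothM; [exact: openT|exact: S|].
  apply: smoothV; [exact: openT| |by move=> eta _; rewrite gt_eqF ?partition_gt0].
  by apply: smooth_sum => //; exact: openT.
Qed.

Lemma smooth_mean v : smooth setT (fun eta => mean eta v).
Proof.
apply: smooth_sum => [|x _]; first exact: openT.
by apply: smoothM; [exact: openT|exact: smooth_par|exact: smooth_cst].
Qed.

Lemma smooth_cov v w : smooth setT (fun eta => cov eta v w).
Proof.
apply: smooth_sum => [|x _]; first exact: openT.
apply: smoothM; [exact: openT|exact: smooth_par|].
by apply: smoothM; first exact: openT; apply: smoothB; try exact: openT;
  try exact: smooth_cst; exact: smooth_mean.
Qed.

(** These are third derivatives of the cumulant generating function. *)
Lemma diff_cov_sym theta u v w :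
  'd (fun eta => cov eta v w) theta u = 'd (fun eta => cov eta v u) theta w.
Proof.
have H z : (fun eta => cov eta v z) = fun eta => 'd (fun eta => mean eta v) eta z.
  by apply/funext => eta; have [_ ->] := has_diff_mean v eta.
rewrite !H; apply: diff2_sym (smooth_mean v) _ => //; exact: openT.
Qed.

Let fM := family_full exp_par_inj (exp_surj eE).

Lemma exp_riemannian : is_riemannian M.
Proof.
split.
- exact: family_manifold exp_par_inj (exp_surj eE).
- by move=> q v w; rewrite !family_metE cov_sym.
- by move=> q v c w w'; rewrite !family_metE; exact: cov_is_linear.
- by move=> q v v0; rewrite family_metE; exact: cov_gt0.
- move=> [] v w; rewrite (cod_full fM).
  apply: smooth_eq (smooth_cov v w); first exact: openT.
  move=> x _; rewrite family_metE; have E1 := coordK fM tt x.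
  by rewrite E1 !(family_vec exp_par_inj (exp_surj eE)).
Qed.

(** The Fisher matrix exchanges vector fields with 1-forms. *)
Let G (theta : 'rV[R]_n) : 'M[R]_n :=
  \matrix_(i, j) cov theta (delta_mx 0 i) (delta_mx 0 j).
Let Pt (x : 'rV[R]_n) : M := point (tt : chart M) x.
Let Co (q : M) : 'rV[R]_n := coord (tt : chart M) q.
Let flat (Z : vfield M) : vfield M := fun q => Z q *m G (Co q).
Let sharp (Z : vfield M) : vfield M := fun q => Z q *m invmx (G (Co q)).

Let CoK x : Co (Pt x) = x. Proof. exact: (coordK fM). Qed.
Let PtK q : Pt (Co q) = q. Proof. exact: (pointK fM). Qed.

Let G_coord theta v j : (v *m G theta) 0 j = cov theta v (delta_mx 0 j).
Proof.
rewrite cov_sym cov_expandr mxE; apply: eq_bigr => i _.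
by rewrite mxE cov_sym.
Qed.

Let G_dot theta v w : dot v (w *m G theta) = cov theta v w.
Proof.
rewrite cov_sym cov_expandr; apply: eq_bigr => i _.
by rewrite G_coord.
Qed.

Let G_unit theta : G theta \in unitmx.
Proof.
rewrite -row_free_unit; apply: inj_row_free => v vG.
apply/eqP; apply: contraTT isT => v0; have := cov_gt0 theta v0.
rewrite -G_dot vG /dot big1 ?ltxx // => i _; by rewrite mxE mulr0.
Qed.

Let flatK Z q : sharp (flat Z) q = Z q.
Proof. by rewrite /sharp /flat mulmxK. Qed.

Let sharpK Z q : flat (sharp Z) q = Z q.
Proof. by rewrite /sharp /flat mulmxKV. Qed.

Let smooth_vfP (X : vfield M) : smooth_vf X <-> smooth setT (X \o Pt).
Proof. exact: (family_smooth_vf exp_par_inj (exp_surj eE)). Qed.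

Let smooth_mx (X : vfield M) (A : 'rV[R]_n -> 'M[R]_n) :
  (forall i j, smooth setT (fun x => A x i j)) -> smooth_vf X ->
  smooth_vf (fun q => X q *m A (Co q)).
Proof.
move=> AC /smooth_vfP XC; apply/smooth_vfP; apply: smooth_row => [|j]; first exact: openT.
rewrite (_ : (fun x => _) = fun x => \sum_i (X \o Pt) x 0 i * A x i j); last first.
  by apply/funext => x; rewrite /= CoK mxE.
apply: smooth_sum => [|i _]; first exact: openT.
by apply: smoothM; [exact: openT|apply: smooth_coord => //; exact: openT|].
Qed.

Let G_smooth i j : smooth setT (fun x => G x i j).
Proof.
rewrite (_ : (fun x => _) = fun x => cov x (delta_mx 0 i) (delta_mx 0 j)); last first.
  by apply/funext => x; rewrite mxE.
exact: smooth_cov.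
Qed.

Let flat_smooth X : smooth_vf X -> smooth_vf (flat X).
Proof. exact: (@smooth_mx X G). Qed.

Let sharp_smooth X : smooth_vf X -> smooth_vf (sharp X).
Proof.
apply: (@smooth_mx X (fun x => invmx (G x))) => i j.
by apply: smooth_invmx => //; exact: openT.
Qed.

(** The metric is [dot Y (flat Z)], so that differentiating it along [X] by the
    product rule puts [nabla] on [Y] and on [flat Z]; hence the dual connection
    is [nabla] conjugated by [flat]. *)
Definition dual_nabla (X Y : vfield M) : vfield M :=
  sharp (nabla X (flat Y)).

Let cN : is_connection (@nabla R n M).
Proof. exact: (coord_nabla_connection exp_par_inj (exp_surj eE)). Qed.

Lemma dual_nabla_connection : is_connection dual_nabla.
Proof.
case: cN => C1 C2 C3 C4 C5; split.
- by move=> X Y sX sY; apply/sharp_smooth/C1 => //; exact: flat_smooth.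
- move=> X X' Y p0 sX sX' sY; rewrite /dual_nabla /sharp C2 ?mulmxDl //; exact: flat_smooth.
- move=> f X Y p0 sf sX sY; rewrite /dual_nabla /sharp C3 ?scalemxAl //; exact: flat_smooth.
- move=> X Y Y' p0 sX sY sY'; rewrite /dual_nabla /sharp.
  rewrite (_ : flat _ = fun q => flat Y q + flat Y' q); last first.
    by apply/funext => q; rewrite /flat mulmxDl.
  by rewrite C4 ?mulmxDl //; exact: flat_smooth.
- move=> f X Y p0 sf sX sY; rewrite /dual_nabla /sharp.
  rewrite (_ : flat _ = fun q => f q *: flat Y q); last first.
    by apply/funext => q; rewrite /flat scalemxAl.
  rewrite C5 //; last exact: flat_smooth.
  by rewrite mulmxDl -!scalemxAl; congr (_ *: _ + _); exact: flatK.
Qed.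

Let sd (Y : vfield M) x : smooth_vf Y -> has_diff (Y \o Pt) x ('d (Y \o Pt) x).
Proof. by move=> /smooth_vfP /smooth_has_diff; exact. Qed.

Lemma exp_dual : dual_connections (@nabla R n M) dual_nabla.
Proof.
move=> X Y Z sX sY sZ q.
have E1 : (fun q => met q (Y q) (Z q)) \o Pt = fun x => dot ((Y \o Pt) x) ((flat Z \o Pt) x).
  by apply/funext => x; apply: etrans (family_metE _ _ _) _; rewrite -G_dot.
suff : 'd ((fun q => met q (Y q) (Z q)) \o Pt) (Co q) (X q)
    = met q (nabla X Y q) (Z q) + met q (Y q) (dual_nabla X Z q) by [].
rewrite E1.
have [_ H] := has_diff_dot (sd (Co q) sY) (sd (Co q) (flat_smooth sZ)).
apply: etrans (H _) _; rewrite !family_metE -!G_dot; congr (_ + _).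
  by congr dot; rewrite /= PtK.
congr dot; first by rewrite /= PtK.
by rewrite -[RHS]/(flat (sharp _) q) sharpK.
Qed.

Let flat_diff (Y : vfield M) x u j : smooth_vf Y ->
  'd (flat Y \o Pt) x u 0 j
    = cov x ('d (Y \o Pt) x u) (delta_mx 0 j)
      + \sum_i Y (Pt x) 0 i * 'd (fun eta => cov eta (delta_mx 0 j) (delta_mx 0 i)) x u.
Proof.
move=> sY; rewrite diff_coord; last by have [] := sd x (flat_smooth sY).
have Yi i := has_diff_comp (sd x sY) (has_diff_coord (Y (Pt x)) i).
have Gi i := smooth_has_diff (smooth_cov (delta_mx 0 j) (delta_mx 0 i)) (x := x) I.
have := has_diff_sum (index_enum 'I_n) (P := predT) (fun i _ => has_diffM (Yi i) (Gi i)).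
rewrite (_ : (fun y => \sum_i _) = fun y => (flat Y \o Pt) y 0 j); last first.
  by apply/funext => y; rewrite /= /flat CoK G_coord cov_sym cov_expandr.
move=> [_ /(_ u) H]; apply: etrans H _; rewrite big_split /= addrC; congr (_ + _).
by rewrite cov_sym cov_expandr; apply: eq_bigr => i _; rewrite mulrC.
Qed.

(** Conjugation carries the vanishing of curvature over from [nabla]. In the
    torsion, the derivatives of the Fisher matrix contracted with [X] and [Y]
    are symmetric by [diff_cov_sym], and what is left is the torsion of
    [nabla]. *)
Lemma dual_nabla_flat : is_flat dual_nabla.
Proof.
split=> [X Y sX sY q|X Y Z sX sY sZ q]; last first.
  rewrite /dual_nabla.
  have S W : flat (sharp W) = W by apply/funext => r; exact: sharpK.
  rewrite !S /sharp -!mulmxBl.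
  have [_ C] := coord_nabla_flat exp_par_inj (exp_surj eE).
  by rewrite [X in X *m _](C X Y (flat Z) sX sY (flat_smooth sZ) q) mul0mx.
suff : flat (fun q => dual_nabla X Y q - dual_nabla Y X q - bracket X Y q) q = 0.
  move=> H; rewrite -[LHS](mulmxK (G_unit (Co q))).
  by move: H; rewrite /flat => ->; rewrite mul0mx.
pose aX := 'd (Y \o Pt) (Co q) (X q); pose bY := 'd (X \o Pt) (Co q) (Y q).
have BR : bracket X Y q = aX - bY := family_bracket exp_par_inj (exp_surj eE) X Y q.
have -> : flat (fun q => dual_nabla X Y q - dual_nabla Y X q - bracket X Y q) q
    = flat (dual_nabla X Y) q - flat (dual_nabla Y X) q - (aX - bY) *m G (Co q).
  by rewrite /flat -BR !mulmxBl.
rewrite /dual_nabla !sharpK mulmxBl; apply/rowP => j.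
have rB (u v : 'rV[R]_n) : (u - v) 0 j = u 0 j - v 0 j by rewrite !mxE.
rewrite !rB !G_coord {BR}.
have E1 W W' : smooth_vf W' -> nabla W (flat W') q 0 j = cov (Co q) ('d (W' \o Pt) (Co q) (W q)) (delta_mx 0 j)
      + \sum_i W' q 0 i * 'd (fun eta => cov eta (delta_mx 0 j) (delta_mx 0 i)) (Co q) (W q).
  by move=> sW'; apply: etrans (flat_diff (Co q) (W q) j sW') _; rewrite PtK.
rewrite (E1 X Y sY) (E1 Y X sX).
have C : \sum_i Y q 0 i * 'd (fun eta => cov eta (delta_mx 0 j) (delta_mx 0 i)) (Co q) (X q)
  = \sum_i X q 0 i * 'd (fun eta => cov eta (delta_mx 0 j) (delta_mx 0 i)) (Co q) (Y q).
  under eq_bigr do rewrite diff_expand mulr_sumr.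
  under [in RHS]eq_bigr do rewrite diff_expand mulr_sumr.
  rewrite exchange_big; apply: eq_bigr => i _; apply: eq_bigr => k _.
  by rewrite /GRing.scale /= mulrCA (diff_cov_sym (Co q)).
have cancel (u v s s' : R) : s = s' -> u + s - (v + s') - (u - v) = 0 by move=> ->; ring.
rewrite [RHS]mxE; exact: cancel C.
Qed.

Lemma exp_dually_flat : is_dually_flat M.
Proof.
split; [exact: exp_riemannian|exact: cN|exact: (coord_nabla_flat exp_par_inj (exp_surj eE))|].
exists dual_nabla; split; [exact: dual_nabla_connection|exact: exp_dual|exact: dual_nabla_flat].
Qed.

End ExpFamily.

(** * Positive distributions on a finite set, and product families *)

Section Instances.
Context {R : realType}.

Section SimplexFamily.
Context {n : nat}.

(** The statistic of the last outcome is 0, so that [dot theta (stat k)] is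
    [theta_k] with the convention [theta_n = 0]. *)
Definition stat (k : 'I_n.+1) : 'rV[R]_n :=
  if unlift ord_max k is Some i then delta_mx 0 i else 0.

Lemma dot_stat v k : dot v (stat k) = if unlift ord_max k is Some i then v 0 i else 0.
Proof.
rewrite dotC /stat; case: unlift => [i|]; first exact: dot_delta.
by rewrite /dot big1 // => i _; rewrite mxE mul0r.
Qed.

Variable T : ordered_set n.

Definition simplex_stat (x : T) : 'rV[R]_n := stat (rank x).

Lemma simplex_sum (f : T -> R) :
  \sum_x f x = f (elt T ord_max) + \sum_(i < n) f (elt T (lift ord_max i)).
Proof.
rewrite (reindex (elt T)) /=; last first.
  by exists (@rank n T) => [k _|x _]; [exact: eltK|exact: rankK].
rewrite big_ord_recr addrC /=; congr (_ + _).
by apply: eq_bigr => i _; congr (f (elt T _)); apply/val_inj; rewrite /= /bump leqNgt ltn_ord.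
Qed.

Lemma simplex_partition theta :
  \sum_x expR (dot theta (simplex_stat x)) = 1 + \sum_(i < n) expR (theta 0 i).
Proof.
rewrite simplex_sum /simplex_stat dot_stat eltK unlift_none expR0; congr (_ + _).
by apply: eq_bigr => i _; rewrite /simplex_stat dot_stat eltK liftK.
Qed.

Lemma simplex_parE theta x : @par R n (simplex T) theta x =
  expR (dot theta (simplex_stat x)) / \sum_y expR (dot theta (simplex_stat y)).
Proof.
rewrite simplex_partition /= /simplex_par /simplex_stat dot_stat.
have pos : 0 < 1 + \sum_(i < n) expR (theta 0 i).
  by rewrite ltr_pwDl // sumr_ge0 // => i _; exact: expR_ge0.
rewrite -[X in _ = _ / X]lnK ?posrE // -expRN -expRD -/(psi theta).
by case: unlift => // ; rewrite add0r.
Qed.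

(** Natural parameters are the logarithms of the ratios to the last
    probability. *)
Lemma simplex_exp_family : @exp_family R n (simplex T) simplex_stat.
Proof.
split.
- exact: simplex_parE.
- exact: (inhabits (elt T ord_max)).
- move=> v c H.
  have c0 : c = 0 by rewrite -(H (elt T ord_max)) /simplex_stat dot_stat eltK unlift_none.
  apply/rowP => i; rewrite mxE -c0 -(H (elt T (lift ord_max i))).
  by rewrite /simplex_stat dot_stat eltK liftK.
- move=> p [p0 p1]; pose pn := p (elt T ord_max); have pn0 : 0 < pn by exact: p0.
  pose theta : 'rV[R]_n := \row_i ln (p (elt T (lift ord_max i)) / pn).
  exists theta; apply/funext => x.
  have E0 y : expR (dot theta (simplex_stat y)) = p y / pn.
    rewrite /simplex_stat dot_stat; have := rankK y; case: unliftP => [i ->|->] <-.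
      by rewrite mxE lnK // posrE divr_gt0.
    by rewrite expR0 divff // gt_eqF.
  rewrite simplex_parE; under eq_bigr do rewrite E0.
  by rewrite E0 -mulr_suml p1 mul1r invrK divfK // gt_eqF.
Qed.

End SimplexFamily.

Section Product.
Context {n m : nat} (E : family R n) (E' : family R m)
  (a : outcomes E -> 'rV[R]_n) (a' : outcomes E' -> 'rV[R]_m).
Hypotheses (eE : exp_family a) (eE' : exp_family a').

Definition product_stat (xy : outcomes E * outcomes E') : 'rV[R]_(n + m) :=
  row_mx (a xy.1) (a' xy.2).

Lemma dot_row_mx (v : 'rV[R]_(n + m)) (b : 'rV[R]_n) (c : 'rV[R]_m) :
  dot v (row_mx b c) = dot (lsubmx v) b + dot (rsubmx v) c.
Proof.
rewrite /dot big_split_ord /=; congr (_ + _); apply: eq_bigr => i _.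
  by rewrite row_mxEl mxE.
by rewrite row_mxEr mxE.
Qed.

Lemma product_partition theta :
  \sum_xy expR (dot theta (product_stat xy))
    = (\sum_x expR (dot (lsubmx theta) (a x))) * (\sum_y expR (dot (rsubmx theta) (a' y))).
Proof.
rewrite big_distrlr /= pair_big /=; apply: eq_bigr => -[x y] _ /=.
by rewrite /product_stat dot_row_mx expRD.
Qed.

Lemma product_exp_family : @exp_family R (n + m) (product_family E E') product_stat.
Proof.
have [x0] := exp_nonempty eE; have [y0] := exp_nonempty eE'.
split.
- move=> theta [x y]; rewrite product_partition /= /product_par /=.
  rewrite (exp_par eE) (exp_par eE') /product_stat dot_row_mx expRD /=.
  by rewrite invfM mulrACA.
- exact: (inhabits (x0, y0)).
- move=> v c H.
  have H' x y : dot (lsubmx v) (a x) + dot (rsubmx v) (a' y) = c.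
    by rewrite -dot_row_mx; exact: (H (x, y)).
  have l0 : lsubmx v = 0.
    by apply: (exp_free eE (c := c - dot (rsubmx v) (a' y0))) => x; rewrite -(H' x y0) addrK.
  have r0 : rsubmx v = 0.
    by apply: (exp_free eE' (c := c - dot (lsubmx v) (a x0))) => y; rewrite -(H' x0 y) addrC addKr.
  by rewrite -[v]hsubmxK l0 r0 row_mx0.
- move=> p [p1 [p2 [m1 m2 pE]]].
  have [t1 E1] := exp_surj eE m1; have [t2 E2] := exp_surj eE' m2.
  exists (row_mx t1 t2); apply/funext => -[x y].
  by rewrite pE /= /product_par /= row_mxKl row_mxKr E1 E2.
Qed.

(** Each factor has total mass 1, so the statistics of the other one keep their
    expectation. *)
Lemma mean_product theta v :
  mean (E := product_family E E') product_stat theta v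
    = mean a (lsubmx theta) (lsubmx v) + mean a' (rsubmx theta) (rsubmx v).
Proof.
pose F x y := @product_par R n m E E' theta (x, y) * dot v (product_stat (x, y)).
have -> : mean (E := product_family E E') product_stat theta v = \sum_xy F xy.1 xy.2.
  by apply: eq_bigr => -[x y].
rewrite -(pair_bigA _ F) /F /=.
have H x : \sum_y @product_par R n m E E' theta (x, y) * dot v (product_stat (x, y))
  = @par R n E (lsubmx theta) x * dot (lsubmx v) (a x)
    + @par R n E (lsubmx theta) x * mean a' (rsubmx theta) (rsubmx v).
  rewrite /product_stat; under eq_bigr do rewrite dot_row_mx /product_par /=.
  rewrite -[X in _ = X + _]mulr1 -(par_sum eE' (rsubmx theta)) /mean.
  move: (dot (lsubmx v) (a x)) => d; rewrite !mulr_sumr -big_split /=.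
  by apply: eq_bigr => y _; ring.
under eq_bigr do rewrite H.
by rewrite big_split /= -mulr_suml (par_sum eE) mul1r.
Qed.

(** The derivative of [mean_product], by [has_diff_mean]. *)
Lemma cov_product theta v w :
  cov (E := product_family E E') product_stat theta v w
    = cov a (lsubmx theta) (lsubmx v) (lsubmx w) + cov a' (rsubmx theta) (rsubmx v) (rsubmx w).
Proof.
have [_ H] := has_diff_mean product_exp_family v theta.
have [_ H'] := has_diffD
  (has_diff_lsubmx (has_diff_mean eE (lsubmx v) (lsubmx theta)))
  (has_diff_rsubmx (has_diff_mean eE' (rsubmx v) (rsubmx theta))).
apply: etrans (esym (H w)) _; apply: etrans _ (H' w).
by congr ('d _ theta w); apply/funext => eta; exact: mean_product.
Qed.

End Product.
End Instances.

(** * Calculus of complex-valued functions *)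

Section ComplexNumbers.
Context {R : realType}.
Local Notation C := (R[i]).
Local Notation Re := complex.Re.
Local Notation Im := complex.Im.

Lemma complex_ext (z w : C) : Re z = Re w -> Im z = Im w -> z = w.
Proof. by case: z w => [a b] [c d] /= -> ->. Qed.

Lemma cReD (z w : C) : Re (z + w) = Re z + Re w.
Proof. by case: z w => [a b] [c d]. Qed.
Lemma cImD (z w : C) : Im (z + w) = Im z + Im w.
Proof. by case: z w => [a b] [c d]. Qed.
Lemma cReN (z : C) : Re (- z) = - Re z.
Proof. by case: z. Qed.
Lemma cImN (z : C) : Im (- z) = - Im z.
Proof. by case: z. Qed.
Lemma cReM (z w : C) : Re (z * w) = Re z * Re w - Im z * Im w.
Proof. by case: z w => [a b] [c d]. Qed.
Lemma cImM (z w : C) : Im (z * w) = Re z * Im w + Im z * Re w.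
Proof. by case: z w => [a b] [c d]. Qed.
Lemma cReJ (z : C) : Re (z^*)%C = Re z.
Proof. by case: z. Qed.
Lemma cImJ (z : C) : Im (z^*)%C = - Im z.
Proof. by case: z. Qed.
Lemma cReV (z : C) : Re z^-1 = Re z / (Re z ^+ 2 + Im z ^+ 2).
Proof. by case: z. Qed.
Lemma cImV (z : C) : Im z^-1 = - Im z / (Re z ^+ 2 + Im z ^+ 2).
Proof. by case: z => a b /=; rewrite mulNr. Qed.

Lemma norm2_neq0 (z : C) : z != 0 -> Re z ^+ 2 + Im z ^+ 2 != 0.
Proof.
case: z => a b /= z0; rewrite paddr_eq0 ?sqr_ge0 // !sqrf_eq0.
by apply: contra z0 => /andP[/eqP -> /eqP ->].
Qed.

Definition ReIm := (cReD, cImD, cReN, cImN, cReM, cImM, cReJ, cImJ).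

Lemma cRe_sum (I : Type) (r : seq I) (P : pred I) (F : I -> C) :
  Re (\sum_(i <- r | P i) F i) = \sum_(i <- r | P i) Re (F i).
Proof. by elim/big_rec2: _ => // i x y _ <-; rewrite cReD. Qed.

Lemma cIm_sum (I : Type) (r : seq I) (P : pred I) (F : I -> C) :
  Im (\sum_(i <- r | P i) F i) = \sum_(i <- r | P i) Im (F i).
Proof. by elim/big_rec2: _ => // i x y _ <-; rewrite cImD. Qed.

End ComplexNumbers.

Section ComplexCalculus.
Context {R : realType}.
Local Notation C := (R[i]).
Local Notation Re := complex.Re.
Local Notation Im := complex.Im.

(** Complex-valued functions are differentiated over the reals, part by part,
    because all charts are real. *)
Definition has_cdiff (V : normedModType R) (Z : V -> C) (x : V) (A : V -> C) : Prop :=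
  has_diff (fun y => Re (Z y)) x (fun v => Re (A v)) /\
  has_diff (fun y => Im (Z y)) x (fun v => Im (A v)).

Section Rules.
Context {V : normedModType R}.
Implicit Types (Z W A B : V -> C) (x : V).

Lemma has_cdiff_ext Z x A B : has_cdiff Z x A -> (forall v, A v = B v) -> has_cdiff Z x B.
Proof. by move=> [H K] E; split; [apply: has_diff_ext H _|apply: has_diff_ext K _] => v; rewrite E. Qed.

Lemma has_cdiff_cst (c : C) x : has_cdiff (fun _ => c) x (fun=> 0).
Proof. by split; exact: has_diff_cst. Qed.

Lemma has_cdiffD Z W x A B : has_cdiff Z x A -> has_cdiff W x B ->
  has_cdiff (fun y => Z y + W y) x (fun v => A v + B v).
Proof.
move=> [H K] [H' K']; split.
  have := has_diffD H H'; under eq_fun do rewrite -cReD.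
  by move=> /has_diff_ext; apply => v; rewrite cReD.
have := has_diffD K K'; under eq_fun do rewrite -cImD.
by move=> /has_diff_ext; apply => v; rewrite cImD.
Qed.

Lemma has_cdiff_sum (I : Type) (r : seq I) (P : pred I) (Z A : I -> V -> C) x :
  (forall i, P i -> has_cdiff (Z i) x (A i)) ->
  has_cdiff (fun y => \sum_(i <- r | P i) Z i y) x (fun v => \sum_(i <- r | P i) A i v).
Proof.
move=> H; split.
  have := has_diff_sum r (P := P) (fun i Pi => (H i Pi).1).
  under eq_fun do rewrite -cRe_sum.
  by move=> /has_diff_ext; apply => v; rewrite cRe_sum.
have := has_diff_sum r (P := P) (fun i Pi => (H i Pi).2).
under eq_fun do rewrite -cIm_sum.
by move=> /has_diff_ext; apply => v; rewrite cIm_sum.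
Qed.

Lemma has_cdiffM Z W x A B : has_cdiff Z x A -> has_cdiff W x B ->
  has_cdiff (fun y => Z y * W y) x (fun v => Z x * B v + A v * W x).
Proof.
move=> [H K] [H' K']; split.
  have := has_diffB (has_diffM H H') (has_diffM K K'); under eq_fun do rewrite -cReM.
  by move=> /has_diff_ext; apply => v; rewrite !ReIm; ring.
have := has_diffD (has_diffM H K') (has_diffM K H'); under eq_fun do rewrite -cImM.
by move=> /has_diff_ext; apply => v; rewrite !ReIm; ring.
Qed.

Lemma has_cdiffJ Z x A : has_cdiff Z x A ->
  has_cdiff (fun y => (Z y)^*%C) x (fun v => (A v)^*%C).
Proof.
move=> [H K]; split.
  by under eq_fun do rewrite cReJ; apply: has_diff_ext H _ => v; rewrite cReJ.
under eq_fun do rewrite cImJ.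
by apply: has_diff_ext (has_diffN K) _ => v; rewrite cImJ.
Qed.

Lemma has_cdiffV Z x A : has_cdiff Z x A -> Z x != 0 ->
  has_cdiff (fun y => (Z y)^-1) x (fun v => - (A v / Z x ^+ 2)).
Proof.
move=> [H K] z0; have n0 := norm2_neq0 z0.
have HK := has_diffD (has_diffM H H) (has_diffM K K).
have n0' : Re (Z x) * Re (Z x) + Im (Z x) * Im (Z x) != 0 by rewrite -!expr2.
have := has_diffV HK n0' => D.
split.
  have := has_diffM H D; under eq_fun do rewrite -!expr2 -cReV.
  move=> /has_diff_ext; apply => v; rewrite !ReIm cReV cImV expr2 !ReIm.
  move: n0 n0' => {H K HK D}; case: (Z x) (A v) z0 => [a b] [c d] /= z0 n0 n0'.
  field; have -> : (a * a - b * b) ^+ 2 + (a * b + b * a) ^+ 2 = (a * a + b * b) ^+ 2 by ring.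
  by rewrite sqrf_eq0 !n0'.
have := has_diffM (has_diffN K) D; under eq_fun do rewrite -!expr2 -cImV.
move=> /has_diff_ext; apply => v; rewrite !ReIm cReV cImV expr2 !ReIm.
move: n0 n0' => {H K HK D}; case: (Z x) (A v) z0 => [a b] [c d] /= z0 n0 n0'.
field; have -> : (a * a - b * b) ^+ 2 + (a * b + b * a) ^+ 2 = (a * a + b * b) ^+ 2 by ring.
  by rewrite sqrf_eq0 !n0'.
Qed.

End Rules.

Definition csmooth {n} (U : set 'rV[R]_n) (Z : 'rV[R]_n -> C) : Prop :=
  smooth U (fun x => Re (Z x)) /\ smooth U (fun x => Im (Z x)).

Section Smooth.
Context {n : nat}.
Implicit Types (U : set 'rV[R]_n) (Z W : 'rV[R]_n -> C).

Lemma csmooth_cst U (c : C) : csmooth U (fun=> c).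
Proof. by split; exact: smooth_cst. Qed.

Lemma csmoothD U Z W : open U -> csmooth U Z -> csmooth U W ->
  csmooth U (fun x => Z x + W x).
Proof.
move=> oU [H K] [H' K']; split.
  by under eq_fun do rewrite cReD; exact: smoothD.
by under eq_fun do rewrite cImD; exact: smoothD.
Qed.

Lemma csmoothN U Z : open U -> csmooth U Z -> csmooth U (fun x => - Z x).
Proof.
move=> oU [H K]; split.
  by under eq_fun do rewrite cReN; exact: smoothN.
by under eq_fun do rewrite cImN; exact: smoothN.
Qed.

Lemma csmoothB U Z W : open U -> csmooth U Z -> csmooth U W ->
  csmooth U (fun x => Z x - W x).
Proof. by move=> oU H K; apply: csmoothD => //; exact: csmoothN. Qed.

Lemma csmoothM U Z W : open U -> csmooth U Z -> csmooth U W ->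
  csmooth U (fun x => Z x * W x).
Proof.
move=> oU [H K] [H' K']; split.
  by under eq_fun do rewrite cReM; apply: smoothB => //; exact: smoothM.
by under eq_fun do rewrite cImM; apply: smoothD => //; exact: smoothM.
Qed.

Lemma csmoothJ U Z : open U -> csmooth U Z -> csmooth U (fun x => (Z x)^*%C).
Proof.
move=> oU [H K]; split; first by under eq_fun do rewrite cReJ.
by under eq_fun do rewrite cImJ; exact: smoothN.
Qed.

Lemma csmoothV U Z : open U -> csmooth U Z -> (forall x, U x -> Z x != 0) ->
  csmooth U (fun x => (Z x)^-1).
Proof.
move=> oU [H K] Z0.
have N : smooth U (fun x => (Re (Z x) ^+ 2 + Im (Z x) ^+ 2)^-1).
  apply: smoothV => //; first by apply: smoothD => //; exact: smoothX.
  by move=> x /Z0; exact: norm2_neq0.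
split; first by under eq_fun do rewrite cReV; exact: smoothM.
by under eq_fun do rewrite cImV; apply: smoothM => //; exact: smoothN.
Qed.

Lemma csmooth_div U Z W : open U -> csmooth U Z -> csmooth U W ->
  (forall x, U x -> W x != 0) -> csmooth U (fun x => Z x / W x).
Proof. by move=> oU H K W0; apply: csmoothM => //; exact: csmoothV. Qed.

Lemma csmooth_sum U (I : Type) (r : seq I) (P : pred I) (Z : I -> 'rV[R]_n -> C) :
  open U -> (forall i, P i -> csmooth U (Z i)) ->
  csmooth U (fun x => \sum_(i <- r | P i) Z i x).
Proof.
move=> oU H; split.
  by under eq_fun do rewrite cRe_sum; apply: smooth_sum => // i /H[].
by under eq_fun do rewrite cIm_sum; apply: smooth_sum => // i /H[].
Qed.

Lemma csmooth_comp m U (l : 'rV[R]_n -> 'rV[R]_m) (Z : 'rV[R]_m -> C) :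
  open U -> smooth U l -> csmooth setT Z -> csmooth U (fun x => Z (l x)).
Proof.
by move=> oU lC [H K]; split;
  [exact: (smooth_comp oU (@openT _) (fun _ _ => I) lC H)|
   exact: (smooth_comp oU (@openT _) (fun _ _ => I) lC K)].
Qed.

Lemma csmooth_neq0_open U Z : open U -> csmooth U Z -> open [set x | U x /\ Z x != 0].
Proof.
move=> oU [H K].
have N : smooth U (fun x => Re (Z x) ^+ 2 + Im (Z x) ^+ 2).
  by apply: smoothD => //; exact: smoothX.
have := open_neq0 oU N; congr open; apply/seteqP; split=> x [Ux z0]; split=> //.
  by apply: contraNneq z0 => ->; rewrite /= expr0n addr0.
exact: norm2_neq0.
Qed.

End Smooth.
End ComplexCalculus.

(** * Homogeneous coordinates *)

Section HomogeneousCoordinates.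
Context {R : realType} {n : nat}.
Local Notation C := (R[i]).
Local Notation Re := complex.Re.
Local Notation Im := complex.Im.
Implicit Types (z w a b : 'rV[C]_n.+1) (p : @proj_mfd R n).

Lemma rep_in (T : Type) (e : T -> set T) (A : quot e) : sval A = e (rep A).
Proof. by rewrite /rep; case: cid. Qed.

(** The value at [z = 0] is the class of some fixed vector; a total function
    lets maps into projective space be written without proofs of nonvanishing in
    their terms. *)
Definition hpoint z : proj_mfd (R := R) n :=
  cls (@line R n) (insubd (exist _ (insert ord0 1 0) (insert_neq0 ord0 0) : {z : 'rV[C]_n.+1 | z != 0}) z).

Lemma hpointE z (z0 : z != 0) : cls (@line R n) (exist _ z z0) = hpoint z.
Proof. by rewrite /hpoint; congr cls; apply/val_inj; rewrite val_insubd z0. Qed.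

Lemma hcoord_neq0 p : hcoord p != 0.
Proof. exact: (svalP (rep p)). Qed.

Lemma hpoint_hcoord p : hpoint (hcoord p) = p.
Proof.
rewrite -(hpointE (hcoord_neq0 p)).
have -> : exist _ (hcoord p) (hcoord_neq0 p) = rep p by apply: val_inj.
by have := rep_in p; case: p => A HA /= E; exact: eq_exist (esym E).
Qed.

Lemma hcoord_hpoint z : z != 0 -> exists2 c : C, c != 0 & hcoord (hpoint z) = c *: z.
Proof.
move=> z0; have := rep_in (hpoint z); rewrite -(hpointE z0) /= => E.
have : line (rep (cls (@line R n) (exist _ z z0))) (rep (cls (@line R n) (exist _ z z0))).
  by exists 1; [exact: oner_neq0|rewrite scale1r].
by rewrite -E => -[c c0 Ec]; exists c.
Qed.

Lemma hpointZ c z : c != 0 -> z != 0 -> hpoint (c *: z) = hpoint z.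
Proof.
move=> c0 z0; have cz0 : c *: z != 0 by rewrite scaler_eq0 negb_or c0.
rewrite -(hpointE z0) -(hpointE cz0) /cls; apply: eq_exist.
apply/seteqP; split=> w [d d0 /= E].
  by exists (d * c); rewrite ?mulf_neq0 //= E scalerA.
by exists (d / c); rewrite ?mulf_neq0 ?invr_neq0 //= E scalerA divfK.
Qed.

Lemma hpoint_inj z w : z != 0 -> w != 0 -> hpoint z = hpoint w ->
  exists2 c : C, c != 0 & w = c *: z.
Proof.
move=> z0 w0 E; have [c c0 Ec] := hcoord_hpoint z0; have [d d0 Ed] := hcoord_hpoint w0.
exists (d^-1 * c); first by rewrite mulf_neq0 // invr_neq0.
by rewrite -scalerA -Ec E Ed scalerA mulVf // scale1r.
Qed.

(** The chart around the points with [z_i != 0], on homogeneous coordinates. *)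
Definition affine i z : 'rV[C]_n := \row_j (z 0 (lift i j) / z 0 i).
(** The differential of [affine i] at [z] along [a]. *)
Definition daffine i z a : 'rV[C]_n :=
  \row_j (a 0 (lift i j) / z 0 i - z 0 (lift i j) * a 0 i / z 0 i ^+ 2).

Lemma insert_affine i z : z 0 i != 0 -> insert i 1 (affine i z) = (z 0 i)^-1 *: z.
Proof.
move=> zi; apply/rowP => k; rewrite !mxE; case: unliftP => [j ->|->].
  by rewrite mxE mulrC.
by rewrite mulVf.
Qed.

(** The tangent vector with components [daffine i z a] is represented by [a /
    z_i] up to a multiple of [z]. *)
Lemma insert_daffine i z a : z 0 i != 0 ->
  insert i 0 (daffine i z a) = (z 0 i)^-1 *: a - (a 0 i / z 0 i ^+ 2) *: z.
Proof.
move=> zi; apply/rowP => k; rewrite !mxE; case: unliftP => [j ->|->].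
  by rewrite mxE; ring.
by field.
Qed.

Lemma affineZ c i z : c != 0 -> affine i (c *: z) = affine i z.
Proof.
move=> c0; apply/rowP => j; rewrite !mxE invfM mulrACA.
by rewrite mulfV // mul1r.
Qed.

Lemma affine_insert i (w : 'rV[C]_n) : affine i (insert i 1 w) = w.
Proof. by apply/rowP => j; rewrite !mxE liftK unlift_none divr1. Qed.

Lemma dom_hpoint i z : z != 0 -> dom (i : chart (@proj_mfd R n)) (hpoint z) = (z 0 i != 0) :> Prop.
Proof.
move=> z0; have [c c0 /= ->] := hcoord_hpoint z0.
by rewrite mxE mulf_eq0 (negPf c0).
Qed.

Lemma coord_hpoint i z : z != 0 ->
  coord (i : chart (@proj_mfd R n)) (hpoint z) = of_complex (affine i z).
Proof.
move=> z0; have [c c0 /= ->] := hcoord_hpoint z0.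
by rewrite -(affineZ i z c0).
Qed.

Lemma to_complexK : cancel (@to_complex R n) of_complex.
Proof.
move=> x; rewrite -[RHS]hsubmxK /of_complex; congr row_mx.
  by apply/rowP => k; rewrite !mxE.
by apply/rowP => k; rewrite !mxE.
Qed.

Lemma of_complexK : cancel of_complex (@to_complex R n).
Proof.
move=> w; apply/rowP => k; rewrite mxE /of_complex row_mxKl row_mxKr !mxE.
by case: (w 0 k).
Qed.

Lemma point_hpoint i x : point (i : chart (@proj_mfd R n)) x = hpoint (insert i 1 (to_complex x)).
Proof. exact: hpointE. Qed.

Lemma proj_full : full_charts (proj_mfd (R := R) n).
Proof.
move=> i; split=> [p|x].
  rewrite -[p]hpoint_hcoord dom_hpoint ?hcoord_neq0 // => pi.
  rewrite coord_hpoint ?hcoord_neq0 // point_hpoint of_complexK insert_affine //.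
  by rewrite hpointZ ?invr_neq0 ?hcoord_neq0.
rewrite point_hpoint dom_hpoint ?insert_neq0 // coord_hpoint ?insert_neq0 //.
rewrite affine_insert to_complexK; split=> //.
by rewrite mxE unlift_none oner_neq0.
Qed.

Lemma proj_prefer p : dom (prefer p) p.
Proof.
rewrite /=; case: pickP => [i //|H]; exfalso.
by have /rV0Pn[k] := hcoord_neq0 p; rewrite H.
Qed.

Lemma daffine_is_linear i z : linear (daffine i z).
Proof.
by move=> k a b; apply/rowP => j; rewrite !mxE; ring.
Qed.

Lemma of_complex_i (w : 'rV[C]_n) : of_complex ('i%C *: w) = mul_i (of_complex w).
Proof.
rewrite /mul_i /of_complex row_mxKl row_mxKr; congr row_mx; apply/rowP => k; rewrite !mxE !ReIm /=; ring.
Qed.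

Lemma to_complex_i x : to_complex (mul_i x) = 'i%C *: @to_complex R n x.
Proof. by rewrite -[in LHS](to_complexK x) -of_complex_i of_complexK. Qed.

Lemma insert0_is_linear i : linear (@insert R n i 0).
Proof.
move=> k a b; apply/rowP => j; rewrite !mxE; case: unlift => [l|]; first by rewrite !mxE.
by rewrite mulr0 addr0.
Qed.

Lemma insertZ i c (w : 'rV[C]_n) : insert i 0 (c *: w) = c *: insert i 0 w.
Proof. by have := insert0_is_linear i c w 0; rewrite addr0 => ->; rewrite -[RHS]addr0; congr (_ + _); apply/rowP => j; rewrite !mxE; case: unlift => // l; rewrite mxE. Qed.

End HomogeneousCoordinates.

(** * Algebra of the Fubini-Study form *)

Section FubiniStudy.
Context {R : realType} {n : nat}.
Local Notation C := (R[i]).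
Local Notation Re := complex.Re.
Local Notation Im := complex.Im.
Implicit Types (z w a b : 'rV[C]_n.+1).

Lemma hdotDl a b w : hdot (a + b) w = hdot a w + hdot b w.
Proof. by rewrite /hdot -big_split; apply: eq_bigr => k _; rewrite mxE mulrDl. Qed.

Lemma hdotZl c a w : hdot (c *: a) w = c * hdot a w.
Proof. by rewrite /hdot mulr_sumr; apply: eq_bigr => k _; rewrite mxE mulrA. Qed.

Lemma hdotJ a b : (hdot a b)^*%C = hdot b a.
Proof.
rewrite /hdot rmorph_sum; apply: eq_bigr => k _.
by rewrite rmorphM /= conjcK mulrC.
Qed.

Lemma hdotDr a b w : hdot w (a + b) = hdot w a + hdot w b.
Proof. by rewrite -hdotJ hdotDl rmorphD /= !hdotJ. Qed.

Lemma hdotZr c a w : hdot w (c *: a) = c^*%C * hdot w a.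
Proof. by rewrite -hdotJ hdotZl rmorphM /= hdotJ. Qed.

Definition norm2 z : R := \sum_k (Re (z 0 k) ^+ 2 + Im (z 0 k) ^+ 2).

Lemma hdot_norm2 z : hdot z z = (norm2 z)%:C%C.
Proof.
apply: complex_ext; rewrite /hdot /norm2 ?cRe_sum ?cIm_sum /=.
  by apply: eq_bigr => k _; rewrite !ReIm; ring.
by rewrite big1 // => k _; rewrite !ReIm; ring.
Qed.

Lemma norm2_gt0 z : z != 0 -> 0 < norm2 z.
Proof.
move=> /rV0Pn[k zk]; rewrite /norm2 (bigD1 k) //=; apply: ltr_pwDl.
  by rewrite lt_neqAle eq_sym norm2_neq0 //= addr_ge0 ?sqr_ge0.
by apply: sumr_ge0 => j _; rewrite addr_ge0 ?sqr_ge0.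
Qed.

Lemma hdot_neq0 z : z != 0 -> hdot z z != 0.
Proof. by move=> /norm2_gt0 z0; rewrite hdot_norm2 (inj_eq (@complexI R)) gt_eqF. Qed.

(** Neither the scale of the representative nor multiples of [z] added to the
    tangent vectors matter, so the metric can be computed on any homogeneous
    coordinates. *)
Lemma fubini_study_scale c l m z a b : c != 0 -> z != 0 ->
  fubini_study (c *: z) (c *: a + l *: z) (c *: b + m *: z) = fubini_study z a b.
Proof.
move=> c0 z0; rewrite /fubini_study; congr (4 * Re _).
rewrite !(hdotDl, hdotDr, hdotZl, hdotZr).
have := hdot_neq0 z0; have : c^*%C != 0 by rewrite conjc_eq0.
move: (hdot z z) (hdot a b) (hdot a z) (hdot z b) (c^*%C) (l^*%C) (m^*%C).
by move=> S p q r cb lb mb cb0 S0; field; rewrite c0 cb0 S0.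
Qed.

Lemma fubini_study_i z a b : fubini_study z ('i%C *: a) ('i%C *: b) = fubini_study z a b.
Proof.
rewrite /fubini_study !(hdotZl, hdotZr); congr (4 * Re _).
have E : 'i%C * ('i%C)^*%C = 1 :> C by apply: complex_ext; rewrite !ReIm /=; ring.
by rewrite !mulrA E [_ * hdot a z * _]mulrAC E !mul1r.
Qed.

Lemma fubini_study_sym z a b : fubini_study z a b = fubini_study z b a.
Proof.
rewrite /fubini_study -[in RHS]cReJ; congr (4 * Re _).
rewrite rmorphB /= !rmorphM /= !fmorphV /= rmorphXn /= !hdotJ.
by rewrite [hdot z b * _]mulrC.
Qed.

Lemma fubini_study_linear z a (k : R) b c :
  fubini_study z a (k%:C%C *: b + c) = k * fubini_study z a b + fubini_study z a c.
Proof.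
rewrite /fubini_study !(hdotDr, hdotZr) conjc_real mulrCA -mulrDr; congr (4 * _).
have -> : k * Re (hdot a b / hdot z z - hdot a z * hdot z b / hdot z z ^+ 2) =
  Re (k%:C%C * (hdot a b / hdot z z - hdot a z * hdot z b / hdot z z ^+ 2)).
  by move: (_ - _) => u; rewrite cReM /=; ring.
by rewrite -cReD; congr (Re _); ring.
Qed.

(** The component of [a] orthogonal to [z], multiplied by the square norm of [z]
    to avoid a division. *)
Definition orth z a := hdot z z *: a - hdot a z *: z.

Lemma orth_norm2 z a :
  (norm2 (orth z a))%:C%C = hdot z z * (hdot z z * hdot a a - hdot a z * hdot z a).
Proof.
rewrite -hdot_norm2 /orth -scaleNr !(hdotDl, hdotDr, hdotZl, hdotZr) rmorphN /= !hdotJ.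
by ring.
Qed.

Lemma orth0 z a : z != 0 -> orth z a = 0 -> a = (hdot a z / hdot z z) *: z.
Proof.
move=> z0 /eqP; rewrite subr_eq0 => /eqP E; have h := hdot_neq0 z0.
by rewrite mulrC -scalerA -E scalerA mulVf // scale1r.
Qed.

(** This form shows the metric to be positive on tangent vectors that are not
    multiples of [z]. *)
Lemma fubini_study_orth z a : z != 0 ->
  fubini_study z a a = 4 * (norm2 (orth z a) / norm2 z ^+ 3).
Proof.
move=> z0; rewrite /fubini_study; congr (4 * _).
have h := hdot_neq0 z0.
have -> : hdot a a / hdot z z - hdot a z * hdot z a / hdot z z ^+ 2
  = (norm2 (orth z a))%:C%C / (norm2 z)%:C%C ^+ 3.
  by rewrite orth_norm2 -hdot_norm2; field.
by rewrite -!rmorphXn -fmorphV -rmorphM.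
Qed.

(** The square norm of [orth z a] is positive. *)
Lemma cauchy_schwarz_strict z a : z != 0 -> orth z a != 0 ->
  Re (hdot a z * hdot z a) < norm2 z * norm2 a.
Proof.
move=> z0 /norm2_gt0 o0; have zp := norm2_gt0 z0.
have := congr1 (@complex.Re R) (orth_norm2 z a); rewrite !hdot_norm2.
move: (hdot a z * hdot z a) => u /= E; rewrite E in o0; move: o0.
by rewrite !ReIm /= !mul0r !subr0 pmulr_rgt0 // subr_gt0.
Qed.

End FubiniStudy.

(** * Maps into projective space given by homogeneous coordinates *)

Section Lifts.
Context {R : realType} {n : nat}.
Local Notation C := (R[i]).
Local Notation Re := complex.Re.
Local Notation Im := complex.Im.
Local Notation P := (@proj_mfd R n).

Lemma has_diff_affine (V : normedModType R) (Z A : V -> 'rV[C]_n.+1) (x : V) i :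
  (forall k, has_cdiff (fun y => Z y 0 k) x (fun v => A v 0 k)) -> Z x 0 i != 0 ->
  has_diff (fun y => of_complex (affine i (Z y))) x
    (fun v => of_complex (daffine i (Z x) (A v))).
Proof.
move=> H Zi.
have D j : has_cdiff (fun y => affine i (Z y) 0 j) x (fun v => daffine i (Z x) (A v) 0 j).
  have := has_cdiffM (H (lift i j)) (has_cdiffV (H i) Zi).
  rewrite (_ : (fun y => _ * _) = fun y => affine i (Z y) 0 j); last first.
    by apply/funext => y; rewrite mxE.
  by move=> /has_cdiff_ext; apply => v; rewrite mxE; ring.
rewrite /of_complex; apply: has_diff_row_mx; apply: has_diff_row => j.
  under eq_fun do rewrite mxE; under [X in has_diff _ _ X]eq_fun do rewrite mxE.
  exact: (D j).1.
under eq_fun do rewrite mxE; under [X in has_diff _ _ X]eq_fun do rewrite mxE.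
exact: (D j).2.
Qed.

Section Lift.
Context {m : nat} (Z : 'rV[R]_m -> 'rV[C]_n.+1).
Hypotheses (Z0 : forall y, Z y != 0) (ZC : forall k, csmooth setT (fun y => Z y 0 k)).

Lemma lift_smooth (j : chart P) :
  open [set y | dom j (hpoint (Z y))] /\
  smooth [set y | dom j (hpoint (Z y))] (fun y => coord j (hpoint (Z y))).
Proof.
have -> : [set y | dom j (hpoint (Z y))] = [set y | setT y /\ Z y 0 j != 0].
  by apply/seteqP; split=> y; rewrite /mkset (dom_hpoint _ (Z0 y)); [split|case].
have oU : open [set y | setT y /\ Z y 0 j != 0] by apply: csmooth_neq0_open (ZC j); exact: openT.
split=> //; apply: (@smooth_eq _ _ _ _ (fun y => of_complex (affine j (Z y)))) => //.
  by move=> y _; rewrite coord_hpoint.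
have S k : csmooth [set y | setT y /\ Z y 0 j != 0] (fun y => Z y 0 k).
  by have [H K] := ZC k; split; [apply: smooth_sub H|apply: smooth_sub K].
have D k : csmooth [set y | setT y /\ Z y 0 j != 0] (fun y => affine j (Z y) 0 k).
  have -> : (fun y => affine j (Z y) 0 k) = fun y => Z y 0 (lift j k) / Z y 0 j.
    by apply/funext => y; rewrite mxE.
  by apply: csmooth_div => // y [].
apply: smooth_row_mx => //; apply: smooth_row => // k.
  by apply: smooth_eq (D k).1 => // y _; rewrite mxE.
by apply: smooth_eq (D k).2 => // y _; rewrite mxE.
Qed.

Variables (x : 'rV[R]_m) (A : 'rV[R]_m -> 'rV[C]_n.+1).
Hypothesis ZD : forall k, has_cdiff (fun y => Z y 0 k) x (fun v => A v 0 k).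

Lemma lift_diff (j : chart P) v : Z x 0 j != 0 ->
  'd (fun y => coord j (hpoint (Z y))) x v = of_complex (daffine j (Z x) (A v)).
Proof.
move=> Zj.
rewrite (_ : (fun y => _) = fun y => of_complex (affine j (Z y))); last first.
  by apply/funext => y; rewrite coord_hpoint.
by have [_ ->] := has_diff_affine ZD Zj.
Qed.

Let i : chart P := prefer (hpoint (Z x)).
Let Zi : Z x 0 i != 0. Proof. by rewrite -dom_hpoint //; exact: proj_prefer. Qed.

(** The affine chart replaces [Z] by [Z / Z_i] and [A] by [A / Z_i] up to a
    multiple of [Z], which [fubini_study_scale] ignores. *)
Lemma lift_met v w :
  @met R _ (CP R n) (hpoint (Z x))
    ('d (fun y => coord i (hpoint (Z y))) x v) ('d (fun y => coord i (hpoint (Z y))) x w)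
  = fubini_study (Z x) (A v) (A w).
Proof.
rewrite !lift_diff // /met /= -/i.
have -> : of_complex (\row_j (hcoord (hpoint (Z x)) 0 (lift i j) / hcoord (hpoint (Z x)) 0 i))
    = of_complex (affine i (Z x)) by rewrite -coord_hpoint.
rewrite !of_complexK insert_affine // !insert_daffine // -!scaleNr.
by rewrite fubini_study_scale // invr_neq0.
Qed.

Lemma lift_cpx v w : A w = 'i%C *: A v ->
  'd (fun y => coord i (hpoint (Z y))) x w
    = @cpx R _ (CP R n) (hpoint (Z x)) ('d (fun y => coord i (hpoint (Z y))) x v).
Proof.
move=> E; rewrite !lift_diff // E /= -of_complex_i; congr of_complex.
have := daffine_is_linear i (Z x) 'i%C (A v) 0.
rewrite !addr0 => ->; rewrite -[RHS]addr0; congr (_ + _).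
by apply/rowP => k; rewrite !mxE !(mul0r, mulr0) subr0.
Qed.

End Lift.
End Lifts.

(** * Projective space is Kähler *)

Section ProjectiveKahler.
Context {R : realType} {n : nat}.
Local Notation C := (R[i]).
Local Notation Re := complex.Re.
Local Notation Im := complex.Im.
Local Notation P := (@proj_mfd R n).

(** The section of homogeneous coordinates over the chart [i]. *)
Definition affine_rep (i : chart P) (x : 'rV[R]_(n + n)) : 'rV[C]_n.+1 := insert i 1 (to_complex x).
(** The differential of the section [affine_rep i]. *)
Definition daffine_rep (i : chart P) (v : 'rV[R]_(n + n)) : 'rV[C]_n.+1 := insert i 0 (to_complex v).

Lemma affine_rep_neq0 i x : affine_rep i x != 0. Proof. exact: insert_neq0. Qed.

Lemma lcoord_is_linear p q j : linear (fun x : 'rV[R]_(p + q) => lsubmx x 0 j : R).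
Proof. by move=> k a b; rewrite !mxE. Qed.
Lemma rcoord_is_linear p q j : linear (fun x : 'rV[R]_(p + q) => rsubmx x 0 j : R).
Proof. by move=> k a b; rewrite !mxE. Qed.

Lemma affine_rep_csmooth i k : csmooth setT (fun x => affine_rep i x 0 k).
Proof.
case: (unliftP i k) => [j E|E].
  have -> : (fun x => affine_rep i x 0 k) = fun x => (lsubmx x 0 j +i* rsubmx x 0 j)%C.
    by apply/funext => x; rewrite E [LHS]mxE liftK [LHS]mxE.
  by split; apply: smooth_linear; [exact: lcoord_is_linear|exact: rcoord_is_linear].
have -> : (fun x => affine_rep i x 0 k) = fun=> 1; last exact: csmooth_cst.
by apply/funext => x; rewrite E !mxE unlift_none.
Qed.

Lemma affine_rep_has_cdiff i k x : has_cdiff (fun x => affine_rep i x 0 k) x (fun v => daffine_rep i v 0 k).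
Proof.
case: (unliftP i k) => [j E|E].
  have -> : (fun x => affine_rep i x 0 k) = fun x => (lsubmx x 0 j +i* rsubmx x 0 j)%C.
    by apply/funext => y; rewrite E [LHS]mxE liftK [LHS]mxE.
  have -> : (fun x => daffine_rep i x 0 k) = fun x => (lsubmx x 0 j +i* rsubmx x 0 j)%C.
    by apply/funext => y; rewrite E [LHS]mxE liftK [LHS]mxE.
  by split; apply: has_diff_linear; [exact: lcoord_is_linear|exact: rcoord_is_linear].
have -> : (fun x => affine_rep i x 0 k) = fun=> 1.
  by apply/funext => y; rewrite E !mxE unlift_none.
have -> : (fun x => daffine_rep i x 0 k) = fun=> 0; last exact: has_cdiff_cst.
by apply/funext => y; rewrite E !mxE unlift_none.
Qed.

Lemma daffine_rep_i i v : daffine_rep i (mul_i v) = 'i%C *: daffine_rep i v.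
Proof. by rewrite /daffine_rep to_complex_i insertZ. Qed.

Lemma to_complex_linear (k : R) (a b : 'rV[R]_(n + n)) :
  to_complex (k *: a + b) = k%:C%C *: to_complex a + to_complex b.
Proof.
by apply/rowP => j; rewrite !mxE; apply: complex_ext; rewrite /= ?mul0r ?subr0 ?addr0 ?mxE //=.
Qed.

Lemma daffine_rep_linear i (k : R) a b : daffine_rep i (k *: a + b) = k%:C%C *: daffine_rep i a + daffine_rep i b.
Proof. by rewrite /daffine_rep to_complex_linear insert0_is_linear. Qed.

Lemma proj_vec_met (i : chart P) x a b :
  @met R _ (CP R n) (point i x) (vec i x a) (vec i x b)
    = fubini_study (affine_rep i x) (daffine_rep i a) (daffine_rep i b).
Proof.
have := lift_met (affine_rep_neq0 i) (fun k => affine_rep_has_cdiff i k x) a b.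
rewrite /vec -/P.
have -> : (fun y => coord (prefer (hpoint (affine_rep i x)) : chart P) (hpoint (affine_rep i y)))
  = coord (prefer (hpoint (affine_rep i x))) \o point i.
  by apply/funext => y; rewrite /= -point_hpoint.
by rewrite /affine_rep -point_hpoint.
Qed.

Lemma proj_vec_cpx (i : chart P) x a :
  @cpx R _ (CP R n) (point i x) (vec i x a) = vec i x (mul_i a).
Proof.
have := lift_cpx (affine_rep_neq0 i) (fun k => affine_rep_has_cdiff i k x) (daffine_rep_i i a).
rewrite /vec -/P.
have -> : (fun y => coord (prefer (hpoint (affine_rep i x)) : chart P) (hpoint (affine_rep i y)))
  = coord (prefer (hpoint (affine_rep i x))) \o point i.
  by apply/funext => y; rewrite /= -point_hpoint.
by rewrite /affine_rep -point_hpoint.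
Qed.

Lemma csmooth_hdot m k (U : set 'rV[R]_m) (Z W : 'rV[R]_m -> 'rV[C]_k.+1) : open U ->
  (forall j, csmooth U (fun x => Z x 0 j)) -> (forall j, csmooth U (fun x => W x 0 j)) ->
  csmooth U (fun x => hdot (Z x) (W x)).
Proof.
move=> oU ZC WC; apply: csmooth_sum => // j _; apply: csmoothM => //.
exact: csmoothJ.
Qed.

Lemma smooth_fubini_study i (a b : 'rV[C]_n.+1) :
  smooth setT (fun x => fubini_study (affine_rep i x) a b).
Proof.
have K (c : 'rV[C]_n.+1) j : csmooth setT (fun _ : 'rV[R]_(n + n) => c 0 j) by exact: csmooth_cst.
have oT := @openT ('rV[R]_(n + n)).
apply: smoothM => //; first exact: smooth_cst.
have H0 x : [set: 'rV[R]_(n + n)] x -> hdot (affine_rep i x) (affine_rep i x) != 0.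
  by move=> _; apply: hdot_neq0; exact: affine_rep_neq0.
have S1 : csmooth setT (fun x => hdot (affine_rep i x) (affine_rep i x)).
  by apply: csmooth_hdot => // j; exact: affine_rep_csmooth.
suff [] : csmooth setT (fun x => hdot a b / hdot (affine_rep i x) (affine_rep i x)
  - hdot a (affine_rep i x) * hdot (affine_rep i x) b / hdot (affine_rep i x) (affine_rep i x) ^+ 2) by [].
apply: csmoothB => //.
  by apply: csmooth_div => //; exact: csmooth_cst.
apply: csmooth_div => //.
- apply: csmoothM => //; apply: csmooth_hdot => // j; exact: affine_rep_csmooth.
- by under eq_fun do rewrite expr2; exact: csmoothM.
- by move=> x Ux; rewrite expf_neq0 // H0.
Qed.

Lemma proj_connected : mconnected (CP R n).
Proof.
apply: (full_connected proj_full (p0 := hpoint (const_mx 1))).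
  move=> i; rewrite dom_hpoint ?mxE ?oner_neq0 //.
  by apply/rV0Pn; exists ord0; rewrite mxE oner_neq0.
by move=> p; exists (prefer p); exact: proj_prefer.
Qed.

Lemma proj_manifold : is_manifold (CP R n).
Proof.
apply: (full_manifold proj_full).
- exact: proj_prefer.
- move=> i j.
  have := lift_smooth (affine_rep_neq0 i) (affine_rep_csmooth i) j.
  have -> : (fun y => coord j (hpoint (affine_rep i y))) = coord j \o point i.
    by apply/funext => y; rewrite /= -point_hpoint.
  by rewrite /affine_rep; under eq_set do rewrite -point_hpoint.
- move=> p q pq; pose z := hcoord p.
  have z0 : z != 0 := hcoord_neq0 p.
  (* The squared cosine of the angle with the line [p], which is 1 at [p]
     only. *)
  pose f (r : P) : R := Re (hdot (hcoord r) z * hdot z (hcoord r)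
     / (hdot (hcoord r) (hcoord r) * hdot z z)).
  have fE w : w != 0 -> f (hpoint w) = Re (hdot w z * hdot z w / (hdot w w * hdot z z)).
    move=> w0; rewrite /f; have [c c0 ->] := hcoord_hpoint w0.
    rewrite !(hdotZl, hdotZr); congr Re.
    have := hdot_neq0 w0; have := hdot_neq0 z0; have : c^*%C != 0 by rewrite conjc_eq0.
    move: (hdot w w) (hdot z z) (hdot w z) (hdot z w) (c^*%C).
    by move=> W Zz u v d d0 Z0 W0; field; rewrite c0 d0 W0 Z0.
  have fr (w : 'rV[C]_n.+1) : w != 0 -> f (hpoint w) = Re (hdot w z * hdot z w) / (norm2 w * norm2 z).
    move=> w0; rewrite fE // !hdot_norm2 -rmorphM -fmorphV /= cReM /=.
    by rewrite mulr0 subr0.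
  have fp : f p = 1.
    rewrite -[p]hpoint_hcoord -/z fr // hdot_norm2 -rmorphM /= divff //.
    by rewrite mulf_neq0 // gt_eqF // norm2_gt0.
  have fq : f q < f p.
    rewrite fp -[q]hpoint_hcoord; set w := hcoord q; have w0 : w != 0 := hcoord_neq0 q.
    rewrite fr // ltr_pdivrMr ?mulr_gt0 ?norm2_gt0 // mul1r [X in _ < X]mulrC.
    apply: cauchy_schwarz_strict => //; apply/eqP => /(orth0 z0) E; apply: pq.
    rewrite -[p]hpoint_hcoord -[q]hpoint_hcoord -/z -/w E hpointZ //.
    by apply: contraNneq w0 => c0; rewrite E c0 scale0r.
  have [|S [T [oS oT Sq Tp ST]]] := separated_by_function proj_full fq.
    move=> i; have oT := @openT ('rV[R]_(n + n)).
    have K j : csmooth setT (fun _ : 'rV[R]_(n + n) => z 0 j) by exact: csmooth_cst.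
    have H0 x : [set: 'rV[R]_(n + n)] x -> hdot (affine_rep i x) (affine_rep i x) * hdot z z != 0.
      by move=> _; rewrite mulf_neq0 // hdot_neq0 // affine_rep_neq0.
    suff [+ _] : csmooth setT (fun x => hdot (affine_rep i x) z * hdot z (affine_rep i x)
        / (hdot (affine_rep i x) (affine_rep i x) * hdot z z)).
      by apply: smooth_eq => // x _; rewrite [RHS](congr1 f (point_hpoint i x)) (fE _ (affine_rep_neq0 i x)).
    apply: csmooth_div => //.
      by apply: csmoothM => //; apply: csmooth_hdot => // j; exact: affine_rep_csmooth.
    apply: csmoothM => //; last exact: csmooth_cst.
    by apply: csmooth_hdot => // j; exact: affine_rep_csmooth.
  by exists T, S; split=> //; rewrite setIC.
- by exists (fun k => inord k) => p; exists (prefer p); rewrite inord_val; exact: proj_prefer.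
Qed.

Lemma fubini_study_gt0 i x v : v != 0 -> 0 < fubini_study (affine_rep i x) (daffine_rep i v) (daffine_rep i v).
Proof.
move=> v0; rewrite fubini_study_orth ?affine_rep_neq0 //.
rewrite mulr_gt0 // divr_gt0 ?exprn_gt0 ?norm2_gt0 ?affine_rep_neq0 //.
apply: contraNneq v0 => /(orth0 (affine_rep_neq0 i x)) E.
have l0 : hdot (daffine_rep i v) (affine_rep i x) / hdot (affine_rep i x) (affine_rep i x) = 0.
  by have := congr1 (fun z : 'rV[C]_n.+1 => z 0 i) E; rewrite !mxE unlift_none mulr1.
move: E; rewrite l0 scale0r => E; rewrite -[v]to_complexK.
rewrite (_ : to_complex v = 0); last first.
  apply/rowP => j; have Ed : daffine_rep i v 0 (lift i j) = to_complex v 0 j by rewrite [LHS]mxE liftK.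
  by rewrite -Ed E !mxE.
apply/eqP; rewrite /of_complex -[RHS](row_mx0 _ 1 n n).
by congr row_mx; apply/rowP => j; rewrite !mxE.
Qed.

Lemma proj_riemannian : is_riemannian (CP R n).
Proof.
split; first exact: proj_manifold.
- by move=> p v w; rewrite /met /= fubini_study_sym.
- move=> p v c w w'; rewrite /met /= -!/(daffine_rep _ _) daffine_rep_linear.
  by rewrite fubini_study_linear.
- by move=> p v v0; exact: fubini_study_gt0.
- move=> i a b; rewrite (cod_full proj_full).
  apply: smooth_eq (smooth_fubini_study i (daffine_rep i a) (daffine_rep i b)); first exact: openT.
  by move=> x _; rewrite -proj_vec_met.
Qed.

Lemma has_cdiff_hdot (V : normedModType R) (Z W A B : V -> 'rV[C]_n.+1) (x : V) :
  (forall k, has_cdiff (fun y => Z y 0 k) x (fun v => A v 0 k)) ->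
  (forall k, has_cdiff (fun y => W y 0 k) x (fun v => B v 0 k)) ->
  has_cdiff (fun y => hdot (Z y) (W y)) x (fun v => hdot (Z x) (B v) + hdot (A v) (W x)).
Proof.
move=> ZD WD.
have := has_cdiff_sum (index_enum 'I_n.+1) (P := predT)
  (fun k _ => has_cdiffM (ZD k) (has_cdiffJ (WD k))).
by move=> /has_cdiff_ext; apply => v; rewrite /hdot -big_split.
Qed.

(** A quarter of the derivative of the Kähler form at a representative [z],
    before taking the real part: [s] stands for [1 / |z|^2], [p], [q], [r] for
    the products [<A, B>], [<B, C>], [<C, A>] of three tangent vectors, and
    [al], [be], [ga] for their products with [z]. The derivative of the form on
    [A, B] is taken along [C]. *)
Definition kahler_term (s p al be ga q r : C) : C :=
  'i%C * (p * - ((conjc ga + ga) * s ^+ 2) - ((al * conjc q + conjc r * conjc be) * s ^+ 2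
      + al * conjc be * (2 * s * - ((conjc ga + ga) * s ^+ 2))))%C.

(** The part of order 2 in [s] and the part of order 3 have to vanish
    separately. *)
Lemma kahler_termE (s : R) (p al be ga q r : C) :
  Re (kahler_term s%:C%C p al be ga q r)
    = s ^+ 2 * Im (p * (conjc ga + ga) + (al * conjc q + conjc r * conjc be))%C
      + - 2 * s ^+ 3 * Im (al * conjc be * (conjc ga + ga))%C.
Proof.
have -> : kahler_term s%:C%C p al be ga q r = - ('i%C * ((s ^+ 2)%:C%C *
    (p * (conjc ga + ga) + (al * conjc q + conjc r * conjc be)) + (- 2 * s ^+ 3)%:C%C * (al * conjc be * (conjc ga + ga))))%C.
  have E2 : (s ^+ 2)%:C%C = s%:C%C ^+ 2 :> C by exact: rmorphXn.
  have E3 : (- 2 * s ^+ 3)%:C%C = - 2 * s%:C%C ^+ 3 :> C.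
    by rewrite [LHS]rmorphM /= [X in X * _]rmorphN /= rmorph_nat [X in _ * X]rmorphXn.
  by rewrite E2 E3 /kahler_term; ring.
move: (_ + _)%C (_ * _ * _)%C => u v; case: u v => [a b] [c d].
by rewrite !ReIm /=; ring.
Qed.

(** Under cyclic permutation of the three vectors, each monomial meets its
    complex conjugate, so that the imaginary parts cancel. *)
Lemma kahler_term_cyclic (s : R) (p q r al be ga : C) :
  Re (kahler_term s%:C%C p al be ga q r) + Re (kahler_term s%:C%C q be ga al r p)
    + Re (kahler_term s%:C%C r ga al be p q) = 0.
Proof.
rewrite !kahler_termE.
have U : Im (p * (conjc ga + ga) + (al * conjc q + conjc r * conjc be))%C
    + Im (q * (conjc al + al) + (be * conjc r + conjc p * conjc ga))%C
    + Im (r * (conjc be + be) + (ga * conjc p + conjc q * conjc al))%C = 0.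
  by case: p q r al be ga => [? ?] [? ?] [? ?] [? ?] [? ?] [? ?]; rewrite /=; ring.
have V : Im (al * conjc be * (conjc ga + ga))%C + Im (be * conjc ga * (conjc al + al))%C
    + Im (ga * conjc al * (conjc be + be))%C = 0.
  by case: al be ga {U} => [? ?] [? ?] [? ?]; rewrite /=; ring.
move: U V; move: (Im _) (Im _) (Im _) (Im _) (Im _) (Im _) => v3 v2 v1 u3 u2 u1 U V.
have -> : s ^+ 2 * u1 + - 2 * s ^+ 3 * v1 + (s ^+ 2 * u2 + - 2 * s ^+ 3 * v2)
    + (s ^+ 2 * u3 + - 2 * s ^+ 3 * v3)
  = s ^+ 2 * (u1 + u2 + u3) + - 2 * s ^+ 3 * (v1 + v2 + v3) by ring.
by rewrite U V !mulr0 addr0.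
Qed.

Lemma diff_fubini_study i x (A B : 'rV[C]_n.+1) c :
  let z := affine_rep i x in let C := daffine_rep i c in
  'd (fun y => fubini_study (affine_rep i y) ('i%C *: A) B) x c
    = 4 * Re (kahler_term (hdot z z)^-1 (hdot A B) (hdot A z) (hdot B z) (hdot C z)
              (hdot B C) (hdot C A)).
Proof.
move=> z C.
have zD k := affine_rep_has_cdiff i k x.
have cD (D : 'rV[R[i]]_n.+1) k : has_cdiff (fun _ : 'rV[R]_(n + n) => D 0 k) x
    (fun _ => (0 : 'rV[R[i]]_n.+1) 0 k).
  by apply: has_cdiff_ext (has_cdiff_cst _ _) _ => v; rewrite mxE.
have SV := has_cdiffV (has_cdiff_hdot zD zD) (hdot_neq0 (affine_rep_neq0 i x)).
have H1 := has_cdiffM (has_cdiff_cst (hdot A B) x) SV.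
have H2 := has_cdiffM (has_cdiffM (has_cdiff_hdot (cD A) zD) (has_cdiff_hdot zD (cD B)))
  (has_cdiffM SV SV).
have H3 := has_cdiffM (has_cdiff_cst 'i%C x) (has_cdiffD H1 (has_cdiffM (has_cdiff_cst (- 1) x) H2)).
have [_ E] := has_diffM (has_diff_cst (4 : R) x) H3.1.
have -> : (fun y => fubini_study (affine_rep i y) ('i%C *: A) B) = fun y => 4 * Re ('i%C *
   (hdot A B / hdot (affine_rep i y) (affine_rep i y) + - 1 * (hdot A (affine_rep i y) * hdot (affine_rep i y) B *
      ((hdot (affine_rep i y) (affine_rep i y))^-1 / hdot (affine_rep i y) (affine_rep i y))))).
  apply/funext => y; rewrite /fubini_study !hdotZl expr2 invfM; congr (4 * Re _); ring.
apply: etrans (E c) _; rewrite mulr0 addr0 -/z -/C; congr (4 * Re _).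
rewrite /kahler_term !hdotJ.
have h0 (v : 'rV[R[i]]_n.+1) : hdot 0 v = 0.
  by rewrite -[X in hdot X v](scale0r (0 : 'rV[R[i]]_n.+1)) hdotZl mul0r.
have h1 (v : 'rV[R[i]]_n.+1) : hdot v 0 = 0 by rewrite -hdotJ h0 conjc0.
rewrite !(h0, h1) -!exprVn; move: (hdot z z)^-1 => s; ring.
Qed.

(** In an affine chart the Kähler form on constant vectors is [fubini_study] at
    a moving representative, so its derivatives are given by
    [diff_fubini_study]. *)
Lemma proj_closed : closed_omega (CP R n).
Proof.
move=> i x _ a b c om.
have omE u v : om u v = fun y => fubini_study (affine_rep i y) ('i%C *: daffine_rep i u) (daffine_rep i v).
  by apply/funext => y; rewrite /om /omega proj_vec_cpx proj_vec_met daffine_rep_i.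
have D u v w : 'd (om u v) x w = 4 * Re (kahler_term (norm2 (affine_rep i x))^-1%:C%C
    (hdot (daffine_rep i u) (daffine_rep i v)) (hdot (daffine_rep i u) (affine_rep i x)) (hdot (daffine_rep i v) (affine_rep i x))
    (hdot (daffine_rep i w) (affine_rep i x)) (hdot (daffine_rep i v) (daffine_rep i w)) (hdot (daffine_rep i w) (daffine_rep i u))).
  rewrite omE; apply: etrans (diff_fubini_study i x _ _ w) _.
  by rewrite hdot_norm2 -fmorphV.
rewrite [X in X + _ + _](D b c a) [X in _ + X + _](D c a b) [X in _ + _ + X](D a b c).
by rewrite -!mulrDr kahler_term_cyclic mulr0.
Qed.

Lemma proj_pre_kahler : pre_kahler (CP R n).
Proof.
split; first by split; [exact: proj_full|exact: proj_riemannian].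
- split.
    move=> p k a b; rewrite /= /mul_i !lsubmx_is_linear !rsubmx_is_linear.
    by rewrite scale_row_mx add_row_mx scalerN opprD.
  move=> p v; rewrite /= /mul_i row_mxKl row_mxKr -opp_row_mx hsubmxK //.
- move=> p v w; rewrite /met /= -!/(daffine_rep _ _) !daffine_rep_i.
  exact: fubini_study_i.
- by exists (fun _ => mul_i) => i x a; exact: proj_vec_cpx.
- exact: proj_closed.
Qed.

End ProjectiveKahler.

(** * The tangent bundle of an exponential family *)

(** The map [tau] is a torification read in the coordinates [(theta, y)] of the
    tangent bundle, where [g theta] is the metric of the base in natural
    parameters and the complex structure is [mul_i]. The period [4 pi] comes
    from the half angle in [exp ((theta_k + i y_k) / 2)]. Sections are only
    asked for locally and in charts, which is what smoothness of the inverse on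
    the quotient needs. *)
Record toric_cover (R : realType) (n d : nat) (g : 'rV[R]_n -> 'rV[R]_n -> 'rV[R]_n -> R)
    (N : herm R d) (Phi : 'rV[R]_n -> N -> N) (tau : 'rV[R]_(n + n) -> N) : Prop := ToricCover {
  tc_smooth : forall j : chart N, open [set x | dom j (tau x)] /\
    smooth [set x | dom j (tau x)] (coord j \o tau);
  tc_fibre : forall x x', tau x = tau x' ->
    exists k : 'rV[int]_n, x' = x + row_mx 0 ((4 * pi) *: map_mx intr k);
  tc_range : range tau = free_locus Phi;
  tc_section : forall x0 (i : chart N), dom i (tau x0) ->
    exists (U : set 'rV[R]_d) (s : 'rV[R]_d -> 'rV[R]_(n + n)),
      [/\ open U, U (coord i (tau x0)), smooth U s, s (coord i (tau x0)) = x0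
        & forall y, U y -> tau (s y) = point i y];
  tc_holo : forall x v, let f := coord (prefer (tau x)) \o tau in
    'd f x (mul_i v) = cpx (tau x) ('d f x v);
  tc_isom : forall x v w, let f := coord (prefer (tau x)) \o tau in
    met (tau x) ('d f x v) ('d f x w)
      = g (lsubmx x) (lsubmx v) (lsubmx w) + g (lsubmx x) (rsubmx v) (rsubmx w);
  tc_action : forall x t, tau (x + row_mx 0 ((4 * pi) *: t)) = Phi t (tau x) }.

Lemma some_such_eq (T : Type) (x0 x : T) (P : set T) :
  P x -> (forall y, P y -> y = x) -> some_such x0 P = x.
Proof.
move=> Px H; rewrite /some_such; case: pselect => [ex|[]]; last by exists x.
by apply: H; case: cid.
Qed.

Section TangentBundle.
Context {R : realType} {n : nat} (E : family R n) (a : outcomes E -> 'rV[R]_n).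
Hypothesis eE : exp_family a.
Local Notation M := (family_affine E).
Local Notation TM := (tangent M).

Let inj := exp_par_inj eE.
Let surj := exp_surj eE.
Let fM : full_charts (family_mfd E) := family_full inj surj.

Definition of_natural (x : 'rV[R]_n) : M := point (tt : chart M) x.
Definition natural (q : M) : 'rV[R]_n := coord (tt : chart M) q.

Lemma of_naturalK x : natural (of_natural x) = x.
Proof. exact: (coordK fM). Qed.

Lemma naturalK q : of_natural (natural q) = q.
Proof. exact: (pointK fM). Qed.

Definition bundle_point (x : 'rV[R]_(n + n)) : TM := (of_natural (lsubmx x), rsubmx x).
Definition bundle_coord (u : TM) : 'rV[R]_(n + n) := row_mx (natural u.1) u.2.

Lemma bundle_pointK x : bundle_coord (bundle_point x) = x.
Proof. by rewrite /bundle_coord /bundle_point /= -/(natural _) of_naturalK hsubmxK. Qed.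

Lemma bundle_coordK u : bundle_point (bundle_coord u) = u.
Proof. by case: u => q v; rewrite /bundle_coord /bundle_point /= row_mxKl row_mxKr naturalK. Qed.

Lemma tangent_coordE (i : chart TM) u : coord i u = bundle_coord u.
Proof. by case: i; rewrite /bundle_coord /= (family_comp inj surj). Qed.

Lemma tangent_pointE (i : chart TM) x : point i x = bundle_point x.
Proof. by case: i; rewrite /bundle_point /= (family_vec inj surj). Qed.

Lemma tangent_full : full_charts TM.
Proof.
move=> i; split=> [u _|x]; first by rewrite tangent_coordE tangent_pointE bundle_coordK.
by rewrite tangent_coordE tangent_pointE bundle_pointK; case: i.
Qed.

Lemma tangent_mopen (S : set TM) : mopen S <-> open [set x | S (bundle_point x)].
Proof.
have e (i : chart TM) : [set x | S (point i x)] = [set x | S (bundle_point x)].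
  by apply/funext => x; rewrite /mkset tangent_pointE.
split=> [/(mopen_full tangent_full)/(_ tt)|H]; first by rewrite e.
by apply/(mopen_full tangent_full) => i; rewrite e.
Qed.

Lemma diff_section (Y : vfield M) p v : smooth_vf Y ->
  mdiff (fun q : M => (q, Y q) : TM) p v = row_mx v ('d (Y \o of_natural) (natural p) v).
Proof.
move=> sY; rewrite /mdiff.
have YD : has_diff (Y \o of_natural) (natural p) ('d (Y \o of_natural) (natural p)).
  by move/(family_smooth_vf inj surj)/smooth_has_diff : sY; exact.
have I : has_diff (fun x : 'rV[R]_n => x) (natural p) id by apply: has_diff_linear.
have [_ H] := has_diff_row_mx I YD; apply: etrans _ (H v).
suff -> : (coord (prefer ((p, Y p) : TM)) \o (fun q : M => (q, Y q) : TM)) \o point (prefer p)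
  = fun x => row_mx x ((Y \o of_natural) x) by [].
apply/funext => x; apply: etrans (tangent_coordE _ _) _.
by rewrite /bundle_coord /=; congr row_mx; exact: of_naturalK.
Qed.

Hypothesis n_gt0 : (0 < n)%N.

(** The defining property only fixes the connector on differentials of vector
    fields, that is on the vectors [(x, b)] with [x != 0], where a field with
    value [w] and derivative [b] along [x] exists. For [n > 0] these span the
    tangent space, so linearity determines the rest. *)
Lemma connectorE u A : connector (@nabla R n M) u A = rsubmx A.
Proof.
rewrite /connector /some_such; case: pselect => [ex|H]; last first.
  exfalso; apply: H; exists (fun _ A => rsubmx A); split=> [_|X Y sX sY p].
    exact: rsubmx_is_linear.
  by rewrite diff_section // row_mxKr.
case: cid => K /= [Kl KE]; clear ex.
have Kgen (x : 'rV[R]_n) b : x != 0 -> K u (row_mx x b) = b.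
  move=> /rV0Pn[k xk]; case: u => p w.
  (* A linear map with [l x = b], so that [Y] has value [w] at [p] and
     derivative [b] along [x]. *)
  pose l (v : 'rV[R]_n) : 'rV[R]_n := (v 0 k / x 0 k) *: b.
  have lL : linear l.
    by move=> c v v'; rewrite /l !mxE scalerA -scalerDl; congr (_ *: _); ring.
  pose X : vfield M := fun=> x; pose Y : vfield M := fun q => w + l (natural q - natural p).
  have YP : Y \o of_natural = fun y => w + (l y - l (natural p)).
    apply/funext => y; rewrite /Y /= of_naturalK; congr (_ + _).
    by rewrite -!/(l _) addrC -scaleN1r lL scaleN1r addrC.
  have sX : smooth_vf X by apply/(family_smooth_vf inj surj); exact: smooth_cst.
  have sY : smooth_vf Y.
    apply/(family_smooth_vf inj surj); rewrite -/of_natural YP.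
    apply: smoothD; [exact: openT|exact: smooth_cst|].
    by apply: smoothD; [exact: openT|exact: smooth_linear|exact: smooth_cst].
  have dY v : 'd (Y \o of_natural) (natural p) v = l v.
    rewrite YP.
    have [_ H] := has_diffD (has_diff_cst w (natural p))
      (has_diffD (has_diff_linear (natural p) lL) (has_diff_cst (- l (natural p)) (natural p))).
    by apply: etrans (H v) _; rewrite add0r addr0.
  have := KE X Y sX sY p; rewrite diff_section // dY.
  have -> : Y p = w by rewrite /Y subrr /l mxE mul0r scale0r addr0.
  by rewrite /X /l divff // scale1r.
rewrite -[A]hsubmxK; move: (lsubmx A) (rsubmx A) => x b; rewrite row_mxKr.
have [->|/Kgen//] := eqVneq x 0.
pose e : 'rV[R]_n := delta_mx 0 (Ordinal n_gt0).
have e0 : e != 0 by apply/rV0Pn; exists (Ordinal n_gt0); rewrite mxE !eqxx oner_neq0.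
have -> : row_mx 0 b = -1 *: row_mx e 0 + row_mx e b.
  by rewrite scale_row_mx add_row_mx scaler0 add0r scaleN1r addNr.
by rewrite Kl !Kgen // scaler0 add0r.
Qed.

Lemma projectionE (u : TM) A : mdiff (fun w : TM => w.1 : M) u A = lsubmx A.
Proof.
rewrite /mdiff.
have -> : (coord (prefer (u.1 : M)) \o (fun w : TM => w.1 : M)) \o point (prefer u) = lsubmx.
  by apply/funext => x; apply: etrans (of_naturalK _).
by apply: diff_linear; exact: lsubmx_is_linear.
Qed.

Lemma tangent_metE (u : TM) A B : @met R _ (tangent_herm M) u A B
  = cov a (natural u.1) (lsubmx A) (lsubmx B) + cov a (natural u.1) (rsubmx A) (rsubmx B).
Proof.
apply: (@etrans _ _ (met u.1 (lsubmx A) (lsubmx B) + met u.1 (rsubmx A) (rsubmx B))).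
  by rewrite {1}/met /= -/TM !projectionE !connectorE.
by rewrite !(family_metE eE).
Qed.

Lemma tangent_cpxE (u : TM) A : @cpx R _ (tangent_herm M) u A = mul_i A.
Proof.
apply: some_such_eq => [|B [l r]].
  split.
    by apply: etrans (projectionE u _) _; rewrite connectorE /mul_i row_mxKl.
  by apply: etrans (connectorE u _) _; rewrite projectionE /mul_i row_mxKr.
have {}l : lsubmx B = - rsubmx A by rewrite -(projectionE u B) -(connectorE u A).
have {}r : rsubmx B = lsubmx A by rewrite -(connectorE u B) -(projectionE u A).
by rewrite -[B]hsubmxK l r.
Qed.

End TangentBundle.

(** * From a toric cover to a toric parametrization *)

Lemma some_such_in (T : Type) (x0 : T) (P : set T) :
  (exists x, P x) -> P (some_such x0 P).
Proof. by move=> ex; rewrite /some_such; case: pselect => // ex'; case: cid. Qed.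

Section ToricParametrization.
Context {R : realType} {n : nat} (E : family R n) (a : outcomes E -> 'rV[R]_n).
Hypotheses (eE : exp_family a) (n_gt0 : (0 < n)%N).
Local Notation M := (family_affine E).
Local Notation TM := (tangent M).
Context {d : nat} (N : herm R d) (Phi : 'rV[R]_n -> N -> N) (tau : 'rV[R]_(n + n) -> N).
Hypotheses (fN : full_charts N) (Phi_per : forall t p, integral t -> Phi t p = p).
Hypothesis tc : toric_cover (cov a) Phi tau.

Definition period_fields (i : 'I_n) : vfield M := fun=> (4 * pi) *: delta_mx 0 i.

Definition period_lattice : set TM :=
  [set u | exists k : 'I_n -> int, u.2 = \sum_(i < n) (k i)%:~R *: period_fields i u.1].

Lemma sum_period_fields (t : 'rV[R]_n) q :
  \sum_(i < n) t 0 i *: period_fields i q = (4 * pi) *: t.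
Proof.
rewrite [in RHS](row_expand t) scaler_sumr; apply: eq_bigr => i _.
by rewrite /period_fields !scalerA mulrC.
Qed.

Lemma translate_period t (u : TM) :
  translate period_fields t u = (u.1, u.2 + (4 * pi) *: t).
Proof. by rewrite /translate sum_period_fields. Qed.

Lemma period_generates : generates period_fields period_lattice.
Proof.
split=> //.
- move=> i; apply/(family_smooth_vf (exp_par_inj eE) (exp_surj eE)); exact: smooth_cst.
- move=> i Y _ q; have [_ H] := has_diff_cst ((4 * pi) *: (delta_mx 0 i : 'rV[R]_n)) (natural q).
  exact: H.
- move=> q; have -> : \matrix_(i < n) period_fields i q = (4 * pi)%:M.
    apply/matrixP => i j; rewrite !mxE eqxx /= mulr_natr.
    by rewrite eq_sym.
  rewrite unitmxE det_scalar unitfE expf_neq0 // mulf_neq0 ?pnatr_eq0 //.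
  by rewrite gt_eqF // pi_gt0.
Qed.

Local Notation L := period_lattice.

(** Any other generator of the lattice consists of integral combinations of
    [period_fields], so it gives the same translations. *)
Lemma orbitE (u u' : TM) : orbit L u u' <->
  exists k : 'rV[int]_n, u' = (u.1, u.2 + (4 * pi) *: map_mx intr k).
Proof.
split=> [[gam [X [k [gX ->]]] ->]|[k ->]]; last first.
  exists (translate period_fields (map_mx intr k)); last by rewrite translate_period.
  by exists period_fields, k; split=> //; exact: period_generates.
case: gX => _ _ _ LE.
have : L (u.1, \sum_(i < n) (map_mx intr k : 'rV[R]_n) 0 i *: X i u.1).
  by rewrite LE; exists (fun i => k 0 i) => /=; apply: eq_bigr => i _; rewrite mxE.
move=> [k' /= E']; exists (\row_i k' i); rewrite /translate E'; congr (_, _ + _).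
by rewrite -(sum_period_fields _ u.1); apply: eq_bigr => i _; rewrite !mxE.
Qed.

Lemma bundle_coord_shift (u : TM) v : bundle_coord (u.1, u.2 + v) = bundle_coord u + row_mx 0 v.
Proof. by rewrite /bundle_coord /= add_row_mx addr0. Qed.

Local Notation q := (@qmap R n M L).

Lemma qmap_tau (u u' : TM) : q u = q u' <-> tau (bundle_coord u) = tau (bundle_coord u').
Proof.
have int_row (k : 'rV[int]_n) : integral (map_mx intr k : 'rV[R]_n).
  by move=> i; rewrite mxE intr_int.
split=> [|Et].
  move=> /(congr1 (@proj1_sig _ _)) /= E1.
  have : orbit L u' u' by apply/orbitE; exists 0; rewrite map_mx0 scaler0 addr0; case: (u').
  rewrite -E1 => /orbitE[k ->].
  by rewrite bundle_coord_shift (tc_action tc) Phi_per.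
have [k Ek] := tc_fibre tc Et.
have E1 : u' = (u.1, u.2 + (4 * pi) *: map_mx intr k).
  by rewrite -(bundle_coordK eE u') Ek -bundle_coord_shift (bundle_coordK eE).
apply: eq_exist; apply/seteqP; split=> w /orbitE[k' ->]; apply/orbitE.
  exists (k' - k); rewrite E1 /=; congr (_, _).
  by rewrite map_mxB scalerBr -addrA; congr (_ + _); rewrite addrC subrK.
by exists (k + k'); rewrite E1 /=; congr (_, _); rewrite map_mxD scalerDr addrA.
Qed.

Lemma qmap_rep (A : qherm L) : q (rep A) = A.
Proof.
rewrite /qmap /cls; case: A => A HA; apply: eq_exist; rewrite /rep /=.
by case: cid => u /= ->.
Qed.

Definition toric_map (A : qherm L) : N := tau (bundle_coord (rep A : TM)).

Lemma toric_mapE u : toric_map (q u) = tau (bundle_coord u).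
Proof. by apply/qmap_tau; exact: qmap_rep. Qed.

Lemma toric_map_inj : injective toric_map.
Proof.
by move=> A B; rewrite -[A]qmap_rep -[B]qmap_rep !toric_mapE => /qmap_tau.
Qed.

(** A chart of the quotient is a chart of the tangent bundle with an open set
    [iU.2] on which the quotient map is injective; on that set the coordinates
    of a class are those of its element. *)
Lemma qdomE (iU : chart (qherm L)) u : dom iU (q u) -> exists u0,
  [/\ iU.2 u0, q u = q u0 & forall w, iU.2 w -> coord iU (q w) = bundle_coord w].
Proof.
move=> [oU Ud inj [u0 Uu0 E0]]; exists u0; split=> // w Uw.
apply: etrans (tangent_coordE eE _ _) _; congr bundle_coord.
rewrite /qsection; apply: some_such_eq => [//|y [Uy Ey]].
exact: esym (inj _ _ Uw Uy Ey).
Qed.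

Lemma qdom_mem (iU : chart (qherm L)) u w : dom iU (q u) -> iU.2 w -> dom iU (q w).
Proof. by move=> [oU Ud inj _] Uw; split=> //; exists w. Qed.

Lemma qdom_open (iU : chart (qherm L)) u : dom iU (q u) -> open [set x | iU.2 (bundle_point E x)].
Proof. by move=> [/(tangent_mopen eE) + _ _ _]. Qed.

Lemma qpoint (iU : chart (qherm L)) x : point iU x = q (bundle_point E x).
Proof. by rewrite -(tangent_pointE eE iU.1). Qed.

Lemma toric_map_smooth : msmooth toric_map.
Proof.
move=> iU j U0; rewrite /U0 {U0}.
set S := [set x | dom j (tau x)].
have [oS cS] := tc_smooth tc j.
have E1 x : (coord j \o toric_map \o point iU) x = (coord j \o tau) x.
  by rewrite -[LHS]/(coord j (toric_map (point iU x))) qpoint toric_mapE (bundle_pointK eE).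
rewrite (_ : coord j \o toric_map \o point iU = coord j \o tau); last exact/funext.
have [[A HA]|H] := pselect (exists A : qherm L, dom iU A); last first.
  have -> : coord iU @` (dom iU `&` setT `&` toric_map @^-1` dom j) = set0.
    by apply/seteqP; split=> // x [A [[HA _] _] _]; apply: H; exists A.
  split; [exact: open0|by apply/smooth_pointwise].
rewrite -[A]qmap_rep in HA.
have [u0 [_ _ coE]] := qdomE HA.
have -> : coord iU @` (dom iU `&` setT `&` toric_map @^-1` dom j)
    = [set x | iU.2 (bundle_point E x)] `&` S.
  apply/seteqP; split=> [x [B [[HB _] jB] <-]|x [Ux Sx]].
    rewrite -[B]qmap_rep in HB jB *.
    have [u1 [U1 Eq _]] := qdomE HB; rewrite Eq coE //.
    split; first by rewrite /mkset (bundle_coordK eE).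
    by rewrite /S /mkset -toric_mapE -Eq.
  exists (q (bundle_point E x)); last by rewrite coE // (bundle_pointK eE).
  split; first by split=> //; exact: qdom_mem HA Ux.
  by rewrite /preimage /mkset toric_mapE (bundle_pointK eE).
split; first by apply: openI => //; exact: qdom_open HA.
by apply: smooth_sub cS => x [].
Qed.

Definition toric_inv (z : N) : qherm L := q (bundle_point E (some_such 0 [set x | tau x = z])).

Lemma toric_invE z : free_locus Phi z -> toric_map (toric_inv z) = z.
Proof.
rewrite -(tc_range tc) => -[x _ xz]; rewrite /toric_inv toric_mapE (bundle_pointK eE).
by apply: (@some_such_in _ 0 [set x | tau x = z]); exists x.
Qed.

Lemma toric_map_free A : free_locus Phi (toric_map A).
Proof. by rewrite -(tc_range tc); exists (bundle_coord (rep A)). Qed.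

Lemma toric_mapK : cancel toric_map toric_inv.
Proof.
by move=> A; apply: toric_map_inj; rewrite toric_invE //; exact: toric_map_free.
Qed.

(** Near a point of the free locus the inverse is a local section of [tau]
    followed by the quotient map. The section is shrunk to land in the open set
    of the given chart of the quotient. *)
Lemma toric_inv_smooth : msmooth_on (free_locus Phi) toric_inv.
Proof.
move=> i iU U0; rewrite /U0 {U0} -setIA image_dom //.
set D := [set x | _].
have loc y0 : D y0 -> exists (V : set 'rV[R]_d) (f : 'rV[R]_d -> 'rV[R]_(n + n)),
    [/\ open V, V y0, V `<=` D, smooth V f &
      forall y, V y -> (coord iU \o toric_inv \o point i) y = f y].
  rewrite /D /mkset => -[Sy]; rewrite /preimage /mkset.
  rewrite -(qmap_rep (toric_inv (point i y0))) => Dy.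
  have [u0 [U0 Eq coE]] := qdomE Dy; have oU := qdom_open Dy.
  pose x0 := bundle_coord u0.
  have tx0 : tau x0 = point i y0.
    by rewrite /x0 -toric_mapE -Eq qmap_rep toric_invE.
  have yx0 : coord i (tau x0) = y0 by rewrite tx0 coordK.
  have [|V [s [oV Vy0 sC sx0 sV]]] := tc_section tc (x0 := x0) (i := i).
    by rewrite tx0; exact: dom_point.
  rewrite yx0 in Vy0 sx0.
  have inv y : V y -> toric_inv (point i y) = q (bundle_point E (s y)).
    by move=> Vy; rewrite -(sV _ Vy) -[X in tau X](bundle_pointK eE) -toric_mapE toric_mapK.
  exists [set y | V y /\ iU.2 (bundle_point E (s y))], s; split.
  - exact: (open_preimage (A := [set x | iU.2 (bundle_point E x)])).
  - by split=> //; rewrite sx0 /x0 (bundle_coordK eE).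
  - move=> y [Vy Uy]; split.
      by rewrite -(sV _ Vy) -(tc_range tc); exists (s y).
    by rewrite /preimage /mkset inv //; exact: qdom_mem Dy Uy.
  - by apply: smooth_sub sC => y [].
  - move=> y [Vy Uy]; rewrite -[LHS]/(coord iU (toric_inv (point i y))) inv // coE //.
    exact: bundle_pointK eE _.
split.
  rewrite openE => y0 /loc[V [f [oV Vy0 VD _ _]]].
  have := open_nbhs_nbhs (conj oV Vy0); exact: filterS.
by apply: smooth_local => y0 /loc[V [f [oV Vy0 _ fC E1]]]; exists V, f.
Qed.

(** Two points of a ball of radius [pi] are at distance less than [2 pi], while
    distinct points of an orbit are at distance at least [4 pi]; hence the
    quotient map is injective on the ball. *)
Lemma prefer_qdom (A : qherm L) : exists U : set TM,
  U (rep A) /\ dom ((prefer (rep A : TM), U) : chart (qherm L)) A.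
Proof.
pose u0 : TM := rep A; pose U : set TM := [set u | ball (bundle_coord u0) pi (bundle_coord u)].
have U0 : U u0 by apply: ballxx; exact: pi_gt0.
exists U; split=> //; split=> //.
- apply/(tangent_mopen eE); rewrite (_ : [set x | _] = ball (bundle_coord u0) pi).
    exact: ball_open.
  by apply/funext => x; rewrite -[LHS]/(ball (bundle_coord u0) pi (bundle_coord (bundle_point E x))) (bundle_pointK eE).
- move=> u u' Uu Uu' /qmap_tau/(tc_fibre tc)[k Ek].
  have kpi : `|row_mx 0 ((4 * pi) *: map_mx intr k) : 'rV[R]_(n + n)| < 2 * pi.
    have {}Uu : ball (bundle_coord u0) pi (bundle_coord u) := Uu; have {}Uu' : ball (bundle_coord u0) pi (bundle_coord u') := Uu'.
    move: Uu Uu'; rewrite Ek -!ball_normE /ball_ /mkset => Uu Uu'.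
    set r := row_mx _ _ in Uu' *.
    rewrite (_ : r = (bundle_coord u0 - bundle_coord u) - (bundle_coord u0 - (bundle_coord u + r))); last first.
      by rewrite opprB [RHS]addrC addrA subrK [bundle_coord u + r]addrC addrK.
    apply: le_lt_trans (ler_normB _ _) _; rewrite mulr2n mulrDl mul1r; exact: ltrD.
  have k0 : k = 0.
    apply/rowP => j; rewrite mxE; apply/eqP; apply: contraTT kpi => kj.
    rewrite -leNgt; apply: (@le_trans _ _ `|(4 * pi) * (k 0 j)%:~R|).
      rewrite normrM ger0_norm ?mulr_ge0 ?pi_ge0 //.
      apply: (@le_trans _ _ (4 * pi * 1)).
        by rewrite mulr1; apply: ler_wpM2r; [exact: pi_ge0|rewrite ler_nat].
      apply: ler_wpM2l; first by rewrite mulr_ge0 ?pi_ge0.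
      by rewrite -intr_norm ler1z; rewrite -gtz0_ge1 normr_gt0.
    rewrite [leRHS]/Num.Def.normr /= mx_normrE.
    have := le_bigmax (0 : R) (fun i : 'I_1 * 'I_(n + n) =>
      `|(row_mx 0 ((4 * pi) *: map_mx intr k) : 'rV[R]_(n + n)) i.1 i.2|) (0, rshift n j).
    by rewrite /= row_mxEr !mxE.
  by rewrite -(bundle_coordK eE u) -(bundle_coordK eE u') Ek k0 map_mx0 scaler0 row_mx0 addr0.
- by exists u0 => //; rewrite -[LHS]qmap_rep.
Qed.

(** The preferred chart at a class is one around its representative, so that
    tangent vectors at the class and at the representative have the same
    components. *)
Lemma coord_prefer_qherm (A : qherm L) : coord (prefer A) A = bundle_coord (rep A : TM).
Proof.
have [U UA] := prefer_qdom A.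
have [VA VD] : (prefer A).2 (rep A) /\ dom (prefer A) A.
  suff : [set U : set TM | U (rep A) /\ dom ((prefer (rep A : TM), U) : chart (qherm L)) A]
    (prefer A).2 by [].
  by apply: some_such_in; exists U.
have VD' : dom (prefer A) (q (rep A)) by rewrite qmap_rep.
by have [u0 [_ _ /(_ _ VA)]] := qdomE VD'; rewrite qmap_rep.
Qed.

Lemma mdiff_toric_map (A : qherm L) v : mdiff toric_map A v
  = 'd (coord (prefer (tau (bundle_coord (rep A : TM)))) \o tau) (bundle_coord (rep A : TM)) v.
Proof.
rewrite /mdiff coord_prefer_qherm.
have -> : (coord (prefer (toric_map A)) \o toric_map) \o point (prefer A)
  = coord (prefer (toric_map A)) \o tau.
  apply/funext => x; rewrite -[LHS]/(coord (prefer (toric_map A)) (toric_map (point (prefer A) x))).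
  by rewrite qpoint toric_mapE (bundle_pointK eE).
by [].
Qed.

(** The map induced by [tau] on the quotient has the same expression as [tau] in
    preferred charts, and its inverse is smooth by the local sections. *)
Lemma toric_parametrizationP : toric_parametrization Phi period_fields toric_map.
Proof.
split.
- exact: period_generates.
- split; first exact: toric_map_smooth.
    apply/seteqP; split=> [_ [A _ <-]|z Sz]; first exact: toric_map_free.
    by exists (toric_inv z) => //; exact: toric_invE.
  by exists toric_inv; split; [exact: toric_mapK|exact: toric_inv_smooth].
- move=> A v; rewrite !mdiff_toric_map.
  have -> : cpx A v = mul_i v := tangent_cpxE eE n_gt0 (rep A : TM) v.
  exact: (tc_holo tc).
- move=> A v w; rewrite !mdiff_toric_map.
  apply: etrans (tc_isom tc _ _ _) _; rewrite /bundle_coord row_mxKl.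
  exact: esym (tangent_metE eE n_gt0 (rep A : TM) v w).
- move=> t A; rewrite /PhiX toric_mapE translate_period bundle_coord_shift (tc_action tc).
  by rewrite /toric_map; case: (rep A).
Qed.

End ToricParametrization.

(** * The complex exponential *)

Section Cis.
Context {R : realType}.
Local Notation C := (R[i]).
Local Notation Re := complex.Re.
Local Notation Im := complex.Im.

Lemma cisD (x y : R) : cis (x + y) = cis x * cis y.
Proof. by apply: complex_ext; rewrite !ReIm /= ?cosD ?sinD; ring. Qed.

Lemma cis0 : cis (0 : R) = 1.
Proof. by apply: complex_ext; rewrite /= ?cos0 ?sin0. Qed.

Lemma cis2pi : cis (2 * pi : R) = 1.
Proof. by rewrite mulr_natl; apply: complex_ext; rewrite /= ?cos2pi ?sin2pi. Qed.

Lemma cis_conj (x : R) : cis x * (cis x)^*%C = 1.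
Proof.
apply: complex_ext; rewrite !ReIm /=; last by ring.
by rewrite mulrN opprK -!expr2 cos2Dsin2.
Qed.

Lemma cis_nat (k : nat) : cis (2 * pi * k%:R : R) = 1.
Proof. by elim: k => [|k IH]; [rewrite mulr0 cis0|rewrite -[k.+1]addn1 natrD mulrDr cisD IH mul1r mulr1 cis2pi]. Qed.

Lemma cis_int (t : R) : t \is a Num.int -> cis (2 * pi * t) = 1.
Proof.
move=> /intrP[[k|k] ->]; first exact: cis_nat.
have := cisD (2 * pi * (Negz k)%:~R) (2 * pi * k.+1%:R).
rewrite cis_nat mulr1 => <-; rewrite NegzE -mulrDr mulrNz addNr mulr0; exact: cis0.
Qed.

(** For the fractional part [r] of [t], the real part of [cis (2 pi r)] is [1 -
    2 sin^2 (pi r)], and the sine is positive for [0 < r < 1]. *)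
Lemma cis_eq1 (t : R) : cis (2 * pi * t) = 1 -> t \is a Num.int.
Proof.
move=> H; pose r := t - (Num.floor t)%:~R.
have [r0 r1] : 0 <= r /\ r < 1.
  have := floor_itv t; rewrite /r => /andP[h1 h2].
  by split; [rewrite subr_ge0|rewrite ltrBlDl -[1]/(1%:~R) -intrD].
have Hr : cis (2 * pi * r) = 1.
  have : cis (2 * pi * t) = cis (2 * pi * r) * cis (2 * pi * (Num.floor t)%:~R).
    by rewrite -cisD -mulrDr subrK.
  by rewrite H (cis_int (t := (Num.floor t)%:~R)) ?intr_int // mulr1.
have [rz|rn] := eqVneq r 0.
  by rewrite (_ : t = (Num.floor t)%:~R) ?intr_int //; apply/eqP; rewrite -subr_eq0 -/r rz.
exfalso; have rp : 0 < r by rewrite lt_neqAle eq_sym rn.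
have s0 : 0 < sin (pi * r).
  by apply: sin_gt0_pi; rewrite mulr_gt0 ?pi_gt0 //= gtr_pMr ?pi_gt0.
have := congr1 (@complex.Re R) Hr; rewrite /= -mulrA mulr_natl mulr2n cosD -!expr2.
have := cos2Dsin2 (pi * r) => E2 E1.
have : sin (pi * r) ^+ 2 = 0 by lra.
by move/eqP; rewrite sqrf_eq0 gt_eqF.
Qed.

Lemma cis_neqN1 : cis (2 * pi * 2^-1 : R) = - 1.
Proof.
rewrite mulrAC divff ?mul1r ?pnatr_eq0 //.
by apply: complex_ext; rewrite /= ?cospi ?sinpi ?oppr0.
Qed.

(** The principal logarithm on the right half plane, where the argument is an
    arctangent and thus visibly smooth. *)
Lemma exp_cis_log (u : C) : 0 < Re u ->
  (expR (ln (Re u ^+ 2 + Im u ^+ 2) / 2))%:C%C * cis (atan (Im u / Re u)) = u.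
Proof.
case: u => a b /= a0.
set s := a ^+ 2 + b ^+ 2; have s0 : 0 < s by rewrite ltr_pwDl ?exprn_gt0 // sqr_ge0.
set c := expR _; have c0 : 0 < c by exact: expR_gt0.
have c2 : c ^+ 2 = s by rewrite expr2 -expRD -splitr lnK // posrE.
set t := b / a; have e0 : 0 < 1 + t ^+ 2 by rewrite ltr_pwDl // sqr_ge0.
have cosE : c * cos (atan t) = a.
  have q0 : 0 < Num.sqrt (1 + t ^+ 2) by rewrite sqrtr_gt0.
  apply/eqP; rewrite -(eqrXn2 (n := 2)) ?ltW ?mulr_gt0 ?cos_atan ?invr_gt0 //.
  rewrite exprMn c2 exprVn sqr_sqrtr ?ltW //; apply/eqP; rewrite /s /t.
  by field; rewrite (gt_eqF a0) gt_eqF.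
have sinE : c * sin (atan t) = b.
  have cn : cos (atan t) != 0 by rewrite cos_atan invr_eq0 gt_eqF // sqrtr_gt0.
  have : sin (atan t) = t * cos (atan t) by rewrite -{2}(atanK t) /tan divfK.
  by move=> ->; rewrite mulrCA cosE /t divfK ?gt_eqF.
by apply: complex_ext; rewrite !ReIm /= mul0r ?subr0 ?addr0 ?cosE ?sinE.
Qed.

(** Quarter turns bring any nonzero number into the right half plane. *)
Lemma polar (u : C) : u != 0 -> exists r y : R, u = (expR (r / 2))%:C%C * cis (y / 2).
Proof.
have pos (w : C) : 0 < Re w -> exists r y : R, w = (expR (r / 2))%:C%C * cis (y / 2).
  move=> w0; exists (ln (Re w ^+ 2 + Im w ^+ 2)), (2 * atan (Im w / Re w)).
  by rewrite [2 * _]mulrC mulfK ?pnatr_eq0 // exp_cis_log.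
have rot (w c : C) (t : R) : cis t * c = 1 ->
    (exists r y : R, c * w = (expR (r / 2))%:C%C * cis (y / 2)) ->
    exists r y : R, w = (expR (r / 2))%:C%C * cis (y / 2).
  move=> tc [r [y E]]; exists r, (y + 2 * t).
  rewrite mulrDl [2 * t]mulrC mulfK ?pnatr_eq0 // cisD mulrA -E.
  by rewrite mulrC mulrA tc mul1r.
move=> u0; have [|lt0|Re0] := ltgtP 0 (Re u); first exact: pos.
  apply: (rot u (- 1) pi); last by apply: pos; rewrite mulN1r cReN oppr_gt0.
  by apply: complex_ext; rewrite !ReIm /= ?cospi ?sinpi; ring.
have [|lt0|Im0] := ltgtP 0 (Im u).
- move=> I0; apply: (rot u (- 'i%C) (pi / 2)).
    by apply: complex_ext; rewrite !ReIm /= ?cos_pihalf ?sin_pihalf; ring.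
  by apply: pos; rewrite !ReIm /=; lra.
- apply: (rot u 'i%C (- (pi / 2))).
    by apply: complex_ext; rewrite !ReIm /= ?cosN ?sinN ?cos_pihalf ?sin_pihalf; ring.
  by apply: pos; rewrite !ReIm /=; lra.
- by move/eqP: u0; case; apply: complex_ext.
Qed.

End Cis.

(** * The torus action on projective space *)

Lemma msmooth_full (R : realType) d d' (M : mfd R d) (M' : mfd R d') (f : M -> M') :
  full_charts M ->
  (forall (i : chart M) (j : chart M'), open [set x | dom j (f (point i x))] /\
     smooth [set x | dom j (f (point i x))] (fun x => coord j (f (point i x)))) ->
  msmooth f.
Proof.
by move=> fM H i j U; rewrite /U {U} -setIA image_dom // setTI; exact: H.
Qed.

Lemma euclid_full (R : realType) n : full_charts (euclid n : mfd R n).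
Proof. by []. Qed.

Record kahler_action (R : realType) (n d : nat) (N : herm R d) (Phi : 'rV[R]_n -> N -> N) : Prop :=
  KahlerAction {
    action_torus : is_torus_action Phi;
    action_smooth : forall t, msmooth (Phi t);
    action_holo : forall t, holomorphic (Phi t);
    action_isom : forall t, isometric (Phi t) }.

Section ProjectiveAction.
Context {R : realType} {n : nat}.
Local Notation C := (R[i]).
Local Notation P := (@proj_mfd R n).
Implicit Types (t s : 'rV[R]_n) (z w : 'rV[C]_n.+1).

Lemma phaseD s t k : phase (s + t) k = phase s k * phase t k.
Proof.
by rewrite /phase; case: unlift => [j|]; rewrite ?mulr1 // mxE mulrDr cisD.
Qed.

Lemma phase_conj t k : phase t k * (phase t k)^*%C = 1.
Proof.
by rewrite /phase; case: unlift => [j|]; [exact: cis_conj|rewrite conjc1 mulr1].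
Qed.

Lemma phase_integral t k : integral t -> phase t k = 1.
Proof. by move=> it; rewrite /phase; case: unlift => // j; exact: cis_int. Qed.

Lemma rotate_nz t z : z != 0 -> rotate t z != 0.
Proof. by move=> z0; exact: (rotate_neq0 t (exist _ z z0)). Qed.

Lemma rotateZ t c z : rotate t (c *: z) = c *: rotate t z.
Proof. by apply/rowP => k; rewrite !mxE mulrCA. Qed.

Lemma rotateD s t z : rotate (s + t) z = rotate s (rotate t z).
Proof. by apply/rowP => k; rewrite !mxE phaseD mulrA. Qed.

Lemma rotate_integral t z : integral t -> rotate t z = z.
Proof. by move=> it; apply/rowP => k; rewrite !mxE phase_integral // mul1r. Qed.

Lemma hdot_rotate t z w : hdot (rotate t z) (rotate t w) = hdot z w.
Proof.
apply: eq_bigr => k _; rewrite !mxE rmorphM /= mulrACA.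
by rewrite phase_conj mul1r.
Qed.

Lemma fubini_study_rotate t z a b :
  fubini_study (rotate t z) (rotate t a) (rotate t b) = fubini_study z a b.
Proof. by rewrite /fubini_study !hdot_rotate. Qed.

Lemma action_hpoint t z : z != 0 -> proj_action t (hpoint z) = hpoint (rotate t z).
Proof.
move=> z0; rewrite /proj_action hpointE.
by have [c c0 ->] := hcoord_hpoint z0; rewrite rotateZ hpointZ ?rotate_nz.
Qed.

Lemma csmooth_cis m (U : set 'rV[R]_m) (f : 'rV[R]_m -> R) : open U -> smooth U f ->
  csmooth U (fun x => cis (f x)).
Proof. by move=> oU fC; have [cC sC] := smooth_cos_sin oU fC; split. Qed.

Lemma csmooth_phase m (U : set 'rV[R]_m) (l : 'rV[R]_m -> 'rV[R]_n) k : open U ->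
  smooth U l -> csmooth U (fun x => phase (l x) k).
Proof.
move=> oU lC; rewrite /phase; case: unlift => [j|]; last exact: csmooth_cst.
apply: csmooth_cis => //; apply: smoothM => //; first exact: smooth_cst.
exact: smooth_coord.
Qed.

(** In homogeneous coordinates the action is linear and unitary. *)
Lemma proj_kahler_action : kahler_action (@proj_action R n).
Proof.
have fP := @proj_full R n.
have Zrot (i : chart P) t x : rotate t (affine_rep i x) != 0 by rewrite rotate_nz ?affine_rep_neq0.
have ZrotC (i : chart P) t k : csmooth setT (fun x => rotate t (affine_rep i x) 0 k).
  rewrite (_ : (fun x => _) = fun x => phase t k * affine_rep i x 0 k); last first.
    by apply/funext => x; rewrite mxE.
  by apply: csmoothM; [exact: openT|exact: csmooth_cst|exact: affine_rep_csmooth].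
have ZrotD (i : chart P) t x k :
    has_cdiff (fun y => rotate t (affine_rep i y) 0 k) x (fun v => rotate t (daffine_rep i v) 0 k).
  have := has_cdiffM (has_cdiff_cst (phase t k) x) (affine_rep_has_cdiff i k x).
  rewrite (_ : (fun y => _ * _) = fun y => rotate t (affine_rep i y) 0 k); last first.
    by apply/funext => y; rewrite [RHS]mxE.
  by move=> /has_cdiff_ext; apply => v; rewrite mul0r addr0 [RHS]mxE.
have act_point t (i : chart P) x : proj_action t (point i x) = hpoint (rotate t (affine_rep i x)).
  by rewrite point_hpoint action_hpoint // insert_neq0.
have actE t (p : P) : proj_action t p = hpoint (rotate t (affine_rep (prefer p) (coord (prefer p) p))).
  by rewrite -act_point pointK //; exact: proj_prefer.
have mdiffE t (p : P) v : mdiff (@proj_action R n t) p v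
  = 'd (fun y => coord (prefer (proj_action t p))
          (hpoint (rotate t (affine_rep (prefer p) y)))) (coord (prefer p) p) v.
  rewrite /mdiff; congr ('d _ _ v); apply/funext => y.
  by rewrite -act_point.
split.
- split.
  + by move=> t p it; rewrite -[p]hpoint_hcoord action_hpoint ?hcoord_neq0 // rotate_integral.
  + move=> s t p; rewrite -[p]hpoint_hcoord !action_hpoint ?rotate_nz ?hcoord_neq0 //.
    by rewrite rotateD.
  + apply: msmooth_full; first exact: prod_full (@euclid_full R n) fP.
    move=> [[] i] j.
    have H x : proj_action (point ((tt, i) : chart (prod_mfd (euclid n) P)) x).1
        (point ((tt, i) : chart (prod_mfd (euclid n) P)) x).2
      = hpoint (rotate (lsubmx x) (affine_rep i (rsubmx x))) by rewrite -act_point.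
    rewrite (_ : (fun x => coord j _) = fun x => coord j (hpoint (rotate (lsubmx x) (affine_rep i (rsubmx x))))).
      rewrite (_ : [set x | _] = [set x | dom j (hpoint (rotate (lsubmx x) (affine_rep i (rsubmx x))))]).
        apply: lift_smooth => [x|k]; first by rewrite rotate_nz ?affine_rep_neq0.
        rewrite (_ : (fun x => _) = fun x => phase (lsubmx x) k * affine_rep i (rsubmx x) 0 k); last first.
          by apply/funext => x; rewrite mxE.
        apply: csmoothM; first exact: openT.
          apply: csmooth_phase; first exact: openT.
          by apply: smooth_linear; exact: lsubmx_is_linear.
        apply: (csmooth_comp (Z := fun x => affine_rep i x 0 k)); [exact: openT| |exact: affine_rep_csmooth].
        by apply: smooth_linear; exact: rsubmx_is_linear.
      by apply/funext => x; rewrite /mkset H.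
    by apply/funext => x; rewrite H.
- move=> t; apply: msmooth_full => // i j.
  rewrite (_ : (fun x => _) = fun x => coord j (hpoint (rotate t (affine_rep i x)))); last first.
    by apply/funext => x; rewrite act_point.
  rewrite (_ : [set x | _] = [set x | dom j (hpoint (rotate t (affine_rep i x)))]); last first.
    by apply/funext => x; rewrite /mkset act_point.
  by apply: lift_smooth.
- move=> t p v; rewrite !mdiffE actE.
  apply: lift_cpx => [x|k|]; [exact: Zrot|exact: ZrotD|].
  by rewrite -rotateZ -daffine_rep_i.
- move=> t p v w; rewrite !mdiffE actE.
  apply: etrans (lift_met (Zrot _ t) (ZrotD _ t _) v w) _.
  by rewrite fubini_study_rotate.
Qed.

(** If all coordinates are nonzero, a fixing rotation has all phases equal to
    that of the last coordinate, which is 1. *)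
Lemma proj_free (p : P) :
  free_locus (@proj_action R n) p <-> forall k, hcoord p 0 k != 0.
Proof.
rewrite -{1}[p]hpoint_hcoord; set z := hcoord p; have z0 : z != 0 := hcoord_neq0 p.
rewrite /free_locus /mkset; split=> [H k|H t].
  apply/eqP => zk.
  (* A half period in one coordinate acts by a sign there, so it fixes points
     with a zero in that coordinate; if the last coordinate is zero, half
     periods in all the others act by the scalar -1. *)
  have half (t : 'rV[R]_n) j : t 0 j = 2^-1 -> ~ integral t.
    move=> tj /(_ j); rewrite tj => /cis_int; rewrite cis_neqN1 => /eqP.
    by rewrite eq_sym -subr_eq0 opprK -(natrD _ 1 1) pnatr_eq0.
  move: zk; case: (unliftP ord_max k) => [j ->|->] zk.
    apply: (half (2^-1 *: delta_mx 0 j) j); first by rewrite !mxE !eqxx mulr1.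
    apply: H; rewrite action_hpoint //; congr hpoint; apply/rowP => l; rewrite mxE.
    have [->|lj] := eqVneq l (lift ord_max j); first by rewrite zk mulr0.
    rewrite /phase; case: unliftP lj => [i ->|->] lj; last by rewrite mul1r.
    rewrite (inj_eq lift_inj) in lj.
    have -> : (2^-1 *: delta_mx 0 j : 'rV[R]_n) 0 i = 0 by rewrite !mxE eqxx (negPf lj) mulr0.
    by rewrite mulr0 cis0 mul1r.
  have /rV0Pn[k' zk'] := z0.
  case: (unliftP ord_max k') zk' => [j ->|->] zk'; last by rewrite zk eqxx in zk'.
  apply: (half (const_mx 2^-1) j); first by rewrite mxE.
  apply: H; rewrite action_hpoint // -[RHS](hpointZ (c := -1)) ?oppr_eq0 ?oner_neq0 //.
  congr hpoint; apply/rowP => l; rewrite !mxE /phase.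
  case: unliftP => [i _|->]; last by rewrite zk !mulr0.
  by rewrite mxE cis_neqN1.
rewrite action_hpoint // => E.
have [c c0 Ec] := hpoint_inj (rotate_nz t z0) z0 E.
have ck k : c * phase t k = 1.
  have := congr1 (fun w : 'rV[C]_n.+1 => w 0 k) Ec; rewrite /= !mxE mulrA => Ek.
  by apply: (mulIf (H k)); rewrite mul1r -Ek.
have c1 : c = 1 by have := ck ord_max; rewrite /phase unlift_none mulr1.
move=> j; apply: cis_eq1; have := ck (lift ord_max j).
by rewrite c1 mul1r /phase liftK.
Qed.

End ProjectiveAction.

(** * The toric cover of projective space *)

Section ToricLift.
Context {R : realType} {n : nat}.
Local Notation C := (R[i]).
Local Notation Re := complex.Re.
Local Notation Im := complex.Im.
Local Notation P := (@proj_mfd R n).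

(** The vector [exp ((theta_k + i y_k) / 2)] for [x = (theta, y)], with the
    convention [theta_n = y_n = 0] that [stat] encodes. *)
Definition toric_vec (x : 'rV[R]_(n + n)) : 'rV[C]_n.+1 :=
  \row_k ((expR (dot (lsubmx x) (stat k) / 2))%:C%C * cis (dot (rsubmx x) (stat k) / 2)).

(** The logarithmic derivative of the [k]-th entry of [toric_vec] along [v]. *)
Definition log_diff (v : 'rV[R]_(n + n)) (k : 'I_n.+1) : C :=
  (dot (lsubmx v) (stat k) / 2 +i* (dot (rsubmx v) (stat k) / 2))%C.

Definition toric_dvec (x v : 'rV[R]_(n + n)) : 'rV[C]_n.+1 :=
  \row_k (toric_vec x 0 k * log_diff v k).

Lemma toric_vec_last x : toric_vec x 0 ord_max = 1.
Proof. by rewrite mxE !dot_stat unlift_none mul0r expR0 cis0 mulr1. Qed.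

Lemma toric_vec_lift x j : toric_vec x 0 (lift ord_max j)
  = (expR (lsubmx x 0 j / 2))%:C%C * cis (rsubmx x 0 j / 2).
Proof. by rewrite mxE !dot_stat liftK. Qed.

Lemma exp_cis_neq0 (r y : R) : (expR r)%:C%C * cis y != 0.
Proof. by rewrite mulf_neq0 ?cis_neq0 // (inj_eq (@complexI R) _ 0) gt_eqF ?expR_gt0. Qed.

Lemma toric_vec_entry_neq0 x k : toric_vec x 0 k != 0.
Proof. by rewrite mxE exp_cis_neq0. Qed.

Lemma toric_vec_neq0 x : toric_vec x != 0.
Proof. by apply/rV0Pn; exists ord0; exact: toric_vec_entry_neq0. Qed.

Lemma ldot_linear (w : 'rV[R]_n) : linear (fun x : 'rV[R]_(n + n) => dot (lsubmx x) w / 2 : R).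
Proof. by move=> k a b; rewrite lsubmx_is_linear dot_is_linear mulrDl -mulrA. Qed.

Lemma rdot_linear (w : 'rV[R]_n) : linear (fun x : 'rV[R]_(n + n) => dot (rsubmx x) w / 2 : R).
Proof. by move=> k a b; rewrite rsubmx_is_linear dot_is_linear mulrDl -mulrA. Qed.

Lemma toric_vec_csmooth k : csmooth setT (fun x => toric_vec x 0 k).
Proof.
rewrite (_ : (fun x => _) = fun x : 'rV[R]_(n + n) =>
  (expR (dot (lsubmx x) (stat k) / 2))%:C%C * cis (dot (rsubmx x) (stat k) / 2)); last first.
  by apply/funext => x; rewrite mxE.
have oT := @openT ('rV[R]_(n + n)).
apply: csmoothM => //.
  split; last exact: smooth_cst.
  by apply: smooth_expR => //; apply: smooth_linear; exact: ldot_linear.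
by apply: csmooth_cis => //; apply: smooth_linear; exact: rdot_linear.
Qed.

Lemma toric_vec_has_cdiff x k :
  has_cdiff (fun y => toric_vec y 0 k) x (fun v => toric_dvec x v 0 k).
Proof.
have lD := has_diff_linear x (ldot_linear (stat k)).
have rD := has_diff_linear x (rdot_linear (stat k)).
have eD := has_diff_real lD (is_derive_expR _).
have cD := has_diff_real rD (is_derive_cos _).
have sD := has_diff_real rD (is_derive_sin _).
have ED : has_cdiff (fun y : 'rV[R]_(n + n) => (expR (dot (lsubmx y) (stat k) / 2))%:C%C) x
   (fun v => (expR (dot (lsubmx x) (stat k) / 2) * (dot (lsubmx v) (stat k) / 2))%:C%C).
  by split=> //; exact: has_diff_cst.
have CD : has_cdiff (fun y : 'rV[R]_(n + n) => cis (dot (rsubmx y) (stat k) / 2)) x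
   (fun v => (- sin (dot (rsubmx x) (stat k) / 2) * (dot (rsubmx v) (stat k) / 2)
     +i* (cos (dot (rsubmx x) (stat k) / 2) * (dot (rsubmx v) (stat k) / 2)))%C) by split.
have := has_cdiffM ED CD.
rewrite (_ : (fun y => _ * _) = fun y => toric_vec y 0 k); last first.
  by apply/funext => y; rewrite [RHS]mxE.
move=> /has_cdiff_ext; apply => v; rewrite [RHS]mxE [toric_vec _ _ _]mxE.
by apply: complex_ext; rewrite !ReIm /=; ring.
Qed.

Lemma log_diff_i v k : log_diff (mul_i v) k = 'i%C * log_diff v k.
Proof.
rewrite /log_diff /mul_i row_mxKl row_mxKr -scaleN1r dotZl.
by apply: complex_ext; rewrite !ReIm /=; ring.
Qed.

Lemma toric_dvec_i x v : toric_dvec x (mul_i v) = 'i%C *: toric_dvec x v.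
Proof. by apply/rowP => k; rewrite !mxE log_diff_i mulrCA. Qed.

(** The square modulus of the entry [k] of [toric_vec], and an unnormalized
    probability. *)
Definition weight (theta : 'rV[R]_n) (k : 'I_n.+1) : R := expR (dot theta (stat k)).
Definition total (theta : 'rV[R]_n) : R := \sum_k weight theta k.
Definition expect (theta : 'rV[R]_n) (f : 'I_n.+1 -> R) : R :=
  \sum_k weight theta k / total theta * f k.

Lemma conjcM (u w : C) : conjc (u * w) = conjc u * conjc w.
Proof. exact: rmorphM. Qed.

Lemma toric_vec_norm x k : toric_vec x 0 k * (toric_vec x 0 k)^*%C = (weight (lsubmx x) k)%:C%C.
Proof.
rewrite mxE conjcM conjc_real mulrACA cis_conj mulr1.
by rewrite -(rmorphM (real_complex R)) -expRD -splitr.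
Qed.

(** The phases cancel, and the square moduli are the weights by
    [toric_vec_norm]. *)
Lemma hdot_weighted x (f g : 'I_n.+1 -> C) :
  hdot (\row_k (toric_vec x 0 k * f k)) (\row_k (toric_vec x 0 k * g k))
    = \sum_k (weight (lsubmx x) k)%:C%C * (f k * (g k)^*%C).
Proof.
by apply: eq_bigr => k _; rewrite [X in X * _]mxE [X in _ * conjc X]mxE conjcM mulrACA toric_vec_norm.
Qed.

(** The vectors [toric_dvec x v] and [toric_dvec x w] are entrywise multiples of
    [toric_vec x] by [(a + i b) / 2] and [(c + i d) / 2]. So the Fubini-Study
    form is four times the real part of a covariance of complex functions, and
    the factor 4 cancels the two halves. *)
Lemma fubini_study_toric x v w :
  let a k := dot (lsubmx v) (stat k) in let b k := dot (rsubmx v) (stat k) in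
  let c k := dot (lsubmx w) (stat k) in let d k := dot (rsubmx w) (stat k) in
  fubini_study (toric_vec x) (toric_dvec x v) (toric_dvec x w)
    = expect (lsubmx x) (fun k => a k * c k) - expect (lsubmx x) a * expect (lsubmx x) c
      + (expect (lsubmx x) (fun k => b k * d k) - expect (lsubmx x) b * expect (lsubmx x) d).
Proof.
move=> a b c d.
have Z1 : toric_vec x = \row_k (toric_vec x 0 k * 1).
  by apply/rowP => k; rewrite [RHS]mxE mulr1.
have HS : hdot (toric_vec x) (toric_vec x) = (total (lsubmx x))%:C%C.
  rewrite {1 2}Z1 hdot_weighted /total rmorph_sum; apply: eq_bigr => k _.
  by rewrite conjc1 !mulr1.
have ED (f : 'I_n.+1 -> C) : (\sum_k (weight (lsubmx x) k)%:C%C * f k) / (total (lsubmx x))%:C%C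
    = (expect (lsubmx x) (fun k => Re (f k)) +i* expect (lsubmx x) (fun k => Im (f k)))%C.
  rewrite -fmorphV mulr_suml; apply: complex_ext; rewrite ?cRe_sum ?cIm_sum /= /expect;
    by apply: eq_bigr => k _; rewrite !ReIm /=; ring.
rewrite /fubini_study HS.
have -> : hdot (toric_dvec x v) (toric_dvec x w) / (total (lsubmx x))%:C%C
    - hdot (toric_dvec x v) (toric_vec x) * hdot (toric_vec x) (toric_dvec x w) / (total (lsubmx x))%:C%C ^+ 2
  = (\sum_k (weight (lsubmx x) k)%:C%C * (log_diff v k * (log_diff w k)^*%C)) / (total (lsubmx x))%:C%C
    - (\sum_k (weight (lsubmx x) k)%:C%C * log_diff v k) / (total (lsubmx x))%:C%C
      * ((\sum_k (weight (lsubmx x) k)%:C%C * (log_diff w k)^*%C) / (total (lsubmx x))%:C%C).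
  have -> : hdot (toric_dvec x v) (toric_vec x) = \sum_k (weight (lsubmx x) k)%:C%C * log_diff v k.
    rewrite [X in hdot _ X]Z1 hdot_weighted.
    by apply: eq_bigr => k _; rewrite conjc1 mulr1.
  have -> : hdot (toric_vec x) (toric_dvec x w) = \sum_k (weight (lsubmx x) k)%:C%C * (log_diff w k)^*%C.
    rewrite [X in hdot X _]Z1 hdot_weighted.
    by apply: eq_bigr => k _; rewrite mul1r.
  by rewrite /toric_dvec hdot_weighted expr2 invfM; ring.
rewrite !ED !ReIm /=.
have h2 (f : 'I_n.+1 -> R) (q : R) : expect (lsubmx x) (fun k => f k * q) = expect (lsubmx x) f * q.
  by rewrite /expect mulr_suml; apply: eq_bigr => k _; rewrite mulrA.
have hN (f : 'I_n.+1 -> R) : expect (lsubmx x) (fun k => - f k) = - expect (lsubmx x) f.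
  by rewrite /expect -sumrN; apply: eq_bigr => k _; rewrite mulrN.
have hD (f g : 'I_n.+1 -> R) : expect (lsubmx x) (fun k => f k + g k) = expect (lsubmx x) f + expect (lsubmx x) g.
  by rewrite /expect -big_split; apply: eq_bigr => k _; rewrite mulrDr.
have -> : expect (lsubmx x) (fun k => Re (log_diff v k * (log_diff w k)^*%C))
   = (expect (lsubmx x) (fun k => a k * c k) + expect (lsubmx x) (fun k => b k * d k)) * 4^-1.
  rewrite -hD -h2; apply: eq_bigr => k _; congr (_ * _).
  by rewrite !ReIm /= /a /b /c /d; field.
have -> : expect (lsubmx x) (fun k => Re (log_diff v k)) = expect (lsubmx x) a / 2 by rewrite -h2.
have -> : expect (lsubmx x) (fun k => Im (log_diff v k)) = expect (lsubmx x) b / 2 by rewrite -h2.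
have -> : expect (lsubmx x) (fun k => Re (log_diff w k)^*%C) = expect (lsubmx x) c / 2.
  by rewrite -h2; apply: eq_bigr => k _; rewrite cReJ.
have -> : expect (lsubmx x) (fun k => Im (log_diff w k)^*%C) = - (expect (lsubmx x) d / 2).
  by rewrite -h2 -hN; apply: eq_bigr => k _; rewrite cImJ.
by field.
Qed.

Section Simplex.
Variable T : ordered_set n.

Lemma sum_rank (F : 'I_n.+1 -> R) : \sum_(x : T) F (rank x) = \sum_k F k.
Proof.
rewrite (reindex (elt T)) /=; last first.
  by exists (@rank n T) => [k _|x _]; [exact: eltK|exact: rankK].
by apply: eq_bigr => k _; rewrite eltK.
Qed.

Lemma simplex_par_weight theta (x : T) :
  @par R n (simplex T) theta x = weight theta (rank x) / total theta.
Proof. by rewrite (exp_par (simplex_exp_family T)) (sum_rank (weight theta)). Qed.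

Lemma simplex_mean theta v :
  mean (E := simplex T) (@simplex_stat R n T) theta v = expect theta (fun k => dot v (stat k)).
Proof.
rewrite /expect -(sum_rank (fun k => weight theta k / total theta * dot v (stat k))).
by apply: eq_bigr => x _; rewrite simplex_par_weight.
Qed.

Lemma simplex_cov theta v w : cov (E := simplex T) (@simplex_stat R n T) theta v w
  = expect theta (fun k => dot v (stat k) * dot w (stat k))
    - expect theta (fun k => dot v (stat k)) * expect theta (fun k => dot w (stat k)).
Proof.
rewrite -!simplex_mean /expect.
rewrite -(sum_rank (fun k => weight theta k / total theta * (dot v (stat k) * dot w (stat k)))).
set mv := mean _ _ v; set mw := mean _ _ w; rewrite /cov -/mv -/mw.
transitivity (\sum_(x : T) (@par R n (simplex T) theta x * (dot v (@simplex_stat R n T x) * dot w (@simplex_stat R n T x))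
  - (mw * (@par R n (simplex T) theta x * dot v (@simplex_stat R n T x))
  + mv * (@par R n (simplex T) theta x * dot w (@simplex_stat R n T x)) - mv * mw * @par R n (simplex T) theta x))).
  by apply: eq_bigr => x _; ring.
rewrite sumrB sumrB big_split /= -!mulr_sumr (par_sum (simplex_exp_family T)).
rewrite [X in mw * X](_ : _ = mv) // [X in _ + mv * X - _](_ : _ = mw) //.
under [in RHS]eq_bigr do rewrite -simplex_par_weight.
set A := (X in X - _ = _); set B := (X in _ = X - _); have -> : B = A by [].
by ring.
Qed.

End Simplex.

(** Half of [4 pi t] is the phase of the action. *)
Lemma toric_vec_action x t :
  toric_vec (x + row_mx 0 ((4 * pi) *: t)) = rotate t (toric_vec x).
Proof.
apply/rowP => k; rewrite [RHS]mxE; case: (unliftP ord_max k) => [j ->|->].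
  rewrite !toric_vec_lift /phase liftK mulrCA -cisD.
  have -> : lsubmx (x + row_mx 0 ((4 * pi) *: t)) = lsubmx x.
    by rewrite linearD /= row_mxKl addr0.
  have -> : rsubmx (x + row_mx 0 ((4 * pi) *: t)) 0 j = 4 * pi * t 0 j + rsubmx x 0 j.
    by rewrite linearD /= row_mxKr addrC [LHS]mxE [in LHS]mxE.
  by rewrite mulrDl; congr (_ * cis (_ + _)); field.
by rewrite !toric_vec_last /phase unlift_none mulr1.
Qed.

End ToricLift.

Section ProjectiveToricCover.
Context {R : realType} {n : nat}.
Local Notation C := (R[i]).
Local Notation Re := complex.Re.
Local Notation Im := complex.Im.
Local Notation P := (@proj_mfd R n).

Definition toric_point (x : 'rV[R]_(n + n)) : CP R n := hpoint (toric_vec x).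

Lemma scalerowE (K : nzRingType) k (c : K) (z : 'rV[K]_k) j : (c *: z) 0 j = c * z 0 j.
Proof. by rewrite mxE. Qed.

Lemma toric_point_fibre x x' : toric_point x = toric_point x' ->
  exists k : 'rV[int]_n, x' = x + row_mx 0 ((4 * pi) *: map_mx intr k).
Proof.
move=> /(hpoint_inj (toric_vec_neq0 x) (toric_vec_neq0 x'))[c c0 E].
have c1 : c = 1.
  by have := congr1 (fun z : 'rV[C]_n.+1 => z 0 ord_max) E; rewrite scalerowE !toric_vec_last mulr1.
rewrite c1 scale1r in E.
have Ej j := congr1 (fun z : 'rV[C]_n.+1 => z 0 (lift ord_max j)) E.
have ER : lsubmx x' = lsubmx x.
  apply/rowP => j; have := congr1 (fun u => u * conjc u) (Ej j).
  rewrite /= !toric_vec_norm /weight !dot_stat liftK => -[] /expR_inj //.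
have EI j : (rsubmx x' 0 j - rsubmx x 0 j) / (4 * pi) \is a Num.int.
  apply: cis_eq1; have := Ej j; rewrite /= !toric_vec_lift ER => /mulfI.
  have -> : (expR (lsubmx x 0 j / 2))%:C%C != 0.
    by rewrite (inj_eq (@complexI R) _ 0) gt_eqF ?expR_gt0.
  move=> /(_ isT) Ec.
  have p0 : pi != 0 :> R by rewrite gt_eqF ?pi_gt0.
  have -> : 2 * pi * ((rsubmx x' 0 j - rsubmx x 0 j) / (4 * pi)) = rsubmx x' 0 j / 2 + - (rsubmx x 0 j / 2).
    by move: p0; move: (pi : R) => q q0; field.
  by rewrite cisD Ec -cisD addrN cis0.
exists (\row_j Num.floor ((rsubmx x' 0 j - rsubmx x 0 j) / (4 * pi))).
set k := (\row__ _).
rewrite -[LHS]hsubmxK -{1}(hsubmxK x) add_row_mx addr0 ER; congr row_mx.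
apply/rowP => j.
have -> : (rsubmx x + (4 * pi) *: map_mx intr k) 0 j = rsubmx x 0 j + 4 * pi * (k 0 j)%:~R.
  by rewrite [LHS]mxE; congr (_ + _); rewrite scalerowE [X in _ * X]mxE.
rewrite [k 0 j]mxE floorK //.
have p0 : pi != 0 :> R by rewrite gt_eqF ?pi_gt0.
by move: p0; move: (pi : R) => q q0; field.
Qed.

Lemma toric_point_range : range toric_point = free_locus (@proj_action R n).
Proof.
apply/seteqP; split=> [_ [x _ <-]|p].
  apply/proj_free => k; rewrite /toric_point.
  have [c c0 ->] := hcoord_hpoint (toric_vec_neq0 x).
  by rewrite scalerowE mulf_neq0 // toric_vec_entry_neq0.
move=> /proj_free H; pose z := hcoord p; have z0 : z != 0 := hcoord_neq0 p.
have pol j : exists ry : R * R, z 0 (lift ord_max j) / z 0 ord_max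
    = (expR (ry.1 / 2))%:C%C * cis (ry.2 / 2).
  have [|r [y E]] := @polar R (z 0 (lift ord_max j) / z 0 ord_max).
    by rewrite mulf_neq0 ?invr_neq0 // H.
  by exists (r, y).
pose f j := projT1 (cid (pol j)); have fP j := projT2 (cid (pol j)).
exists (row_mx (\row_j (f j).1) (\row_j (f j).2)) => //.
rewrite -[p]hpoint_hcoord -/z -(hpointZ (c := (z 0 ord_max)^-1)) ?invr_neq0 ?H //.
congr hpoint; apply/rowP => k; rewrite scalerowE.
case: (unliftP ord_max k) => [j ->|->]; last by rewrite toric_vec_last mulVf ?H.
by rewrite [RHS]mulrC fP toric_vec_lift row_mxKl row_mxKr !mxE.
Qed.

Lemma open_forall m (U0 : set 'rV[R]_m) (Q : 'I_n -> 'rV[R]_m -> Prop) : open U0 ->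
  (forall j, open [set y | U0 y /\ Q j y]) -> open [set y | U0 y /\ forall j, Q j y].
Proof.
move=> oU oQ; rewrite openE => y [Uy Qy].
have N := open_nbhs_nbhs (conj oU Uy).
have H : \forall y' \near y, forall j, Q j y'.
  apply: (@filter_forall _ _ Q (nbhs y)) => j.
  have : nbhs y [set y | U0 y /\ Q j y] by apply: open_nbhs_nbhs; split=> //; split.
  by apply: filterS => y' [].
exact: (filterI N H).
Qed.

(** The affine coordinates at [y], divided by those at the base point, are close
    to 1; their principal logarithm is the displacement in [(theta, y)]. *)
Lemma toric_point_section x0 (i : chart P) : dom i (toric_point x0) ->
  exists (U : set 'rV[R]_(n + n)) (s : 'rV[R]_(n + n) -> 'rV[R]_(n + n)),
    [/\ open U, U (coord i (toric_point x0)), smooth U s,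
      s (coord i (toric_point x0)) = x0 & forall y, U y -> toric_point (s y) = point i y].
Proof.
move=> ix0; set y0 := coord i (toric_point x0).
have E0 : hpoint (affine_rep i y0) = hpoint (toric_vec x0).
  by rewrite -point_hpoint pointK //; exact: proj_full.
have [c c0 Ec] := hpoint_inj (toric_vec_neq0 x0) (affine_rep_neq0 i y0) (esym E0).
pose W j y : C := affine_rep i y 0 (lift ord_max j) / affine_rep i y 0 ord_max.
have W0 j : W j y0 = toric_vec x0 0 (lift ord_max j).
  by rewrite /W Ec !scalerowE toric_vec_last mulr1 mulrC mulKf.
(* [W] gives affine coordinates around the last one, and [u] those relative to
   the base point. *)
pose u j y := W j y / toric_vec x0 0 (lift ord_max j).
pose U0 : set 'rV[R]_(n + n) := [set y | setT y /\ affine_rep i y 0 ord_max != 0].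
have oU0 : open U0 by apply: csmooth_neq0_open; [exact: openT|exact: affine_rep_csmooth].
have uC j : csmooth U0 (u j).
  have SC k : csmooth U0 (fun y => affine_rep i y 0 k).
    by have [H K] := affine_rep_csmooth i k; split; [apply: smooth_sub H|apply: smooth_sub K].
  apply: csmooth_div => //; last by move=> y _; exact: toric_vec_entry_neq0.
    by apply: csmooth_div => // y [].
  exact: csmooth_cst.
pose U : set 'rV[R]_(n + n) := [set y | U0 y /\ forall j, 0 < Re (u j y)].
have oU : open U.
  by apply: open_forall => // j; apply: open_superlevel => //; exact: (uC j).1.
have UU0 : U `<=` U0 by move=> y [].
pose s y : 'rV[R]_(n + n) := x0 + row_mx
  (\row_j ln (Re (u j y) ^+ 2 + Im (u j y) ^+ 2)) (\row_j (2 * atan (Im (u j y) / Re (u j y)))).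
have u1 j : u j y0 = 1 by rewrite /u W0 divff // toric_vec_entry_neq0.
exists U, s; split=> //.
- split; last by move=> j; rewrite u1.
  by split=> //; rewrite Ec mxE mulf_neq0 // toric_vec_entry_neq0.
- apply: smoothD => //; first exact: smooth_cst.
  have RC j : smooth U (fun y => Re (u j y)) by apply: smooth_sub (uC j).1.
  have IC j : smooth U (fun y => Im (u j y)) by apply: smooth_sub (uC j).2.
  apply: smooth_row_mx => //; apply: smooth_row => // j.
    apply: (@smooth_eq _ _ _ _ (fun y => ln (Re (u j y) ^+ 2 + Im (u j y) ^+ 2))) => //.
      by move=> y _; rewrite mxE.
    apply: smooth_ln => //; first by apply: smoothD => //; exact: smoothX.
    by move=> y [_ /(_ j) Hj]; rewrite ltr_pwDl ?exprn_gt0 // sqr_ge0.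
  apply: (@smooth_eq _ _ _ _ (fun y => 2 * atan (Im (u j y) / Re (u j y)))) => //.
    by move=> y _; rewrite mxE.
  apply: smoothM => //; first exact: smooth_cst.
  apply: smooth_atan => //; apply: smoothM => //; apply: smoothV => //.
  by move=> y [_ /(_ j) Hj]; rewrite gt_eqF.
- rewrite /s (_ : row_mx _ _ = 0) ?addr0 //; rewrite -[RHS](row_mx0 _ 1 n n).
  congr row_mx; apply/rowP => j; rewrite !mxE u1 /=.
    by rewrite expr0n addr0 expr1n ln1.
  by rewrite mul0r atan0 mulr0.
- move=> y [[_ ym] Hu]; rewrite point_hpoint -/(affine_rep i y) /toric_point.
  rewrite -[RHS](hpointZ (c := (affine_rep i y 0 ord_max)^-1)) ?invr_neq0 ?affine_rep_neq0 //.
  congr hpoint; apply/rowP => k; rewrite scalerowE.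
  case: (unliftP ord_max k) => [j ->|->]; last by rewrite toric_vec_last mulVf.
  rewrite mulrC -/(W j y) toric_vec_lift.
  have -> : W j y = toric_vec x0 0 (lift ord_max j) * u j y.
    by rewrite /u mulrC divfK // toric_vec_entry_neq0.
  rewrite toric_vec_lift -(exp_cis_log (Hu j)) mulrACA -cisD -(rmorphM (real_complex R)) -expRD.
  have -> : lsubmx (s y) 0 j = lsubmx x0 0 j + ln (Re (u j y) ^+ 2 + Im (u j y) ^+ 2).
    by rewrite /s linearD /= row_mxKl [LHS]mxE; congr (_ + _); rewrite mxE.
  have -> : rsubmx (s y) 0 j = rsubmx x0 0 j + 2 * atan (Im (u j y) / Re (u j y)).
    by rewrite /s linearD /= row_mxKr [LHS]mxE; congr (_ + _); rewrite mxE.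
  congr ((expR _)%:C%C * cis _); first exact: mulrDl.
  by rewrite mulrDl; congr (_ + _); rewrite mulrC mulKf.
Qed.

Variable T : ordered_set n.

Lemma proj_toric_cover :
  toric_cover (cov (E := simplex T) (@simplex_stat R n T)) (@proj_action R n) toric_point.
Proof.
split.
- move=> j; exact: (lift_smooth (@toric_vec_neq0 R n) (@toric_vec_csmooth R n) j).
- exact: toric_point_fibre.
- exact: toric_point_range.
- exact: toric_point_section.
- move=> x v f.
  exact: (lift_cpx (@toric_vec_neq0 R n) (toric_vec_has_cdiff x) (toric_dvec_i x v)).
- move=> x v w f.
  apply: etrans (lift_met (@toric_vec_neq0 R n) (toric_vec_has_cdiff x) v w) _.
  by rewrite fubini_study_toric !simplex_cov.
- move=> x t; rewrite /toric_point toric_vec_action action_hpoint //.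
  exact: toric_vec_neq0.
Qed.

End ProjectiveToricCover.

(** * Products of torus actions and of toric covers *)

Lemma msmooth_fullE (R : realType) d d' (M : mfd R d) (M' : mfd R d') (f : M -> M') :
  full_charts M -> msmooth f -> forall (i : chart M) (j : chart M'),
    open [set x | dom j (f (point i x))] /\
    smooth [set x | dom j (f (point i x))] (fun x => coord j (f (point i x))).
Proof.
by move=> fM H i j; have := H i j => /=; rewrite -setIA image_dom // setTI.
Qed.

Lemma mdiff_has_diff (R : realType) d d' (M : mfd R d) (M' : mfd R d') (f : M -> M') (p : M) :
  full_charts M -> dom (prefer p) p -> dom (prefer (f p)) (f p) -> msmooth f ->
  has_diff (fun x => coord (prefer (f p)) (f (point (prefer p) x))) (coord (prefer p) p) (mdiff f p).
Proof.
move=> fM pp fp fC; have [_ H] := msmooth_fullE fM fC (prefer p) (prefer (f p)).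
by apply: (smooth_has_diff H); rewrite /mkset pointK.
Qed.

Section Shuffle.
Context {R : realType} {a b c d : nat}.

(** The coordinates [((theta, theta'), (y, y'))] of the tangent bundle of a
    product are regrouped as [(theta, y)] and [(theta', y')]. *)
Definition left_part (x : 'rV[R]_((a + b) + (c + d))) : 'rV[R]_(a + c) :=
  row_mx (lsubmx (lsubmx x)) (lsubmx (rsubmx x)).
Definition right_part (x : 'rV[R]_((a + b) + (c + d))) : 'rV[R]_(b + d) :=
  row_mx (rsubmx (lsubmx x)) (rsubmx (rsubmx x)).
Definition join_parts (u : 'rV[R]_(a + c)) (w : 'rV[R]_(b + d)) : 'rV[R]_((a + b) + (c + d)) :=
  row_mx (row_mx (lsubmx u) (lsubmx w)) (row_mx (rsubmx u) (rsubmx w)).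

Lemma left_part_is_linear : linear left_part.
Proof.
by move=> k x y; rewrite /left_part !lsubmx_is_linear rsubmx_is_linear lsubmx_is_linear scale_row_mx add_row_mx.
Qed.

Lemma right_part_is_linear : linear right_part.
Proof.
by move=> k x y; rewrite /right_part !rsubmx_is_linear lsubmx_is_linear rsubmx_is_linear scale_row_mx add_row_mx.
Qed.

Lemma left_part_join u w : left_part (join_parts u w) = u.
Proof. by rewrite /left_part /join_parts !(row_mxKl, row_mxKr) hsubmxK. Qed.

Lemma right_part_join u w : right_part (join_parts u w) = w.
Proof. by rewrite /right_part /join_parts !(row_mxKl, row_mxKr) hsubmxK. Qed.

Lemma join_partsK x : join_parts (left_part x) (right_part x) = x.
Proof. by rewrite /left_part /right_part /join_parts !(row_mxKl, row_mxKr) !hsubmxK. Qed.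

Lemma lsubmx_left_part x : lsubmx (left_part x) = lsubmx (lsubmx x).
Proof. exact: row_mxKl. Qed.

Lemma rsubmx_left_part x : rsubmx (left_part x) = lsubmx (rsubmx x).
Proof. exact: row_mxKr. Qed.

Lemma lsubmx_right_part x : lsubmx (right_part x) = rsubmx (lsubmx x).
Proof. exact: row_mxKl. Qed.

Lemma rsubmx_right_part x : rsubmx (right_part x) = rsubmx (rsubmx x).
Proof. exact: row_mxKr. Qed.

Lemma smooth_join p (U : set 'rV[R]_p) f g : open U -> smooth U f -> smooth U g ->
  smooth U (fun x => join_parts (f x) (g x)).
Proof.
move=> oU fC gC.
have l1 := smooth_postcomp oU (@lsubmx_is_linear R a c) fC.
have l2 := smooth_postcomp oU (@rsubmx_is_linear R a c) fC.
have r1 := smooth_postcomp oU (@lsubmx_is_linear R b d) gC.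
have r2 := smooth_postcomp oU (@rsubmx_is_linear R b d) gC.
by apply: smooth_row_mx => //; exact: smooth_row_mx.
Qed.

Lemma open_parts (A : set 'rV[R]_(a + c)) (B : set 'rV[R]_(b + d)) : open A -> open B ->
  open [set x | A (left_part x) /\ B (right_part x)].
Proof.
move=> oA oB; apply: (@openI _ [set x | A (left_part x)] [set x | B (right_part x)]).
  exact: open_linear_preimage left_part_is_linear oA.
exact: open_linear_preimage right_part_is_linear oB.
Qed.

Lemma smooth_parts k l (A : set 'rV[R]_(a + c)) (B : set 'rV[R]_(b + d))
    (f : 'rV[R]_(a + c) -> 'rV[R]_k) (g : 'rV[R]_(b + d) -> 'rV[R]_l) :
  open A -> open B -> smooth A f -> smooth B g ->
  smooth [set x | A (left_part x) /\ B (right_part x)]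
    (fun x => row_mx (f (left_part x)) (g (right_part x))).
Proof.
move=> oA oB fC gC; have oAB := open_parts oA oB.
apply: smooth_row_mx => //.
  apply: (smooth_comp_row oAB oA _ _ fC); first by move=> x [].
  by apply: smooth_linear; exact: left_part_is_linear.
apply: (smooth_comp_row oAB oB _ _ gC); first by move=> x [].
by apply: smooth_linear; exact: right_part_is_linear.
Qed.

End Shuffle.

Section ProductAction.
Context {R : realType} {n n' d d' : nat} (N : herm R d) (N' : herm R d').
Context (Phi : 'rV[R]_n -> N -> N) (Phi' : 'rV[R]_n' -> N' -> N').
Hypotheses (kN : pre_kahler N) (kN' : pre_kahler N').

Let fN : full_charts N. Proof. by case: kN => -[]. Qed.
Let fN' : full_charts N'. Proof. by case: kN' => -[]. Qed.
Let mN : is_manifold N. Proof. by case: kN => -[_ []]. Qed.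
Let mN' : is_manifold N'. Proof. by case: kN' => -[_ []]. Qed.

Hypotheses (aN : kahler_action Phi) (aN' : kahler_action Phi').

Lemma mdiff_prod_action t (p : prod_herm N N') v : mdiff (prod_action Phi Phi' t) p v
  = row_mx (mdiff (Phi (lsubmx t)) p.1 (lsubmx v)) (mdiff (Phi' (rsubmx t)) p.2 (rsubmx v)).
Proof.
case: p => p p'; rewrite {1}/mdiff.
have := mdiff_has_diff fN (prefer_dom mN p) (prefer_dom mN (Phi (lsubmx t) p)) (action_smooth aN (lsubmx t)).
have := mdiff_has_diff fN' (prefer_dom mN' p') (prefer_dom mN' (Phi' (rsubmx t) p')) (action_smooth aN' (rsubmx t)).
rewrite -{1}(row_mxKl (coord (prefer p) p) (coord (prefer p') p')).
rewrite -{1}(row_mxKr (coord (prefer p) p) (coord (prefer p') p')) => D' D.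
have [_ E] := has_diff_row_mx (has_diff_lsubmx D) (has_diff_rsubmx D'); exact: (E v).
Qed.

Lemma prod_kahler_action : kahler_action (prod_action Phi Phi').
Proof.
have [T1 T2 T3] := action_torus aN; have [T1' T2' T3'] := action_torus aN'.
have fNN := prod_full fN fN'.
split.
- split.
  + move=> t [p p'] it; rewrite /prod_action T1 ?T1' // => i; rewrite mxE; exact: it.
  + by move=> s t [p p']; rewrite /prod_action !linearD /= T2 T2'.
  + apply: msmooth_full; first exact: prod_full (@euclid_full _ _) fNN.
    move=> [[] [i i']] [j j'].
    have [oL cL] := msmooth_fullE (prod_full (@euclid_full R n) fN) T3 (tt, i) j.
    have [oR cR] := msmooth_fullE (prod_full (@euclid_full R n') fN') T3' (tt, i') j'.
    split.
      have := open_parts oL oR; congr open; apply/funext => x.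
      rewrite /mkset /prod_action /=.
      by rewrite lsubmx_left_part rsubmx_left_part lsubmx_right_part rsubmx_right_part.
    have := smooth_parts oL oR cL cR.
    congr smooth; apply/funext => x.
      rewrite /mkset /prod_action /=.
      by rewrite lsubmx_left_part rsubmx_left_part lsubmx_right_part rsubmx_right_part.
    rewrite /prod_action /=.
    by rewrite lsubmx_left_part rsubmx_left_part lsubmx_right_part rsubmx_right_part.
- move=> t; apply: msmooth_full => // -[i i'] [j j'].
  have [oL cL] := msmooth_fullE fN (action_smooth aN (lsubmx t)) i j.
  have [oR cR] := msmooth_fullE fN' (action_smooth aN' (rsubmx t)) i' j'.
  by split; [exact: (open_prod_charts oL oR)|exact: (smooth_prod_charts oL oR cL cR)].
- move=> t [p p'] v; rewrite !mdiff_prod_action /= !row_mxKl !row_mxKr.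
  by rewrite (action_holo aN) (action_holo aN').
- move=> t [p p'] v w; rewrite !mdiff_prod_action /= !row_mxKl !row_mxKr.
  by rewrite (action_isom aN) (action_isom aN').
Qed.

(** A torus element acting on one factor only is extended by 0. *)
Lemma prod_free : free_locus (prod_action Phi Phi')
  = [set p | free_locus Phi p.1 /\ free_locus Phi' p.2].
Proof.
have [T1 _ _] := action_torus aN; have [T1' _ _] := action_torus aN'.
have i0 k : integral (0 : 'rV[R]_k) by move=> i; rewrite mxE; exact: int_num0.
apply/seteqP; split=> -[p p'] /= H; last first.
  move=> t [E E']; move: H => [/(_ _ E) it /(_ _ E') it'] i.
  by rewrite -[t]hsubmxK; case: (split_ordP i) => k ->; rewrite ?row_mxEl ?row_mxEr.
split=> t E.
  have := H (row_mx t 0); rewrite /prod_action /= row_mxKl row_mxKr E T1' //.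
  by move=> /(_ erefl) it i; have := it (lshift _ i); rewrite row_mxEl.
have := H (row_mx 0 t); rewrite /prod_action /= row_mxKl row_mxKr E T1 //.
by move=> /(_ erefl) it i; have := it (rshift _ i); rewrite row_mxEr.
Qed.

Context (g : 'rV[R]_n -> 'rV[R]_n -> 'rV[R]_n -> R) (g' : 'rV[R]_n' -> 'rV[R]_n' -> 'rV[R]_n' -> R).
Context (tau : 'rV[R]_(n + n) -> N) (tau' : 'rV[R]_(n' + n') -> N').
Hypotheses (tc : toric_cover g Phi tau) (tc' : toric_cover g' Phi' tau').

Definition prod_cover (x : 'rV[R]_((n + n') + (n + n'))) : prod_herm N N' :=
  (tau (left_part x), tau' (right_part x)).

Lemma prod_toric_cover : toric_cover
  (fun x v w => g (lsubmx x) (lsubmx v) (lsubmx w) + g' (rsubmx x) (rsubmx v) (rsubmx w))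
  (prod_action Phi Phi') prod_cover.
Proof.
have left_shift (x : 'rV[R]_((n + n') + (n + n'))) (t : 'rV[R]_(n + n')) :
    left_part (x + row_mx 0 t) = left_part x + row_mx 0 (lsubmx t).
  have := left_part_is_linear 1 x (row_mx 0 t); rewrite !scale1r => ->.
  by rewrite {2}/left_part row_mxKl row_mxKr linear0.
have right_shift (x : 'rV[R]_((n + n') + (n + n'))) (t : 'rV[R]_(n + n')) :
    right_part (x + row_mx 0 t) = right_part x + row_mx 0 (rsubmx t).
  have := right_part_is_linear 1 x (row_mx 0 t); rewrite !scale1r => ->.
  by rewrite {2}/right_part row_mxKl row_mxKr linear0.
have D x : let f := coord (prefer (prod_cover x)) \o prod_cover in forall v,
   'd f x v = row_mx ('d (coord (prefer (tau (left_part x))) \o tau) (left_part x) (left_part v))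
     ('d (coord (prefer (tau' (right_part x))) \o tau') (right_part x) (right_part v)).
  move=> f v.
  have [_ cL] := tc_smooth tc (prefer (tau (left_part x))).
  have [_ cR] := tc_smooth tc' (prefer (tau' (right_part x))).
  have D1 := has_diff_comp (has_diff_linear x (@left_part_is_linear R n n' n n'))
    (smooth_has_diff cL (prefer_dom mN _)).
  have D2 := has_diff_comp (has_diff_linear x (@right_part_is_linear R n n' n n'))
    (smooth_has_diff cR (prefer_dom mN' _)).
  by have [_ H] := has_diff_row_mx D1 D2; exact: (H v).
split.
- move=> [j j']; have [oL cL] := tc_smooth tc j; have [oR cR] := tc_smooth tc' j'.
  by split; [exact: (open_parts oL oR)|exact: (smooth_parts oL oR cL cR)].
- move=> x x' [/(tc_fibre tc)[k Ek] /(tc_fibre tc')[k' Ek']].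
  exists (row_mx k k'); rewrite -(join_partsK x') Ek Ek' map_row_mx scale_row_mx.
  rewrite -[RHS]join_partsK left_shift right_shift row_mxKl row_mxKr.
  by [].
- rewrite prod_free -(tc_range tc) -(tc_range tc').
  apply/seteqP; split=> [_ [x _ <-]|[p p'] [/= [y _ yp] [y' _ yp']]].
    by split; [exists (left_part x)|exists (right_part x)].
  by exists (join_parts y y') => //; rewrite /prod_cover left_part_join right_part_join yp yp'.
- move=> x0 [i i'] [ix ix'].
  have [U [s [oU Ux sC sx sE]]] := tc_section tc ix.
  have [U' [s' [oU' Ux' sC' sx' sE']]] := tc_section tc' ix'.
  exists [set y | U (lsubmx y) /\ U' (rsubmx y)], (fun y => join_parts (s (lsubmx y)) (s' (rsubmx y))).
  have oUU := open_prod_charts oU oU'; split=> //.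
  + by split; rewrite ?row_mxKl ?row_mxKr.
  + apply: smooth_join => //.
      apply: (smooth_comp_row oUU oU _ _ sC); first by move=> y [].
      by apply: smooth_linear; exact: lsubmx_is_linear.
    apply: (smooth_comp_row oUU oU' _ _ sC'); first by move=> y [].
    by apply: smooth_linear; exact: rsubmx_is_linear.
  + by rewrite -[RHS]join_partsK -sx -sx' /= row_mxKl row_mxKr.
  + by move=> y [Uy Uy']; rewrite /prod_cover left_part_join right_part_join sE // sE'.
- move=> x v f; rewrite !D /= !row_mxKl !row_mxKr -(tc_holo tc) -(tc_holo tc').
  congr row_mx; congr ('d _ _ _).
    by rewrite /left_part /mul_i !row_mxKl !row_mxKr linearN.
  by rewrite /right_part /mul_i !row_mxKl !row_mxKr linearN.
- move=> x v w f; rewrite !D /= !row_mxKl !row_mxKr.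
  have -> := tc_isom tc (left_part x) (left_part v) (left_part w).
  have -> := tc_isom tc' (right_part x) (right_part v) (right_part w).
  by rewrite !(lsubmx_left_part, lsubmx_right_part, rsubmx_left_part, rsubmx_right_part) addrACA.
- move=> x t; rewrite /prod_cover left_shift right_shift /prod_action /= !linearZ /=.
  by rewrite (tc_action tc) (tc_action tc').
Qed.

End ProductAction.

(** * Torifications from toric covers *)

Section Torification.
Context {R : realType} {n d : nat} (E : family R n) (a : outcomes E -> 'rV[R]_n).
Context (N : herm R d) (Phi : 'rV[R]_n -> N -> N) (tau : 'rV[R]_(n + n) -> N).
Hypotheses (eE : exp_family a) (n_gt0 : (0 < n)%N) (kN : pre_kahler N).
Hypotheses (nP : kahler_action Phi) (tc : toric_cover (cov a) Phi tau).

Let fN : full_charts N. Proof. by case: kN => -[]. Qed.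
Let Phi_per t p : integral t -> Phi t p = p. Proof. by case: (action_torus nP) => H _ _; exact: H. Qed.

(** The action is effective since the image of [tau] is a nonempty free
    locus. *)
Lemma torificationP : mconnected N -> d = (n + n)%N -> is_torification (family_affine E) Phi.
Proof.
move=> cN dE; split=> //.
- split; first exact: exp_dually_flat eE.
  exact: family_connected (exp_par_inj eE) (exp_surj eE).
- by split=> //; exact: kahler_of_pre.
- split; [exact: action_torus nP| |exact: action_holo nP|exact: action_isom nP].
  move=> t /(_ (tau 0)) Et.
  have : free_locus Phi (tau 0) by rewrite -(tc_range tc); exists 0.
  by move=> /(_ _ Et).
- exists (period_lattice (E := E)), (@period_fields _ _ E), (toric_map tau).
  exact (toric_parametrizationP eE n_gt0 fN Phi_per tc).
Qed.

Lemma cover_compatible : compatible_covering (M := family_affine E) Phi (fun u => tau (bundle_coord u)).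
Proof.
exists (period_lattice (E := E)), (@period_fields _ _ E), (toric_map tau).
split; first exact (toric_parametrizationP eE n_gt0 fN Phi_per tc).
by apply/funext => u; rewrite -(toric_mapE eE Phi_per tc).
Qed.

End Torification.

(** * The Segre embedding and the inclusion of product distributions *)

Section Segre.
Context {R : realType} {n m : nat}.
Local Notation C := (R[i]).

Lemma segre_vecZ (c c' : C) (z : 'rV[C]_n.+1) (w : 'rV[C]_m.+1) :
  segre_vec (c *: z) (c' *: w) = (c * c') *: segre_vec z w.
Proof. by apply/rowP => k; rewrite !mxE mulrACA. Qed.

Lemma segre_vec_nz (z : 'rV[C]_n.+1) (w : 'rV[C]_m.+1) : z != 0 -> w != 0 ->
  segre_vec z w != 0.
Proof. by move=> z0 w0; exact: (segre_vec_neq0 (exist _ z z0) (exist _ w w0)). Qed.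

Lemma segre_hpoint (z : 'rV[C]_n.+1) (w : 'rV[C]_m.+1) : z != 0 -> w != 0 ->
  segre ((hpoint z, hpoint w) : prod_herm (CP R n) (CP R m)) = hpoint (segre_vec z w).
Proof.
move=> z0 w0; rewrite /segre hpointE /=.
have [c c0 ->] := hcoord_hpoint z0; have [c' c'0 ->] := hcoord_hpoint w0.
by rewrite segre_vecZ hpointZ ?mulf_neq0 ?segre_vec_nz.
Qed.

(** The products of entries of the sections over two affine charts are
    homogeneous coordinates of the image. *)
Lemma segre_smooth : msmooth (@segre R n m).
Proof.
apply: msmooth_full; first exact: prod_full proj_full proj_full.
move=> [i i'] j.
have H x : segre (point ((i, i') : chart (prod_herm (CP R n) (CP R m))) x)
    = hpoint (segre_vec (affine_rep i (lsubmx x)) (affine_rep i' (rsubmx x))).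
  rewrite -segre_hpoint ?affine_rep_neq0 //; congr segre.
  by rewrite -[LHS]/(_, _); congr pair; exact: point_hpoint.
under eq_fun do rewrite H.
rewrite [X in smooth _ X](_ : _ = fun x => coord j (hpoint (segre_vec (affine_rep i (lsubmx x)) (affine_rep i' (rsubmx x)))));
  last by apply/funext => x; rewrite H.
apply: lift_smooth => [x|k]; first by rewrite segre_vec_nz ?affine_rep_neq0.
rewrite (_ : (fun x => _) = fun x => affine_rep i (lsubmx x) 0 (lex_pair k).1 * affine_rep i' (rsubmx x) 0 (lex_pair k).2); last first.
  by apply/funext => x; rewrite [LHS]mxE.
apply: csmoothM; first exact: openT.
  apply: (csmooth_comp (Z := fun x => affine_rep i x 0 (lex_pair k).1)); [exact: openT| |exact: affine_rep_csmooth].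
  by apply: smooth_linear; exact: lsubmx_is_linear.
apply: (csmooth_comp (Z := fun x => affine_rep i' x 0 (lex_pair k).2)); [exact: openT| |exact: affine_rep_csmooth].
by apply: smooth_linear; exact: rsubmx_is_linear.
Qed.

(** The probabilities of a product are products, so their logarithms add; the
    outcome that pairs the two last ones has parameter 0 again, by
    [lex_pair_max]. *)
Definition lex_natural (theta : 'rV[R]_(n + m)) : 'rV[R]_(lex_dim n m) :=
  \row_k (dot (lsubmx theta) (stat (lex_pair (lift ord_max k)).1)
        + dot (rsubmx theta) (stat (lex_pair (lift ord_max k)).2)).

Lemma lex_natural_is_linear : linear lex_natural.
Proof.
move=> c x y; apply/rowP => k; rewrite !mxE lsubmx_is_linear rsubmx_is_linear.
rewrite !dotDl !dotZl mulrDr; ring.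
Qed.

Lemma lex_pair_max : lex_pair ord_max = (ord_max : 'I_n.+1, ord_max : 'I_m.+1).
Proof.
rewrite -[RHS]lex_indexK; congr lex_pair; apply/val_inj.
apply: etrans (esym (lex_indexE ord_max ord_max)).
by rewrite /= /lex_dim mulSn [RHS]addnC.
Qed.

Lemma dot_lex_natural theta k : dot (lex_natural theta) (stat k)
  = dot (lsubmx theta) (stat (lex_pair k).1) + dot (rsubmx theta) (stat (lex_pair k).2).
Proof.
rewrite [LHS]dot_stat; case: (unliftP ord_max k) => [j ->|->]; first by rewrite mxE.
by rewrite lex_pair_max !dot_stat !unlift_none addr0.
Qed.

Lemma weight_lex theta k : weight (lex_natural theta) k
  = weight (lsubmx theta) (lex_pair k).1 * weight (rsubmx theta) (lex_pair k).2.
Proof. by rewrite /weight dot_lex_natural expRD. Qed.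

Lemma total_lex theta :
  total (lex_natural theta) = total (lsubmx theta) * total (rsubmx theta).
Proof.
rewrite /total (reindex lex_index); last first.
  by exists lex_pair => [ij _|k _]; [exact: lex_indexK|exact: lex_pairK].
rewrite (eq_bigr (fun ij => weight (lsubmx theta) ij.1 * weight (rsubmx theta) ij.2)); last first.
  by move=> ij _; rewrite weight_lex lex_indexK.
rewrite -(pair_bigA _ (fun i j => weight (lsubmx theta) i * weight (rsubmx theta) j)) /=.
by under eq_bigr do rewrite -mulr_sumr; rewrite -mulr_suml.
Qed.

(** Exponentials turn the sums of parameters into products of homogeneous
    coordinates: this is the commutation with the Segre embedding. *)
Lemma toric_vec_lex (x : 'rV[R]_((n + m) + (n + m))) :
  toric_vec (row_mx (lex_natural (lsubmx x)) (lex_natural (rsubmx x)))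
    = segre_vec (toric_vec (left_part x)) (toric_vec (right_part x)).
Proof.
apply/rowP => k; rewrite [RHS]mxE [LHS]mxE [toric_vec (left_part x) _ _]mxE.
rewrite [toric_vec (right_part x) _ _]mxE row_mxKl row_mxKr !dot_lex_natural.
rewrite lsubmx_left_part rsubmx_left_part lsubmx_right_part rsubmx_right_part.
rewrite !mulrDl cisD expRD (rmorphM (real_complex R)) /=; exact: mulrACA.
Qed.

Variables (S : ordered_set n) (T : ordered_set m).
Local Notation E := (@product_family R n m (simplex S) (simplex T)).
Local Notation E' := (@simplex R (lex_dim n m) (lex_product S T)).
Local Notation iota := (@inclusion n m S T R).

Let eE : exp_family (E := E) (product_stat (E := simplex S) (E' := simplex T) (@simplex_stat R n S) (@simplex_stat R m T)).
Proof. by apply: product_exp_family; exact: simplex_exp_family. Qed.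
Let eE' : exp_family (E := E') (@simplex_stat R _ (lex_product S T)) :=
  simplex_exp_family (lex_product S T).

(** Both the weights and their totals multiply. *)
Lemma inclusion_of_natural theta :
  iota (of_natural E theta) = of_natural E' (lex_natural theta).
Proof.
apply: eq_exist; apply/funext => -[x y].
apply: esym; apply: etrans (simplex_par_weight (T := lex_product S T) _ _) _.
rewrite -[RHS]/(@par R n (simplex S) (lsubmx theta) x * @par R m (simplex T) (rsubmx theta) y).
rewrite !simplex_par_weight weight_lex total_lex lex_indexK /=.
by rewrite invfM mulrACA.
Qed.

Lemma inclusion_coord : (coord (tt : chart (family_mfd E')) \o iota) \o point (tt : chart (family_mfd E))
  = lex_natural.
Proof.
apply/funext => theta; rewrite -[LHS]/(natural (iota (of_natural E theta))).
by rewrite inclusion_of_natural (of_naturalK eE').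
Qed.

Lemma inclusion_smooth : msmooth iota.
Proof.
apply: msmooth_full; first exact: family_full (exp_par_inj eE) (exp_surj eE).
move=> [] [].
have -> : [set x | dom (tt : chart (family_mfd E')) (iota (point (tt : chart (family_mfd E)) x))] = setT.
  by apply/seteqP; split.
split; first exact: openT.
have := smooth_linear setT lex_natural_is_linear; by rewrite -inclusion_coord.
Qed.

Lemma bundle_coord_push_inclusion (u : tangent (family_affine E)) :
  bundle_coord (push iota u) = row_mx (lex_natural (natural u.1)) (lex_natural u.2).
Proof.
case: u => q v; rewrite /bundle_coord; congr row_mx.
  rewrite -[LHS]/(natural (iota q)) -[in LHS](naturalK eE q).
  by rewrite inclusion_of_natural (of_naturalK eE').
rewrite -[LHS]/('d ((coord (tt : chart (family_mfd E')) \o iota) \o point (tt : chart (family_mfd E))) (natural q) v).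
by rewrite inclusion_coord (diff_linear _ _ lex_natural_is_linear).
Qed.

End Segre.

Theorem proposition11p8 (R : realType) (n m : nat) (n_ge1 : (1 <= n)%N)
    (m_ge1 : (1 <= m)%N) (S : ordered_set n) (T : ordered_set m) :
  is_lift
    (M := family_affine (product_family (simplex S) (simplex T)))
    (N := prod_herm (CP R n) (CP R m))
    (prod_action (@proj_action R n) (@proj_action R m))
    (M' := family_affine (simplex (lex_product S T)))
    (N' := CP R (lex_dim n m))
    (@proj_action R (lex_dim n m))
    (@segre R n m)
    (@inclusion n m S T R).
Proof.
have eS := @simplex_exp_family R n S; have eT := @simplex_exp_family R m T.
have eE := product_exp_family eS eT.
have eE' := @simplex_exp_family R _ (lex_product S T).
have kP := @proj_pre_kahler R n; have kP' := @proj_pre_kahler R m.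
have kN := prod_pre_kahler kP kP'; have kN' := @proj_pre_kahler R (lex_dim n m).
have aN := prod_kahler_action kP kP' (@proj_kahler_action R n) (@proj_kahler_action R m).
have aN' := @proj_kahler_action R (lex_dim n m).
have tc : toric_cover (cov (E := product_family (simplex S) (simplex T))
    (product_stat (E := simplex S) (E' := simplex T) (@simplex_stat R n S) (@simplex_stat R m T)))
    (prod_action (@proj_action R n) (@proj_action R m)) (prod_cover toric_point toric_point).
  have -> : cov (E := product_family (simplex S) (simplex T))
    (product_stat (E := simplex S) (E' := simplex T) (@simplex_stat R n S) (@simplex_stat R m T)) = fun x v w =>
    cov (E := simplex S) (@simplex_stat R n S) (lsubmx x) (lsubmx v) (lsubmx w)
    + cov (E := simplex T) (@simplex_stat R m T) (rsubmx x) (rsubmx v) (rsubmx w).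
    by apply/funext => x; apply/funext => v; apply/funext => w; exact: cov_product.
  exact (prod_toric_cover kP kP' (@proj_kahler_action R n) (@proj_kahler_action R m) (proj_toric_cover S) (proj_toric_cover T)).
have tc' := @proj_toric_cover R _ (lex_product S T).
have nm_gt0 : (0 < n + m)%N by rewrite addn_gt0 n_ge1.
have lex_gt0 : (0 < lex_dim n m)%N by rewrite /lex_dim mulSn /= addn_gt0 m_ge1.
have cN : mconnected (prod_herm (CP R n) (CP R m)).
  (* The pair of points with all coordinates 1 lies in every chart. *)
  have nz k : const_mx 1 != 0 :> 'rV[R[i]]_k.+1.
    by apply/rV0Pn; exists ord0; rewrite mxE oner_neq0.
  apply: (full_connected (prod_full proj_full proj_full) (p0 := (hpoint (const_mx 1), hpoint (const_mx 1)))).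
    by move=> [i i']; split; rewrite dom_hpoint ?nz // mxE oner_neq0.
  by move=> [p p']; exists (prefer p, prefer p'); split; exact: proj_prefer.
split.
- apply: torificationP eE nm_gt0 kN aN tc cN _; exact: addnACA.
- exact: torificationP eE' lex_gt0 kN' aN' tc' proj_connected erefl.
- exact: segre_smooth.
- exact: inclusion_smooth.
exists (fun u => prod_cover toric_point toric_point (bundle_coord u)), (fun u => toric_point (bundle_coord u)).
split.
- exact: cover_compatible eE nm_gt0 kN aN tc.
- exact: cover_compatible eE' lex_gt0 kN' aN' tc'.
move=> u; rewrite bundle_coord_push_inclusion /toric_point.
have := toric_vec_lex (bundle_coord u); rewrite {1 2}/bundle_coord row_mxKl row_mxKr => ->.
by rewrite -segre_hpoint ?toric_vec_neq0.
Qed.
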